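(* Let $X:\mathbb{R}\to\mathbb{R}^d$ be a continuous, centered Gaussian process with stationary increments and independent components. Assume that its covariance function has finite $2$-dimensional $\varrho$-variation on every square $[s,t]^2$ in $\mathbb{R}^2$, for some $\varrho\in[1,2)$. Let $\overline{\mathbf{X}}$ be the natural lift of $X$ in the sense of Friz–Victoir, with sample paths in $\mathcal{C}_0^{0,p\text{-var}}(\mathbb{R},T_1^{\lfloor p\rfloor}(\mathbb{R}^d))$, for every $p>2\varrho$. Then (for every $p>2\varrho$) there exist a measurable metric dynamical system $(\Omega,\mathcal{F},\mathbb{P},\theta)$ and a $\mathcal{C}_0^{0,p\text{-var}}(\mathbb{R},T_1^{\lfloor p\rfloor}(\mathbb{R}^d))$-valued random variable $\mathbf{X}$ on $\Omega$ with the same law as $\overline{\mathbf{X}}$ which has the cocycle property $\mathbf{X}_{s,s+t}(\omega)=\mathbf{X}_t(\theta_s\omega)$ for every $\omega\in\Omega$ and all $s,t\in\mathbb{R}$.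
   Context: Stationary increments: the law of $(X_{t_0+h}-X_{t_0})_{h\in\mathbb{R}}$ does not depend on $t_0\in\mathbb{R}$. A function $R:[s,t]^2\to\mathbb{R}$ (for vector-valued $X$: the covariance functions of the components) has finite $2$-dimensional $\varrho$-variation if $$\sup_{\mathbb{D},\mathbb{D}'}\sum_{t_i\in\mathbb{D},t'_j\in\mathbb{D}'}\big|R(t_{i+1},t'_{j+1})-R(t_i,t'_{j+1})-R(t_{i+1},t'_j)+R(t_i,t'_j)\big|^{\varrho}<\infty,$$ supremum over finite subsets $\mathbb{D},\mathbb{D}'$ of $[s,t]$. With $E=\mathbb{R}^d$ and compatible norms on tensor powers ($|v\otimes w|=|w\otimes v|\le|v||w|$ and similarly for higher orders), $T_1^N(E)=\{(1,g^1,\dots,g^N):g^k\in E^{\otimes k}\}$ is a group for $\pi_k(g\otimes h)=\sum_{i=0}^kg^{k-i}\otimes h^i$ with unit $\mathbf{1}$; $\pi_k$ is the projection to level $k$; for a path $\mathbf{x}$ in $T_1^N(E)$, $\mathbf{x}_{s,t}:=\mathbf{x}_s^{-1}\otimes\mathbf{x}_t$. For a compact interval $I\ni0$, $\mathcal{C}_0^{0,1\text{-var}}(I,E)$ is the closure in $1$-variation norm of the smooth paths $x:I\to E$ with $x_0=0$. The canonical lift $S_N(x)$ has $S_N(x)_0=\mathbf{1}$ and $\pi_k(S_N(x)_s^{-1}\otimes S_N(x)_t)=\int_{s<u_1<\dots<u_k<t}dx_{u_1}\otimes\cdots\otimes dx_{u_k}$ for $s\le t$. With $$d_{p\text{-var};I}(\mathbf{x},\mathbf{y})=\max_{k=1,\dots,N}\Big(\sup_{\mathbb{D}}\sum_{t_i\in\mathbb{D}}|\pi_k(\mathbf{x}_{t_i,t_{i+1}}-\mathbf{y}_{t_i,t_{i+1}})|^{p/k}\Big)^{1/p},$$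 $\mathcal{C}_0^{0,p\text{-var}}(I,T_1^N(E))$ is the set of continuous $\mathbf{x}:I\to T_1^N(E)$ with $\mathbf{x}_0=\mathbf{1}$ that are $d_{p\text{-var};I}$-limits of $S_N(x_n)$, $x_n\in\mathcal{C}_0^{0,1\text{-var}}(I,E)$. $\mathcal{C}_0^{0,p\text{-var}}(\mathbb{R},T_1^N(E))$ is the set of continuous $\mathbf{x}:\mathbb{R}\to T_1^N(E)$ whose restriction to each compact interval $I\ni0$ belongs to $\mathcal{C}_0^{0,p\text{-var}}(I,T_1^N(E))$, with the coarsest topology making all restriction maps continuous and its Borel $\sigma$-algebra. Natural (Friz–Victoir) lift: the process $\overline{\mathbf{X}}$ whose restriction to each $[-L,L]$, $L\ge1$, is the limit in probability, in $d_{p\text{-var};[-L,L]}$, of the canonical lifts $S_{\lfloor p\rfloor}$ of piecewise linear approximations (equivalently, of mollifications) of $X-X_0$ as the mesh (mollification parameter) tends to $0$; it exists for every $p>2\varrho$ under the stated assumption. A measurable metric dynamical system $(\Omega,\mathcal{F},\mathbb{P},\theta)$ is a probability space with maps $\theta_t:\Omega\to\Omega$, $t\in\mathbb{R}$, such that $(\omega,t)\mapsto\theta_t\omega$ is $\mathcal{F}\otimes\mathcal{B}(\mathbb{R})/\mathcal{F}$-measurable, $\theta_0=\mathrm{Id}$, $\theta_{s+t}=\theta_s\circ\theta_t$, and $\mathbb{P}\circ\theta_t^{-1}=\mathbb{P}$ for all $t$. *)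

(* Defs.v *)
From HB Require Import structures.
From mathcomp Require Import all_boot all_order all_algebra.
From mathcomp Require Import all_classical all_reals all_analysis.

Set Implicit Arguments.
Unset Strict Implicit.
Unset Printing Implicit Defensive.

Import Order.TTheory GRing.Theory Num.Theory.
Import numFieldNormedType.Exports.

Local Open Scope classical_set_scope.
Local Open Scope ring_scope.

Section truncated_tensor_algebra.
Context {R : realType} {d : nat}.

(* Homogeneous tensors of (R^d)^{(x) k}, by their coordinates in the canonical
   basis e_{i_1} (x) ... (x) e_{i_k}. *)
Definition tensor (k : nat) : Type := {ffun k.-tuple 'I_d -> R}.
HB.instance Definition _ k := GRing.Zmodule.copy (tensor k) {ffun k.-tuple 'I_d -> R}.

Definition tensor_scale k (a : R) (v : tensor k) : tensor k :=
  [ffun u => a * (v : {ffun _ -> _}) u].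

Definition tensor_prod k l (v : tensor k) (w : tensor l) : tensor (k + l) :=
  [ffun u : (k + l).-tuple 'I_d =>
     (v : {ffun _ -> _}) [tuple tnth u (lshift l i) | i < k] *
     (w : {ffun _ -> _}) [tuple tnth u (rshift k j) | j < l]].

Definition tensor1 (v : 'rV[R]_d) : tensor 1 := [ffun u => v ord0 (thead u)].

(* Truncated tensor series T^N(R^d): level k is given by the coefficients of
   the words of length k. *)
Definition tseries (N : nat) : Type := {ffun N.-bseq 'I_d -> R}.
HB.instance Definition _ N := GRing.Zmodule.copy (tseries N) {ffun N.-bseq 'I_d -> R}.

(* Junk (the coefficient of the empty word) on words longer than N. *)
Definition tcoef N (g : tseries N) (w : seq 'I_d) : R :=
  (g : {ffun _ -> _}) (insub_bseq N w).

Definition tlevel N (k : nat) (g : tseries N) : tensor k :=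
  [ffun u : k.-tuple 'I_d => tcoef g u].

Section ring.
Context {N : nat}.
Implicit Types g h l : tseries N.

Definition tseries_one : tseries N := [ffun w : N.-bseq _ => (size w == 0)%:R].

Definition tseries_mul g h : tseries N :=
  [ffun w : N.-bseq _ => \sum_(i < (size w).+1) tcoef g (take i w) * tcoef h (drop i w)].

Lemma insub_bseqK (w : seq 'I_d) : (size w <= N)%N -> insub_bseq N w = w :> seq _.
Proof. by move=> h; rewrite /insub_bseq insubdK. Qed.

Lemma insub_bseq_id (w : N.-bseq 'I_d) : insub_bseq N w = w.
Proof. by apply: val_inj; apply: insub_bseqK; exact: size_bseq. Qed.

Lemma tcoefE g (w : N.-bseq 'I_d) : tcoef g w = (g : {ffun _ -> _}) w.
Proof. by rewrite /tcoef insub_bseq_id. Qed.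

Lemma tseriesP g h :
  (forall w : seq 'I_d, (size w <= N)%N -> tcoef g w = tcoef h w) -> g = h.
Proof.
move=> gh; apply/ffunP => w; rewrite -!tcoefE; exact/gh/size_bseq.
Qed.

Lemma tcoefD g h w : tcoef (g + h) w = tcoef g w + tcoef h w.
Proof. by rewrite /tcoef ffunE. Qed.

Lemma tcoef_one (w : seq 'I_d) : (size w <= N)%N ->
  tcoef tseries_one w = (size w == 0)%:R.
Proof. by move=> h; rewrite /tcoef ffunE insub_bseqK. Qed.

Lemma tcoef_mul g h (w : seq 'I_d) : (size w <= N)%N ->
  tcoef (tseries_mul g h) w =
  \sum_(i < (size w).+1) tcoef g (take i w) * tcoef h (drop i w).
Proof. by move=> hw; rewrite /tcoef ffunE insub_bseqK. Qed.

Lemma tseries_mulA : associative tseries_mul.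
Proof.
move=> g h l; apply: tseriesP => w wN; rewrite !tcoef_mul//.
have twN i : (size (take i w) <= N)%N.
  by rewrite size_take_min (leq_trans (geq_minr _ _)).
have dwN i : (size (drop i w) <= N)%N.
  by rewrite size_drop (leq_trans (leq_subr _ _)).
pose F (i m : nat) := tcoef g (take i w) * tcoef h (drop i (take m w)) *
  tcoef l (drop m w).
transitivity (\sum_(0 <= i < (size w).+1)
    \sum_(0 <= m < (size w).+1 | (i <= m)%N) F i m).
  rewrite big_mkord; apply: eq_bigr => i _; rewrite tcoef_mul//.
  have -> : \sum_(0 <= m < (size w).+1 | (i <= m)%N) F i m =
      \sum_(i <= m < (size w).+1) F i m by rewrite (big_nat_widenl i 0).
  rewrite -[X in \sum_(X <= _ < _) _]add0n big_addn subSn; last by rewrite -ltnS.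
  rewrite big_mkord big_distrr/= size_drop; apply: eq_bigr => j _.
  by rewrite mulrA /F take_drop drop_drop.
transitivity (\sum_(0 <= m < (size w).+1)
    \sum_(0 <= i < (size w).+1 | (i <= m)%N) F i m).
  by apply: (exchange_big_dep_nat (P := xpredT)
    (Q := fun i m => (i <= m)%N) xpredT).
rewrite big_mkord; apply: eq_bigr => m _.
have mw : (m <= size w)%N by rewrite -ltnS.
rewrite tcoef_mul// big_distrl/= size_takel//.
rewrite -(big_mkord xpredT (fun i => tcoef g (take i (take m w)) *
  tcoef h (drop i (take m w)) * tcoef l (drop m w))).
rewrite (big_nat_widen 0 m.+1 (size w).+1)// [RHS]big_nat_cond [LHS]big_nat_cond.
apply: eq_big => [i|i /andP[_ im]]; first by rewrite /= ltnS.
by rewrite /F take_takel.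
Qed.

Lemma tseries_mul1r : left_id tseries_one tseries_mul.
Proof.
move=> g; apply: tseriesP => w wN; rewrite tcoef_mul// big_ord_recl/=.
rewrite take0 drop0 tcoef_one// mul1r big1 ?addr0// => i _.
by rewrite tcoef_one ?(leq_trans _ wN) ?size_takel ?mul0r.
Qed.

Lemma tseries_mulr1 : right_id tseries_one tseries_mul.
Proof.
move=> g; apply: tseriesP => w wN; rewrite tcoef_mul// big_ord_recr/=.
rewrite take_size drop_size tcoef_one// mulr1 big1 ?add0r// => i _.
rewrite tcoef_one ?size_drop ?(leq_trans (leq_subr _ _))//.
by rewrite subn_eq0 leqNgt ltn_ord mulr0.
Qed.

Lemma tseries_mulDl : left_distributive tseries_mul +%R.
Proof.
move=> g h l; apply: tseriesP => w wN; rewrite tcoefD !tcoef_mul//.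
by rewrite -big_split; apply: eq_bigr => i _; rewrite tcoefD mulrDl.
Qed.

Lemma tseries_mulDr : right_distributive tseries_mul +%R.
Proof.
move=> g h l; apply: tseriesP => w wN; rewrite tcoefD !tcoef_mul//.
by rewrite -big_split; apply: eq_bigr => i _; rewrite tcoefD mulrDr.
Qed.

HB.instance Definition _ := GRing.Zmodule_isPzRing.Build (tseries N)
  tseries_mulA tseries_mul1r tseries_mulr1 tseries_mulDl tseries_mulDr.

Lemma tcoef1 (w : seq 'I_d) : (size w <= N)%N ->
  tcoef (1 : tseries N) w = (size w == 0)%:R.
Proof. exact: tcoef_one. Qed.

Lemma tcoefM g h (w : seq 'I_d) : (size w <= N)%N -> tcoef (g * h) w =
  \sum_(i < (size w).+1) tcoef g (take i w) * tcoef h (drop i w).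
Proof. exact: tcoef_mul. Qed.

Lemma tcoefM0 g h : tcoef (g * h) [::] = tcoef g [::] * tcoef h [::].
Proof. by rewrite tcoefM// big_ord1. Qed.

Lemma tcoefB g h w : tcoef (g - h) w = tcoef g w - tcoef h w.
Proof. by rewrite tcoefD /tcoef ffunE. Qed.

Lemma tcoef_expr_lt g n (w : seq 'I_d) : tcoef g [::] = 0 ->
  (size w <= N)%N -> (size w < n)%N -> tcoef (g ^+ n) w = 0.
Proof.
move=> g0; elim: n w => // n IH w wN wn; rewrite exprS tcoefM//.
rewrite big_ord_recl/= take0 g0 mul0r add0r big1// => i _.
have iw : (i < size w)%N by [].
have dw : size (drop (lift ord0 i) w) = (size w - i.+1)%N by rewrite size_drop.
rewrite IH ?mulr0// dw; first by rewrite (leq_trans (leq_subr _ _)).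
by rewrite (leq_trans _ (wn : size w <= n)%N)// ltn_subrL (leq_trans _ iw).
Qed.

Lemma tseries_nilpotent g : tcoef g [::] = 0 -> g ^+ N.+1 = 0.
Proof.
move=> g0; apply: tseriesP => w wN; rewrite tcoef_expr_lt//.
by rewrite /tcoef ffunE.
Qed.

(* The Neumann series of 1 - g, which is nilpotent when g has constant
   coefficient 1. *)
Definition tseries_inv g : tseries N := \sum_(i < N.+1) (1 - g) ^+ i.

End ring.

(* The group T_1^N(R^d). *)
Definition T1 (N : nat) : Type := {g : tseries N | tcoef g [::] == 1}.
HB.instance Definition _ N :=
  SubChoice.copy (T1 N) {g : tseries N | tcoef g [::] == 1}.

Section group.
Context {N : nat}.
Implicit Types g h : T1 N.

Lemma T1P g : tcoef (val g) [::] = 1. Proof. exact/eqP/(valP g). Qed.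

Lemma T1_one_subproof : tcoef (1 : tseries N) [::] == 1.
Proof. by rewrite tcoef1. Qed.

Lemma T1_mul_subproof g h : tcoef (val g * val h) [::] == 1.
Proof. by rewrite tcoefM0 !T1P mulr1. Qed.

Lemma T1_inv_subproof g : tcoef (tseries_inv (val g)) [::] == 1.
Proof.
rewrite /tseries_inv big_ord_recl expr0 tcoefD tcoef1//=.
set S := \sum_(i < N) _; suff -> : tcoef S [::] = 0 by rewrite addr0.
rewrite /S; apply: (big_ind (fun g : tseries N => tcoef g [::] = 0)).
- by rewrite /tcoef ffunE.
- by move=> x y x0 y0; rewrite tcoefD x0 y0 addr0.
- by move=> i _; rewrite tcoef_expr_lt// tcoefB tcoef1// T1P subrr.
Qed.

Definition T1_one : T1 N := exist _ (1 : tseries N) T1_one_subproof.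
Definition T1_mul g h : T1 N := exist _ (val g * val h) (T1_mul_subproof g h).
Definition T1_inv g : T1 N := exist _ (tseries_inv (val g)) (T1_inv_subproof g).

Lemma T1_mulA : associative T1_mul.
Proof. by move=> g h l; apply: val_inj; rewrite /= mulrA. Qed.

Lemma T1_mul1 : left_id T1_one T1_mul.
Proof. by move=> g; apply: val_inj; rewrite /= mul1r. Qed.

Lemma T1_mulg1 : right_id T1_one T1_mul.
Proof. by move=> g; apply: val_inj; rewrite /= mulr1. Qed.

Lemma T1_nilpotent g : (1 - val g) ^+ N.+1 = 0.
Proof. by rewrite tseries_nilpotent// tcoefB tcoef1// T1P subrr. Qed.

Lemma T1_mulgV : right_inverse T1_one T1_inv T1_mul.
Proof.
move=> g; apply: val_inj; rewrite /= /tseries_inv.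
have /eqP := subrX1 (1 - val g) N.+1; rewrite T1_nilpotent sub0r.
by rewrite addrAC subrr sub0r mulNr eqr_opp => /eqP.
Qed.

Lemma T1_mulVg : left_inverse T1_one T1_inv T1_mul.
Proof.
move=> g; have e := T1_mulgV (T1_inv g).
by rewrite -[X in T1_mul _ X]T1_mulg1 -[X in T1_mul _ (T1_mul _ X)]e
  [X in T1_mul _ X]T1_mulA T1_mulgV T1_mul1.
Qed.

HB.instance Definition _ := isGroup.Build (T1 N)
  T1_mulA T1_mul1 T1_mulg1 T1_mulVg T1_mulgV.

End group.
End truncated_tensor_algebra.

Arguments tensor : clear implicits.
Arguments tseries : clear implicits.
Arguments T1 : clear implicits.

(* Compatible norms on the tensor powers of E = R^d; nonnegativity follows from
   tnormD and tnormZ. *)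
Record tensor_norm (R : realType) (d : nat) := TensorNorm {
  tnorm :> forall k, tensor R d k -> R;
  tnormD : forall k (v w : tensor R d k), tnorm (v + w) <= tnorm v + tnorm w;
  tnormZ : forall k (a : R) (v : tensor R d k),
    tnorm (tensor_scale a v) = `|a| * tnorm v;
  tnorm0_eq0 : forall k (v : tensor R d k), tnorm v = 0 -> v = 0;
  tnormC : forall k l (v : tensor R d k) (w : tensor R d l),
    tnorm (tensor_prod v w) = tnorm (tensor_prod w v);
  tnormM : forall k l (v : tensor R d k) (w : tensor R d l),
    tnorm (tensor_prod v w) <= tnorm v * tnorm w }.

Section variation.
Context {R : realType}.

(* Finite subsets of [a, b], enumerated increasingly. *)
Definition finite_subset (a b : R) : set (seq R) :=
  [set D | sorted <%R D /\ {in D, forall t, a <= t <= b}].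

Definition rect_increment (K : R -> R -> R) (u u' v v' : R) : R :=
  K u' v' - K u v' - K u' v + K u v.

Definition finite_2d_variation (rho s t : R) (K : R -> R -> R) : Prop :=
  (ereal_sup [set (\sum_(i < (size D.1).-1) \sum_(j < (size D.2).-1)
      `|rect_increment K D.1`_i D.1`_i.+1 D.2`_j D.2`_j.+1| `^ rho)%:E
    | D in finite_subset s t `*` finite_subset s t] < +oo)%E.

(* The largest gap between consecutive points of a :: s. *)
Definition mesh (a : R) (s : seq R) : R :=
  \big[Num.max/0]_(j < size s) ((a :: s)`_j.+1 - (a :: s)`_j).

Definition riemann_stieltjes_sum (f g : R -> R) (a : R) (s xi : seq R) : R :=
  \sum_(j < size s) f xi`_j * (g (a :: s)`_j.+1 - g (a :: s)`_j).

Definition is_RS_integral (f g : R -> R) (a b v : R) : Prop :=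
  forall e, 0 < e -> exists2 del, 0 < del &
    forall s xi : seq R, itv_partition a b s -> mesh a s < del ->
      (forall j, (j < size s)%N -> (a :: s)`_j <= xi`_j <= (a :: s)`_j.+1) ->
      `|riemann_stieltjes_sum f g a s xi - v| < e.

(* Junk value 0 when the Riemann-Stieltjes sums do not converge. *)
Definition RS_integral (f g : R -> R) (a b : R) : R :=
  xget 0 [set v | is_RS_integral f g a b v].

(* Piecewise linear interpolation of x along the points a :: s. *)
Fixpoint pl_interp d (x : R -> 'rV[R]_d) (a : R) (s : seq R) (u : R) : 'rV[R]_d :=
  if s is b :: s' then
    if u <= b then x a + ((u - a) / (b - a)) *: (x b - x a)
    else pl_interp x b s' u
  else x a.

End variation.

Section rough_paths.
Context {R : realType} {d : nat}.
Implicit Types (nrm : tensor_norm R d) (x y : R -> 'rV[R]_d) (a b p : R).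

(* A path on [a, b] is represented by a function on R of which only the values
   on [a, b] matter; smooth paths on [a, b] are the restrictions of smooth
   functions on R. *)
Definition smooth_path x : Prop :=
  forall (i : 'I_d) (n : nat) (t : R),
    derivable (derive1n n (fun u => x u ord0 i)) t 1.

Definition one_variation nrm a b x : \bar R :=
  ereal_sup [set (\sum_(i < (size D).-1)
    nrm 1%N (tensor1 (x D`_i.+1 - x D`_i)))%:E | D in finite_subset a b].

Definition C0_1var nrm a b : set (R -> 'rV[R]_d) :=
  [set x | x 0 = 0 /\ forall e, 0 < e -> exists y,
    [/\ smooth_path y, y 0 = 0 &
        (one_variation nrm a b (fun t => (x t - y t)%R) < e%:E)%E]].

(* The coordinate w = i_1 ... i_k of the k-fold iterated integral
   int_{s < u_1 < ... < u_k < t} dx_{u_1} (x) ... (x) dx_{u_k}. *)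
Definition iterated_integral x (w : seq 'I_d) (s t : R) : R :=
  foldl (fun F i u => RS_integral F (fun r => x r ord0 i) s u) (fun=> 1) w t.

Definition incr N (X : R -> T1 R d N) (s t : R) : T1 R d N := ((X s)^-1 * X t)%g.

Definition is_canonical_lift N a b x (S : R -> T1 R d N) : Prop :=
  S 0 = 1%g /\ forall s t, a <= s -> s <= t -> t <= b ->
    forall w : seq 'I_d, (size w <= N)%N ->
      tcoef (val (incr S s t)) w = iterated_integral x w s t.

(* The lift is determined on [a, b] (take s = 0 or t = 0); its values outside
   [a, b] are arbitrary. *)
Definition canonical_lift N a b x : R -> T1 R d N :=
  xget (fun=> 1%g) [set S | is_canonical_lift a b x S].

Definition d_pvar nrm N p a b (X Y : R -> T1 R d N) : \bar R :=
  (\big[maxe/0]_(1 <= k < N.+1)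
    (ereal_sup [set (\sum_(i < (size D).-1)
        nrm k (tlevel k (val (incr X D`_i D`_i.+1) - val (incr Y D`_i D`_i.+1)))
          `^ (p / k%:R))%:E | D in finite_subset a b]) `^ p^-1)%E.

Definition C0_pvar_on nrm p a b : set (R -> T1 R d (Num.truncn p)) :=
  [set X : R -> T1 R d (Num.truncn p) |
    [/\ forall w, {within `[a, b], continuous (fun t => tcoef (val (X t)) w)},
    X 0 = 1%g &
    exists2 x : nat -> R -> 'rV[R]_d, (forall n, C0_1var nrm a b (x n)) &
      d_pvar nrm p a b X (canonical_lift _ a b (x n)) @[n --> \oo] --> 0%E]].

Definition C0_pvar nrm p : set (R -> T1 R d (Num.truncn p)) :=
  [set X : R -> T1 R d (Num.truncn p) |
    (forall w, continuous (fun t => tcoef (val (X t)) w)) /\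
    forall a b, a <= 0 <= b -> @C0_pvar_on nrm p a b X].

Lemma fine_partition (a b e : R) : a <= b -> 0 < e ->
  exists2 s, itv_partition a b s & mesh a s < e.
Proof.
move=> + e0; have h0 : 0 < e / 2 by rewrite divr_gt0.
have he : e / 2 < e by rewrite ltr_pdivrMr// ltr_pMr// ltr1n.
suff H n : forall a, a <= b -> b - a <= n%:R * (e / 2) ->
    exists2 s, itv_partition a b s & mesh a s < e.
  move=> ab; apply: (H (Num.bound ((b - a) / (e / 2)))) => //.
  rewrite -ler_pdivrMr//; apply/ltW/archi_boundP.
  by rewrite divr_ge0 ?subr_ge0// ltW.
elim: n => [|n IH] {}a ab.
  rewrite mul0r subr_le0 => ba; exists [::]; last by rewrite /mesh big_ord0.
  by split => //=; rewrite eq_le ab ba.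
move=> bn; have [bah|bah] := leP (b - a) (e / 2).
  move: ab; rewrite le_eqVlt => /predU1P[->|ab].
    by exists [::]; [split => /=|rewrite /mesh big_ord0].
  exists [:: b]; first by split => //=; rewrite ab.
  by rewrite /mesh big_ord_recl big_ord0/= gt_max (le_lt_trans bah he).
have [||s [ps /eqP ls] ms] := IH (a + e / 2).
- by rewrite -lerBrDl ltW.
- by rewrite opprD addrA lerBlDr (le_trans bn)// -natr1 mulrDl mul1r.
exists (a + e / 2 :: s); first by split => /=; [rewrite ltrDl h0|rewrite ls].
rewrite /mesh big_ord_recl/= gt_max addrAC subrr add0r he/=.
exact: ms.
Qed.

Lemma RS_integral_cst (f : R -> R) (c a b : R) : a <= b ->
  RS_integral f (fun=> c) a b = 0.
Proof.
move=> ab; apply: xget_unique.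
  move=> e e0; exists 1 => // s xi _ _ _.
  by rewrite /riemann_stieltjes_sum big1 => [|i _]; rewrite /= subrr ?normr0 ?mulr0.
move=> v hv; apply/eqP; apply/negPn/negP => v0.
have [del del0] := hv `|v| (etrans (normr_gt0 _) v0).
have [s ps ms] := fine_partition ab del0.
move=> /(_ s s ps ms); rewrite /riemann_stieltjes_sum big1; last first.
  by move=> i _; rewrite /= subrr mulr0.
rewrite sub0r normrN ltxx; suff /[swap]/[apply]: forall j, (j < size s)%N ->
  (a :: s)`_j <= s`_j <= (a :: s)`_j.+1 by [].
move=> j js /=; rewrite lexx andbT ltW//.
by have [/(pathP 0)/(_ _ js)] := ps.
Qed.

Lemma iterated_integral0 (w : seq 'I_d) (s t : R) : s <= t ->
  iterated_integral (fun=> 0) w s t = (size w == 0)%:R.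
Proof.
move=> st; rewrite /iterated_integral; case/lastP: w => //= w i.
rewrite foldl_rcons size_rcons.
by rewrite [X in RS_integral _ X](_ : _ = fun=> 0) ?RS_integral_cst//; apply/funext => r; rewrite /= mxE.
Qed.

Lemma is_canonical_lift0 N a b :
  is_canonical_lift a b (fun=> 0) (fun=> 1%g : T1 R d N).
Proof.
split=> // s t _ st _ w wN; rewrite iterated_integral0//.
by rewrite /incr mulVg tcoef1.
Qed.

Lemma C0_pvar_on_one nrm p a b : @C0_pvar_on nrm p a b (fun=> 1%g).
Proof.
have tn0 k : nrm k 0 = 0.
  have := tnormZ nrm 0 (0 : tensor R d k); rewrite normr0 mul0r => <-.
  by congr (nrm _ _); apply/ffunP => u; rewrite !ffunE mul0r.
split => //; first by move=> w; apply: continuous_subspaceT => t; exact: cvg_cst.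
exists (fun _ _ => 0) => [_|].
  split=> // e e0; exists (fun=> 0); split => //.
    move=> i n t; suff -> : derive1n n (fun u => (0 : 'rV[R]_d) ord0 i) = fun=> 0.
      exact: derivable_cst.
    elim: n => [|n IH]; first by apply/funext => r; rewrite /= mxE.
    by rewrite derive1nS IH; apply/funext => r; rewrite derive1_cst.
  apply: (@le_lt_trans _ _ 0%E); last by rewrite lte_fin.
  apply: ge_ereal_sup => _ [D _ <-]; rewrite big1// => i _.
  by rewrite !subrr (_ : tensor1 0 = 0) ?tn0//; apply/ffunP => u; rewrite !ffunE mxE.
rewrite (_ : (fun _ => _) = fun=> 0%E); first exact: cvg_cst.
apply/funext => _; apply/eqP.
have [S0 Sincr] : is_canonical_lift a b (fun=> 0)
    (canonical_lift (Num.truncn p) a b (fun=> 0)).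
  have ex : exists S, [set S : R -> T1 R d (Num.truncn p) |
      is_canonical_lift a b (fun=> 0) S] S.
    by exists (fun=> 1%g); exact: is_canonical_lift0.
  exact: (xgetPex _ ex).
rewrite /d_pvar big_nat_cond; apply/eqP.
apply: (big_ind (fun z => z = 0%E)) => // [x y -> ->|k]; first by rewrite maxxx.
rewrite andbT => /andP[k1 kp].
have p0 : p != 0.
  by apply: contraTneq kp => ->; rewrite truncn0 -leqNgt.
rewrite (_ : ereal_sup _ = 0%E) ?poweR0r ?invr_eq0//.
apply/eqP; rewrite eq_le; apply/andP; split.
  apply: ge_ereal_sup => _ [D [Ds Dab] <-]; rewrite big1// => i _.
  have iD : (i.+1 < size D)%N by rewrite -ltn_predRL.
  have iD' := ltnW iD.
  have Dle : D`_i <= D`_i.+1 by exact/ltW/(sortedP 0 Ds).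
  have /andP[aD _] := Dab _ (mem_nth 0 iD').
  have /andP[_ Db] := Dab _ (mem_nth 0 iD).
  rewrite (_ : _ - _ = 0); last first.
    apply: tseriesP => w wN; rewrite tcoefB Sincr// iterated_integral0//.
    by rewrite /incr mulVg tcoef1// subrr /tcoef ffunE.
  rewrite (_ : tlevel k 0 = 0) ?tn0 ?powR0 ?mulf_neq0 ?invr_eq0 ?pnatr_eq0 -?lt0n//.
  by apply/ffunP => u; rewrite ffunE /tcoef !ffunE.
apply: ereal_sup_ubound; exists [::]; first by split.
by rewrite big_ord0.
Qed.

Lemma C0_pvar_one nrm p : @C0_pvar nrm p (fun=> 1%g).
Proof.
by split=> [w t|a b ab]; [exact: cvg_cst|exact: C0_pvar_on_one].
Qed.

End rough_paths.

Arguments C0_1var {R d} nrm a b _.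
Arguments C0_pvar_on {R d} nrm p a b _.
Arguments C0_pvar {R d} nrm p _.
Arguments canonical_lift {R d} N a b x _.

Section path_spaces.
Context {R : realType} {d : nat}.
Implicit Types (nrm : tensor_norm R d) (p : R).

Definition rough_path_on nrm p (I : R * R) : Type :=
  {X : R -> T1 R d (Num.truncn p) | X \in C0_pvar_on nrm p I.1 I.2}.

HB.instance Definition _ nrm p I := SubChoice.copy (rough_path_on nrm p I)
  {X : R -> T1 R d (Num.truncn p) | X \in C0_pvar_on nrm p I.1 I.2}.

(* The topology of the metric d_pvar on C_0^{0,p-var}([a, b], T_1^N(E)),
   I = (a, b). *)
Definition d_pvar_open nrm p I : set (set (rough_path_on nrm p I)) :=
  [set U | forall X, U X -> exists2 r : R, 0 < r &
    forall Y, (d_pvar nrm p I.1 I.2 (val X) (val Y) < r%:E)%E -> U Y].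

Section d_pvar_topology.
Context nrm p (I : R * R).

Lemma d_pvar_openT : @d_pvar_open nrm p I setT.
Proof. by move=> X _; exists 1. Qed.

Lemma d_pvar_openI : setI_closed (@d_pvar_open nrm p I).
Proof.
move=> U V oU oV X [/oU[r r0 rU] /oV[s s0 sV]].
exists (Num.min r s) => [|Y XY]; first by rewrite lt_min r0.
by split; [apply: rU|apply: sV]; apply: (lt_le_trans XY);
  rewrite lee_fin ge_min lexx ?orbT.
Qed.

Lemma d_pvar_open_bigU (J : Type) (f : J -> set (rough_path_on nrm p I)) :
  (forall j, d_pvar_open (f j)) -> d_pvar_open (\bigcup_j f j).
Proof.
by move=> of_ X [j _ /of_[r r0 rf]]; exists r => // Y XY; exists j => //; exact: rf.
Qed.

HB.instance Definition _ := isOpenTopological.Build (rough_path_on nrm p I)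
  d_pvar_openT d_pvar_openI d_pvar_open_bigU.

End d_pvar_topology.

(* The space C_0^{0,p-var}(R, T_1^{floor p}(R^d)). *)
Definition rough_path nrm p : Type :=
  {X : R -> T1 R d (Num.truncn p) | X \in C0_pvar nrm p}.

HB.instance Definition _ nrm p := SubChoice.copy (rough_path nrm p)
  {X : R -> T1 R d (Num.truncn p) | X \in C0_pvar nrm p}.

Definition rough_path_fun nrm p (X : rough_path nrm p) :
  R -> T1 R d (Num.truncn p) := val X.

(* Compact intervals containing 0, by their endpoints. *)
Definition itv0 := {I : R * R | I.1 <= 0 <= I.2}.

Lemma restrict_path_subproof nrm p (I : itv0) (X : rough_path nrm p) :
  val X \in C0_pvar_on nrm p (val I).1 (val I).2.
Proof. by have /set_mem[_ /(_ _ _ (valP I))/mem_set] := valP X. Qed.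

Definition restrict_path nrm p (I : itv0) (X : rough_path nrm p) :
  rough_path_on nrm p (val I) := exist _ (val X) (restrict_path_subproof I X).

(* The coarsest topology making all restrictions continuous. *)
HB.instance Definition _ nrm p :=
  Topological.copy (rough_path nrm p)
   (sup_topology (fun I : itv0 =>
    Topological.class (initial_topology (@restrict_path nrm p I)))).

HB.instance Definition _ nrm p := isPointed.Build (rough_path nrm p)
  (exist _ (fun=> 1%g) (mem_set (C0_pvar_one nrm p))).

(* The Borel sigma-algebra of this topology. *)
HB.instance Definition _ nrm p := Measurable.copy (rough_path nrm p)
  (g_sigma_algebraType (@open (rough_path nrm p))).

End path_spaces.

Arguments rough_path {R d} nrm p.

Section gaussian_processes.
Context {R : realType} {d : nat} {disp : measure_display}
  {Omega : measurableType disp} (P : probability Omega R).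
Implicit Type X : 'I_d -> R -> {RV P >-> R}.

Definition continuous_paths X : Prop :=
  forall i omega, continuous (fun t => X i t omega).

(* Normal laws include the degenerate ones, for which normal_prob is not the
   Dirac mass. *)
Definition gaussian_law (m sigma : R) : set R -> \bar R :=
  fun B => if sigma == 0 then \d_m B else normal_prob m sigma B.

(* All finite linear combinations of the coordinates are normal. *)
Definition gaussian_process X : Prop :=
  forall (n : nat) (t : 'I_n -> R) (c : 'I_n -> 'I_d -> R),
  exists m sigma : R, forall B : set R, measurable B ->
    P ((fun omega => \sum_(j < n) \sum_(i < d) c j i * X i (t j) omega) @^-1` B)
    = gaussian_law m sigma B.

Definition centered X : Prop := forall i t, ('E_P[X i t] = 0)%E.

(* The product sigma-algebra on the set of functions from R to R^d. *)
Definition cylinder_sigma_algebra : set (set (R -> 'I_d -> R)) :=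
  <<s [set A | exists t i, exists2 B : set R, measurable B &
         A = [set x | B (x t i)]] >>.

Definition stationary_increments X : Prop :=
  forall (t0 t1 : R) (A : set (R -> 'I_d -> R)), cylinder_sigma_algebra A ->
    P ((fun omega h i => X i (t0 + h) omega - X i t0 omega) @^-1` A) =
    P ((fun omega h i => X i (t1 + h) omega - X i t1 omega) @^-1` A).

Definition component_sigma_algebra X (i : 'I_d) : set (set Omega) :=
  <<s [set A | exists t, exists2 B : set R, measurable B & A = X i t @^-1` B] >>.

Definition independent_components X : Prop :=
  forall A : 'I_d -> set Omega, (forall i, component_sigma_algebra X i (A i)) ->
    P (\bigcap_i A i) = (\prod_(i < d) fine (P (A i)))%:E.

Definition cov X (i : 'I_d) (u v : R) : R := fine (covariance P (X i u) (X i v)).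

(* The path of X - X_0. *)
Definition path_of X (omega : Omega) (t : R) : 'rV[R]_d :=
  \row_i (X i t omega - X i 0 omega).

(* Xbar is, on each [-L, L], the limit in probability for d_pvar of the canonical
   lifts of the piecewise linear approximations of X - X_0, as the mesh of the partition of [-L, L] tends to 0. *)
Definition natural_lift (nrm : tensor_norm R d) (p : R) X
    (Xbar : {RV P >-> rough_path nrm p}) : Prop :=
  forall L : nat, (1 <= L)%N -> forall eps del : R, 0 < eps -> 0 < del ->
  exists2 eta : R, 0 < eta & forall s : seq R,
    itv_partition (- L%:R) L%:R s -> mesh (- L%:R) s < eta ->
    (P [set omega | (eps%:E < d_pvar nrm p (- L%:R) L%:R
          (canonical_lift (Num.truncn p) (- L%:R) L%:R
             (pl_interp (path_of X omega) (- L%:R) s))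
          (rough_path_fun (Xbar omega)))%E] <= del%:E)%E.

Definition metric_dynamical_system (theta : R -> Omega -> Omega) : Prop :=
  [/\ measurable_fun [set: Omega * R] (fun z => theta z.2 z.1),
      theta 0 = id,
      forall s t, theta (s + t) = theta s \o theta t &
      forall t A, measurable A -> P (theta t @^-1` A) = P A].

End gaussian_processes.

(* Main.v *)
Require Import Defs.
From HB Require Import structures.
From mathcomp Require Import all_boot all_order all_algebra.
From mathcomp Require Import all_classical all_reals all_analysis.
From mathcomp Require Import measurable_realfun.
From mathcomp Require Import ring lra.

Set Implicit Arguments.
Unset Strict Implicit.
Unset Printing Implicit Defensive.

Import Order.TTheory GRing.Theory Num.Theory.
Import numFieldNormedType.Exports.

Local Open Scope classical_set_scope.
Local Open Scope ring_scope.

(** The dynamical system is the path space itself: Omega is the space of rough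
    paths with its Borel sigma-algebra, P is the law of Xbar, the shift maps a path
    Y to t |-> Y_s^-1 Y_(s + t), and the random variable is the identity. The
    cocycle property and the flow property are then identities in the group. What
    has to be shown is that the shift maps the space into itself, that it is jointly
    measurable in the path and in time, and that it preserves P.

    Stability of the space. If a rough path is close in p-variation to the lift of
    x, then its shift is close to the shifted lift, which is the lift of the
    shifted path because iterated integrals are invariant under translations
    (is_canonical_lift_shift, C0_pvar_shift). Approximating paths whose iterated
    integrals do not form a lift have, by convention, the constant canonical lift,
    and can be replaced by the zero path (C0_pvar_on_approx).

    The Borel sigma-algebra is generated by the coefficients of the increments
    Y_s^-1 Y_t, s <= t (measurable_rough_pathE). One inclusion holds because the
    distance controls these coefficients. For the other one, balls are measurable
    for the coefficients, since by continuity the supremum over finite subsets can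
    be restricted to grids (pvar_le_grid, measurable_pvar_le), and the space is
    separable. Separability is obtained without the continuity of the lift: lifts
    of paths x in the 1-variation closure of the smooth paths are uniformly
    continuous and satisfy |Y^k_(s,t)| <= (V t - V s)^k, where V is the total
    variation of x, and on lifts with a common bound on V uniform closeness implies
    closeness in p-variation by interpolation (pvar_interpolation). So the values
    of a close lift on a fine grid, rounded, determine a rough path up to a small
    error (countable_code). Joint measurability of the shift now follows from the
    continuity in time of the coefficients.

    Invariance of P. It suffices to compare P of finitely many constraints on
    coefficients of increments with P of the same constraints at times translated
    by t. On [-L, L], Xbar is the limit in probability of lifts of piecewise linear
    interpolations of X - X_0. These lifts exist: they are explicit products of
    exponentials (pl_lift), by a uniqueness argument for multiplicative paths whose
    level k is of order (dt)^k (incr_iterated_integral); in particular their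
    coefficients are measurable functions of finitely many values of X, so the
    exceptional events in the definition of Xbar are measurable. A fine partition of
    [-L, L], translated by t, is completed to a fine partition of a larger interval
    [-L', L'] (extend_partition). The increments of the lift along the latter
    between the translated times are those of the interpolation of X_(t + .) - X_t
    along the former, which has the law of the interpolation of X - X_0 by
    stationarity of the increments (approximation_stationary). Passing to the limit
    gives an inequality, and its instance at -t the converse (box_le_shift). *)

(** * Norms on tensor powers *)

Section tensor_norms.
Context {R : realType} {d : nat} (nrm : tensor_norm R d) (k : nat).
Implicit Types v w : tensor R d k.

Lemma tnorm0 : nrm k 0 = 0.
Proof.
have := tnormZ nrm 0 (0 : tensor R d k); rewrite normr0 mul0r => <-.
by congr (nrm _ _); apply/ffunP => u; rewrite !ffunE mul0r.
Qed.

Lemma tnormN v : nrm k (- v) = nrm k v.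
Proof.
have := tnormZ nrm (-1) v; rewrite normrN1 mul1r => <-.
by congr (nrm _ _); apply/ffunP => u; rewrite !ffunE mulN1r.
Qed.

Lemma tnorm_ge0 v : 0 <= nrm k v.
Proof.
have := tnormD nrm v (- v); rewrite subrr tnorm0 tnormN -mulr2n.
by rewrite -mulr_natr pmulr_lge0.
Qed.

Definition tensor_basis (u : k.-tuple 'I_d) : tensor R d k :=
  [ffun u' => (u' == u)%:R].

Definition tensor_basis_norm : R := \sum_u nrm k (tensor_basis u).

Lemma tensor_basis_norm_ge0 : 0 <= tensor_basis_norm.
Proof. by apply: sumr_ge0 => u _; exact: tnorm_ge0. Qed.

Lemma tnorm_le_coord v :
  nrm k v <= \sum_u `|(v : {ffun _ -> _}) u| * nrm k (tensor_basis u).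
Proof.
have {1}-> : v = \sum_u tensor_scale ((v : {ffun _ -> _}) u) (tensor_basis u).
  apply/ffunP => u; rewrite sum_ffunE (bigD1 u)//= !ffunE eqxx mulr1 big1 ?addr0//.
  by move=> u' uu'; rewrite !ffunE eq_sym (negbTE uu') mulr0.
apply: (big_ind2 (fun (x : tensor R d k) (y : R) => nrm k x <= y)).
- by rewrite tnorm0.
- move=> x x' y y' xx' yy'; apply: le_trans (tnormD _ _ _) _; exact: lerD.
- by move=> u _; rewrite tnormZ.
Qed.

Lemma tnorm_le_sup v (e : R) : (forall u, `|(v : {ffun _ -> _}) u| <= e) ->
  nrm k v <= e * tensor_basis_norm.
Proof.
move=> ve; apply: le_trans (tnorm_le_coord v) _; rewrite mulr_sumr.
by apply: ler_sum => u _; apply: ler_wpM2r (ve u); exact: tnorm_ge0.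
Qed.

Lemma tnorm_lipschitz v w :
  `|nrm k v - nrm k w| <= \sum_u `|(v : {ffun _ -> _}) u - (w : {ffun _ -> _}) u| *
     nrm k (tensor_basis u).
Proof.
have H v' w' : nrm k v' - nrm k w' <= \sum_u `|(v' : {ffun _ -> _}) u -
    (w' : {ffun _ -> _}) u| * nrm k (tensor_basis u).
  rewrite lerBlDr -{1}(subrK w' v'); apply: le_trans (tnormD _ _ _) _.
  rewrite lerD2r; apply: le_trans (tnorm_le_coord _) _.
  by apply: ler_sum => u _; rewrite !ffunE.
rewrite ler_norml H andbT lerNl opprB; apply: le_trans (H _ _) _.
by apply: ler_sum => u _; rewrite distrC.
Qed.

(** All norms on a finite-dimensional space are equivalent: the norm is
    continuous for the sup norm, so it has a positive minimum on the compact
    unit sphere of the latter. *)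
Lemma tnorm_ge_coord : exists2 C : R, 0 < C &
  forall v u, `|(v : {ffun _ -> _}) u| <= C * nrm k v.
Proof.
set n := #|{: k.-tuple 'I_d}|.
pose tens (x : 'rV[R]_n) : tensor R d k := [ffun u => x ord0 (enum_rank u)].
have [n0|n0] := posnP n.
  by exists 1 => // v u; have := fintype0 u n0.
have coord_le (x : 'rV[R]_n) i : `|x ord0 i| <= `|x|.
  rewrite -[`|x|]/(mx_norm x) mx_normrE.
  exact: (le_bigmax _ (fun ij => `|x ij.1 ij.2|) (ord0, i)).
pose S := [set x : 'rV[R]_n | `|x| = 1].
have cN : continuous (fun x : 'rV[R]_n => nrm k (tens x)).
  move=> x; apply/(@cvgrPdist_le _ _ _ (nbhs x)) => e e0.
  have c0 : 0 < tensor_basis_norm + 1 by rewrite ltr_wpDl// tensor_basis_norm_ge0.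
  near=> y.
  apply: (le_trans (tnorm_lipschitz _ _)).
  apply: (@le_trans _ _ (`|x - y| * (tensor_basis_norm + 1))).
    rewrite mulrDr mulr1; apply: ler_wpDr => //; rewrite mulr_sumr.
    apply: ler_sum => u _; apply: ler_wpM2r; first exact: tnorm_ge0.
    have := coord_le (x - y) (enum_rank u); by rewrite !ffunE !mxE.
  rewrite -ler_pdivlMr//; near: y; apply: cvgr_dist_le; first exact: cvg_id.
  exact: divr_gt0.
have cS : compact S.
  apply: bounded_closed_compact.
    by exists 1; split => // M M1 x /= ->; exact: ltW.
  apply: (@closed_comp _ _ (fun x : 'rV[R]_n => `|x|) [set 1]).
    by move=> x _; exact: norm_continuous.
  exact: closed_eq.
have nz : [set x | S x] !=set0.
  have x0 : (const_mx 1 : 'rV[R]_n) != 0.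
    apply/eqP => /rowP/(_ (Ordinal n0))/eqP; rewrite !mxE oner_eq0//.
  exists (`|const_mx 1 : 'rV[R]_n|^-1 *: const_mx 1).
  by rewrite /S/= normrZ normfV normr_id mulVf// normr_eq0.
have [c cinS cmin] := compact_EVT_min nz cS (continuous_subspaceT cN).
have c1 : `|c| = 1 by move: cinS; rewrite inE.
have m0 : 0 < nrm k (tens c).
  rewrite lt_neqAle tnorm_ge0 andbT eq_sym; apply/negP => /eqP /tnorm0_eq0 tc0.
  have : c = 0.
    apply/rowP => i; have := congr1 (fun f : tensor R d k => (f : {ffun _ -> _}) (enum_val i)) tc0.
    by rewrite !ffunE enum_valK mxE.
  by move=> c0; move: c1; rewrite c0 normr0 => /eqP; rewrite eq_sym oner_eq0.
exists (nrm k (tens c))^-1; first by rewrite invr_gt0.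
move=> v u.
pose x : 'rV[R]_n := \row_i (v : {ffun _ -> _}) (enum_val i).
have tx : tens x = v by apply/ffunP => u'; rewrite ffunE mxE enum_rankK.
have vux : `|(v : {ffun _ -> _}) u| <= `|x|.
  by have := coord_le x (enum_rank u); rewrite mxE enum_rankK.
apply: (le_trans vux).
have [->|x0] := eqVneq x 0.
  by rewrite normr0 mulr_ge0 ?tnorm_ge0// invr_ge0 tnorm_ge0.
have nx0 : 0 < `|x| by rewrite normr_gt0.
have : nrm k (tens c) <= nrm k (tens (`|x|^-1 *: x)).
  apply: cmin; rewrite inE /S/= normrZ normfV normr_id mulVf// gt_eqF//.
have -> : tens (`|x|^-1 *: x) = tensor_scale `|x|^-1 v.
  by apply/ffunP => u'; rewrite !ffunE mxE -tx ffunE.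
rewrite tnormZ normfV normr_id => h.
by rewrite mulrC ler_pdivlMr// -ler_pdivlMl.
Unshelve. all: by end_near.
Qed.

End tensor_norms.

(** * Coefficients of group elements *)

(** A class of pairs (real function, value) that is closed under the ring
    operations, such as the functions with a limit along a filter or the
    measurable functions.  Inversion in the group is a polynomial in the
    coefficients, so membership of all coefficients in such a class passes to
    increments; this serves both for limits and for measurability. *)
Section coefficient_class.
Context {R : realType} {d N : nat} {T : Type} (C : (T -> R) -> R -> Prop).
Hypothesis C_cst : forall c, C (fun=> c) c.
Hypothesis C_add : forall f g a b, C f a -> C g b ->
  C (fun x => f x + g x) (a + b).
Hypothesis C_mul : forall f g a b, C f a -> C g b ->
  C (fun x => f x * g x) (a * b).

Definition coef_class (f : T -> tseries R d N) (g : tseries R d N) :=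
  forall w : seq 'I_d, (size w <= N)%N -> C (fun x => tcoef (f x) w) (tcoef g w).

Lemma class_sum n (F : 'I_n -> T -> R) G : (forall i, C (F i) (G i)) ->
  C (fun x => \sum_(i < n) F i x) (\sum_(i < n) G i).
Proof.
move=> FG; elim: n F G FG => [|n IH] F G FG.
  rewrite big_ord0 (_ : (fun=> _) = fun=> 0); first exact: C_cst.
  by apply/funext => x; rewrite big_ord0.
rewrite big_ord_recl (_ : (fun=> _) = fun x => F ord0 x +
    \sum_(i < n) F (lift ord0 i) x); last first.
  by apply/funext => x; rewrite big_ord_recl.
by apply: C_add => //; apply: IH.
Qed.

Lemma coef_class_cst g : coef_class (fun=> g) g.
Proof. by move=> w _; exact: C_cst. Qed.

Lemma coef_class_mul f f' g g' : coef_class f g -> coef_class f' g' ->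
  coef_class (fun x => f x * f' x) (g * g').
Proof.
move=> fg fg' w wN; rewrite tcoefM//.
rewrite (_ : (fun=> _) = fun x => \sum_(i < (size w).+1)
    tcoef (f x) (take i w) * tcoef (f' x) (drop i w)).
  apply: class_sum => i; apply: C_mul.
    by apply: fg; rewrite (leq_trans _ wN)// size_take_min geq_minr.
  by apply: fg'; rewrite (leq_trans _ wN)// size_drop leq_subr.
by apply/funext => x; rewrite tcoefM.
Qed.

Lemma coef_class_add f f' g g' : coef_class f g -> coef_class f' g' ->
  coef_class (fun x => f x + f' x) (g + g').
Proof.
move=> fg fg' w wN; rewrite tcoefD (_ : (fun=> _) = fun x =>
    tcoef (f x) w + tcoef (f' x) w); last by apply/funext => x; rewrite tcoefD.
by apply: C_add; [apply: fg|apply: fg'].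
Qed.

Lemma coef_class_sub f f' g g' : coef_class f g -> coef_class f' g' ->
  coef_class (fun x => f x - f' x) (g - g').
Proof.
move=> fg fg' w wN; rewrite tcoefB (_ : (fun=> _) = fun x =>
    tcoef (f x) w + -1 * tcoef (f' x) w).
  rewrite -[- tcoef g' w]mulN1r; apply: C_add; first exact: fg.
  by apply: C_mul; [exact: (C_cst (-1))|exact: fg'].
by apply/funext => x; rewrite tcoefB mulN1r.
Qed.

Lemma coef_class_exp f g n : coef_class f g ->
  coef_class (fun x => f x ^+ n) (g ^+ n).
Proof.
move=> fg; elim: n => [|n IH]; first exact: coef_class_cst.
rewrite exprS (_ : (fun=> _) = fun x => f x * f x ^+ n).
  exact: coef_class_mul.
by apply/funext => x; rewrite exprS.
Qed.

Lemma coef_class_inv (f : T -> T1 R d N) (g : T1 R d N) :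
  coef_class (fun x => val (f x)) (val g) ->
  coef_class (fun x => val (f x)^-1%g) (val g^-1%g).
Proof.
move=> fg.
have H n : coef_class (fun x => \sum_(i < n) (1 - val (f x)) ^+ i)
    (\sum_(i < n) (1 - val g) ^+ i).
  elim: n => [|n IH].
    rewrite big_ord0 (_ : (fun=> _) = fun=> 0); first exact: coef_class_cst.
    by apply/funext => x; rewrite big_ord0.
  rewrite big_ord_recr/= (_ : (fun=> _) = fun x =>
      \sum_(i < n) (1 - val (f x)) ^+ i + (1 - val (f x)) ^+ n); last first.
    by apply/funext => x; rewrite big_ord_recr.
  apply: coef_class_add => //; apply: coef_class_exp.
  by apply: coef_class_sub => //; exact: coef_class_cst.
exact: H.
Qed.

Lemma coef_class_ldiv (f f' : T -> T1 R d N) (g g' : T1 R d N) :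
  coef_class (fun x => val (f x)) (val g) ->
  coef_class (fun x => val (f' x)) (val g') ->
  coef_class (fun x => val ((f x)^-1 * f' x)%g) (val (g^-1 * g')%g).
Proof. by move=> fg fg'; apply: coef_class_mul => //; exact: coef_class_inv. Qed.

End coefficient_class.

Section increments.
Context {R : realType} {d N : nat}.
Implicit Types (X : R -> T1 R d N) (s t u : R).

Lemma T1_inj (g h : T1 R d N) : (forall w : seq 'I_d, (size w <= N)%N ->
  tcoef (val g) w = tcoef (val h) w) -> g = h.
Proof. by move=> gh; apply: val_inj; exact: tseriesP. Qed.

Lemma tcoef_val1 (w : seq 'I_d) : (size w <= N)%N ->
  tcoef (val (1%g : T1 R d N)) w = (size w == 0)%:R.
Proof. exact: tcoef1. Qed.

Lemma tcoef_valM (g h : T1 R d N) (w : seq 'I_d) : (size w <= N)%N ->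
  tcoef (val (g * h)%g) w =
  \sum_(i < (size w).+1) tcoef (val g) (take i w) * tcoef (val h) (drop i w).
Proof. exact: tcoefM. Qed.

Lemma incrxx X s : incr X s s = 1%g.
Proof. by rewrite /incr mulVg. Qed.

Lemma incrM X s u t : (incr X s u * incr X u t)%g = incr X s t.
Proof. by rewrite /incr -mulgA mulVKg. Qed.

Definition shift_path (tau : R) X : R -> T1 R d N :=
  fun t => incr X tau (tau + t).

Lemma shift_path0 tau X : shift_path tau X 0 = 1%g.
Proof. by rewrite /shift_path addr0 incrxx. Qed.

Lemma incr_shift_path tau X s t :
  incr (shift_path tau X) s t = incr X (tau + s) (tau + t).
Proof. by rewrite /shift_path /incr invgM invgK -mulgA mulVKg. Qed.

Lemma incr_coef_cvg {T : Type} (F : set_system T) {FF : Filter F}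
    X (f g : T -> R) s t :
  (forall w : seq 'I_d, (size w <= N)%N ->
     tcoef (val (X (f x))) w @[x --> F] --> tcoef (val (X s)) w) ->
  (forall w : seq 'I_d, (size w <= N)%N ->
     tcoef (val (X (g x))) w @[x --> F] --> tcoef (val (X t)) w) ->
  forall w : seq 'I_d, (size w <= N)%N ->
     tcoef (val (incr X (f x) (g x))) w @[x --> F] --> tcoef (val (incr X s t)) w.
Proof.
move=> fs gt; apply: (@coef_class_ldiv R d N T (fun h l => h x @[x --> F] --> l)).
- by move=> c; exact: cvg_cst.
- by move=> h h' a b; exact: cvgD.
- by move=> h h' a b; exact: cvgM.
- exact: fs.
- exact: gt.
Qed.

Lemma measurable_incr_coef disp (T : measurableType disp) (X : T -> R -> T1 R d N) s t :
  (forall w : seq 'I_d, (size w <= N)%N ->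
     measurable_fun setT (fun x => tcoef (val (X x s)) w)) ->
  (forall w : seq 'I_d, (size w <= N)%N ->
     measurable_fun setT (fun x => tcoef (val (X x t)) w)) ->
  forall w : seq 'I_d, (size w <= N)%N ->
     measurable_fun setT (fun x => tcoef (val (incr (X x) s t)) w).
Proof.
move=> ms mt; apply: (@coef_class_ldiv R d N T (fun h l => measurable_fun setT h)
  _ _ _ (fun x => X x s) (fun x => X x t) 1%g 1%g) => //.
- by move=> h h' _ _; exact: measurable_funD.
- by move=> h h' _ _; exact: measurable_funM.
Qed.

End increments.

(** * The p-variation distance, by real inequalities *)

Section p_variation.
Context {R : realType} {d : nat} (nrm : tensor_norm R d) {N : nat}.
Implicit Types (X Y Z : R -> T1 R d N) (p a b r s t : R).

Definition incr_dist k X Y s t : R :=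
  nrm k (tlevel k (val (incr X s t) - val (incr Y s t))).

Definition pvar_sum p k X Y (D : seq R) : R :=
  \sum_(i < (size D).-1) incr_dist k X Y D`_i D`_i.+1 `^ (p / k%:R).

Definition pvar_le p a b X Y r : Prop := forall k D,
  (1 <= k <= N)%N -> finite_subset a b D -> pvar_sum p k X Y D <= r `^ p.

Lemma incr_dist_ge0 k X Y s t : 0 <= incr_dist k X Y s t.
Proof. exact: tnorm_ge0. Qed.


Lemma incr_dist_sym k X Y s t : incr_dist k X Y s t = incr_dist k Y X s t.
Proof.
rewrite /incr_dist -tnormN; congr (nrm k _).
by apply/ffunP => u; rewrite !ffunE !tcoefB opprB.
Qed.

Lemma incr_dist_triangle k X Y Z s t :
  incr_dist k X Z s t <= incr_dist k X Y s t + incr_dist k Y Z s t.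
Proof.
rewrite /incr_dist; apply: le_trans (tnormD _ _ _).
rewrite [X in _ <= nrm _ X](_ : _ = tlevel k (val (incr X s t) - val (incr Z s t)))//.
by apply/ffunP => u; rewrite !ffunE !tcoefB addrA subrK.
Qed.


Lemma finite_subset_nth a b (D : seq R) (i : 'I_(size D).-1) : finite_subset a b D ->
  [/\ a <= D`_i, D`_i <= D`_i.+1 & D`_i.+1 <= b].
Proof.
move=> [Ds Dab]; have iD : (i.+1 < size D)%N by rewrite -ltn_predRL.
have /andP[aD _] := Dab _ (mem_nth 0 (ltnW iD)).
have /andP[_ Db] := Dab _ (mem_nth 0 iD).
by split => //; exact/ltW/(sortedP 0 Ds).
Qed.

(** Bounding every finite sum avoids the suprema, maxima and roots of extended
    real numbers that define the distance. *)
Lemma d_pvar_leP p a b X Y r : 0 < p -> 0 <= r ->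
  (d_pvar nrm p a b X Y <= r%:E)%E <-> pvar_le p a b X Y r.
Proof.
move=> p0 r0.
have S0 k : (0 <= ereal_sup [set (pvar_sum p k X Y D)%:E | D in finite_subset a b])%E.
  apply: ereal_sup_ubound; exists [::]; first by split.
  by rewrite /pvar_sum big_ord0.
have key k : ((ereal_sup [set (pvar_sum p k X Y D)%:E | D in finite_subset a b])
    `^ p^-1 <= r%:E)%E <->
    forall D, finite_subset a b D -> pvar_sum p k X Y D <= r `^ p.
  split.
    move=> h D Dab; rewrite -lee_fin; apply: (@le_trans _ _
      (ereal_sup [set (pvar_sum p k X Y D)%:E | D in finite_subset a b])).
      by apply: ereal_sup_ubound; exists D.
    rewrite -[leLHS]poweRe1 ?S0// -(mulVf (lt0r_neq0 p0)) poweRrM -poweR_EFin.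
    by apply: gt0_ler_poweR; rewrite ?in_itv/= ?leey ?andbT ?lee_fin ?poweR_ge0// ltW.
  move=> h; rewrite -[leRHS]poweRe1 ?lee_fin// -(mulfV (lt0r_neq0 p0)) poweRrM.
  apply: gt0_ler_poweR; rewrite ?in_itv/= ?leey ?andbT ?S0 ?poweR_ge0//.
  - by rewrite invr_ge0 ltW.
  - by rewrite lee_fin powR_ge0.
  by apply: ge_ereal_sup => _ [D Dab <-]; rewrite lee_fin; exact: h.
rewrite /d_pvar; split.
  move=> h k D /andP[k1 kN] Dab; apply: (key k).1 D Dab.
  apply: le_trans h.
  by apply: (@le_bigmax_seq _ _ _ _ 0%E k xpredT) => //; rewrite mem_index_iota k1 ltnS.
move=> h; rewrite big_nat_cond; apply: bigmax_le; first by rewrite lee_fin.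
by move=> k; rewrite andbT ltnS => kN; apply/key => D Dab; exact: h.
Qed.

Lemma pvar_le_sym p a b X Y r : pvar_le p a b X Y r -> pvar_le p a b Y X r.
Proof.
move=> XY k D kN Dab; apply: le_trans (XY k D kN Dab).
by rewrite le_eqVlt; apply/orP; left; apply/eqP; apply: eq_bigr => i _; rewrite incr_dist_sym.
Qed.

(** Replacing Minkowski's inequality by the crude bound
    (x + y)^q <= 2^q (x^q + y^q) costs the constant 4, which is harmless for
    topological purposes. *)
Lemma pvar_le_trans p a b X Y Z r : 1 <= p -> 0 <= r ->
  pvar_le p a b X Y r -> pvar_le p a b Y Z r -> pvar_le p a b X Z (4 * r).
Proof.
move=> p1 r0 XY YZ k D kN Dab; have p0 : 0 < p by exact: lt_le_trans p1.
have k1 : 1 <= k%:R :> R by case/andP: kN => k1 _; rewrite ler1n.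
have k0 : 0 < k%:R :> R by exact: lt_le_trans k1.
set q := p / k%:R.
have q0 : 0 <= q by rewrite divr_ge0// ltW.
have qp : q <= p by rewrite ler_pdivrMr// ler_peMr// ltW.
have pw (x y : R) : 0 <= x -> 0 <= y ->
    (x + y) `^ q <= 2 `^ q * (x `^ q + y `^ q).
  move=> x0 y0; have [xy|yx] := leP x y.
    apply: (@le_trans _ _ ((2 * y) `^ q)).
      apply: ge0_ler_powR => //; rewrite ?nnegrE ?addr_ge0 ?mulr_ge0//.
      by rewrite mulr2n mulrDl mul1r lerD2r.
    by rewrite powRM// ler_wpM2l ?powR_ge0// lerDr powR_ge0.
  apply: (@le_trans _ _ ((2 * x) `^ q)).
    apply: ge0_ler_powR => //; rewrite ?nnegrE ?addr_ge0 ?mulr_ge0//.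
    by rewrite mulr2n mulrDl mul1r lerD2l ltW.
  by rewrite powRM// ler_wpM2l ?powR_ge0// lerDl powR_ge0.
apply: (@le_trans _ _ (2 `^ q * (pvar_sum p k X Y D + pvar_sum p k Y Z D))).
  rewrite -big_split/= mulr_sumr; apply: ler_sum => i _.
  apply: le_trans (pw _ _ (incr_dist_ge0 _ _ _ _ _) (incr_dist_ge0 _ _ _ _ _)).
  by apply: ge0_ler_powR; rewrite ?nnegrE ?addr_ge0 ?incr_dist_ge0// incr_dist_triangle.
apply: (@le_trans _ _ (2 `^ q * (r `^ p + r `^ p))).
  by rewrite ler_wpM2l ?powR_ge0// lerD ?XY ?YZ.
rewrite powRM// (_ : _ * _ = (2 `^ q * 2) * r `^ p); last first.
  by rewrite -mulrA; congr (_ * _); rewrite mulr_natl mulr2n.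
rewrite ler_wpM2r ?powR_ge0//.
rewrite (_ : 4 = 2 * 2); last by rewrite -natrM.
rewrite powRM// ler_pM ?powR_ge0//; first by apply: ler_powR; rewrite ?ler1n.
by rewrite -[leLHS]powRr1// ler_powR// ler1n.
Qed.

Lemma pvar_le_sub p a b a' b' X Y r : a <= a' -> b' <= b ->
  pvar_le p a b X Y r -> pvar_le p a' b' X Y r.
Proof.
move=> aa bb XY k D kN [Ds Dab]; apply: XY => //; split => // x /Dab/andP[ax xb].
by rewrite (le_trans aa)// (le_trans xb).
Qed.

Lemma pvar_le_mono p a b X Y r r' : 0 <= p -> 0 <= r -> r <= r' ->
  pvar_le p a b X Y r -> pvar_le p a b X Y r'.
Proof.
move=> p0 r0 rr XY k D kN Dab; apply: le_trans (XY k D kN Dab) _.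
by apply: ge0_ler_powR; rewrite ?nnegrE// (le_trans r0).
Qed.

Lemma pvar_le_eqr p a b X Y Z r :
  (forall s t, a <= s -> s <= t -> t <= b -> incr Y s t = incr Z s t) ->
  pvar_le p a b X Y r -> pvar_le p a b X Z r.
Proof.
move=> YZ XY k D kN Dab; apply: le_trans (XY k D kN Dab).
rewrite le_eqVlt; apply/orP; left; apply/eqP; apply: eq_bigr => i _.
by have [aD DD Db] := finite_subset_nth i Dab; rewrite /incr_dist YZ.
Qed.

Lemma pvar_le_shift p a b tau X Y r : pvar_le p (a + tau) (b + tau) X Y r ->
  pvar_le p a b (shift_path tau X) (shift_path tau Y) r.
Proof.
move=> XY k D kN [Ds Dab].
have : finite_subset (a + tau) (b + tau) [seq tau + x | x <- D].
  split.
    rewrite sorted_map (@eq_sorted _ _ <%R)// => x y /=; exact: ltrD2l.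
  by move=> _ /mapP[x /Dab xab ->]; rewrite [tau + x]addrC !lerD2r.
move=> /(XY k _ kN); apply: le_trans; rewrite le_eqVlt; apply/orP; left; apply/eqP.
rewrite /pvar_sum size_map; apply: eq_bigr => i _.
have iD : (i.+1 < size D)%N by rewrite -ltn_predRL.
have E s t : incr_dist k (shift_path tau X) (shift_path tau Y) s t =
    incr_dist k X Y (tau + s) (tau + t) by rewrite /incr_dist !incr_shift_path.
by rewrite E (nth_map 0 0 _ (ltnW iD)) (nth_map 0 0 _ iD).
Qed.

(** A pair of times is a finite subset, so a distance r bounds level k of a single
    increment by r^k, hence by r when r <= 1, and the coefficients by the
    equivalence of norms. *)
Lemma pvar_le_coef : exists2 C : R, 0 < C & forall p a b X Y r, 1 <= p ->
  0 <= r <= 1 -> pvar_le p a b X Y r ->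
  forall s t, a <= s -> s <= t -> t <= b ->
  forall w : seq 'I_d, (size w <= N)%N ->
  `|tcoef (val (incr X s t)) w - tcoef (val (incr Y s t)) w| <= C * r.
Proof.
have /choice[C CP] : forall k, exists C : R, 0 < C /\
    forall (v : tensor R d k) u, `|(v : {ffun _ -> _}) u| <= C * nrm k v.
  by move=> k; have [C C0 CP] := tnorm_ge_coord nrm k; exists C.
exists (\sum_(k < N.+1) C k).
  by rewrite big_ord_recl ltr_pwDl ?(CP _).1// sumr_ge0// => i _; exact/ltW/(CP _).1.
move=> p a b X Y r p1 /andP[r0 r1] XY s t as_ st tb w wN.
have p0 : 0 < p by exact: lt_le_trans p1.
have C0 : 0 <= \sum_(k < N.+1) C k by apply: sumr_ge0 => k _; exact/ltW/(CP _).1.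
have [->|w0] := eqVneq w [::].
  by rewrite !T1P subrr normr0 mulr_ge0.
have k1 : (0 < size w)%N by case: w w0 {wN}.
move: st; rewrite le_eqVlt => /predU1P[<-|st].
  by rewrite !incrxx subrr normr0 mulr_ge0.
have k0 : 0 < (size w)%:R :> R by rewrite ltr0n.
have : incr_dist (size w) X Y s t <= r.
  have Dab : finite_subset a b [:: s; t].
    split; rewrite /= ?st// => x; rewrite !inE => /orP[]/eqP->.
      by rewrite as_ (le_trans (ltW st)).
    by rewrite tb (le_trans as_)// ltW.
  have := XY (size w) _ _ Dab; rewrite k1 wN => /(_ isT).
  rewrite /pvar_sum/= big_ord1/= => h.
  have : incr_dist (size w) X Y s t <= r `^ (size w)%:R.
    have -> : incr_dist (size w) X Y s t =
        (incr_dist (size w) X Y s t `^ (p / (size w)%:R)) `^ ((size w)%:R / p).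
      by rewrite -powRrM mulrA divfK ?gt_eqF// mulfV ?gt_eqF// powRr1 ?incr_dist_ge0.
    have -> : r `^ (size w)%:R = (r `^ p) `^ ((size w)%:R / p).
      by rewrite -powRrM mulrC divfK// gt_eqF.
    apply: ge0_ler_powR; rewrite ?nnegrE ?powR_ge0//.
    by rewrite divr_ge0// ltW.
  move=> /le_trans; apply; rewrite powR_mulrn//.
  by apply: le_trans (ler_wiXn2l r0 r1 k1) _; rewrite expr1.
move=> h; have := (CP (size w)).2 (tlevel (size w) (val (incr X s t) - val (incr Y s t))) (in_tuple w).
rewrite ffunE tcoefB /= => /le_trans; apply.
apply: (@le_trans _ _ (C (size w) * r)).
  by rewrite ler_wpM2l// ltW// (CP _).1.
rewrite ler_wpM2r// (bigD1 (Ordinal (wN : (size w < N.+1)%N)))//= lerDl.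
by apply: sumr_ge0 => i _; exact/ltW/(CP _).1.
Qed.

End p_variation.

(** * Equidistant grids *)

Section grids.
Context {R : realType}.
Implicit Types (a b s t : R) (n i j : nat).

Definition grid a b n i : R := a + (b - a) * (i%:R / n.+1%:R).

(** The index of the last grid point that is at most t. *)
Definition grid_index a b n t : nat := Num.truncn ((t - a) / (b - a) * n.+1%:R).

Lemma grid_itv a b n i : a <= b -> (i <= n.+1)%N -> a <= grid a b n i <= b.
Proof.
move=> ab ni; have ba0 : 0 <= b - a by rewrite subr_ge0.
rewrite /grid lerDl mulr_ge0 ?divr_ge0//= -lerBrDl -[leRHS]mulr1.
by rewrite ler_wpM2l// ler_pdivrMr// mul1r ler_nat.
Qed.

Lemma grid_lt a b n i j : a < b -> (i < j)%N -> grid a b n i < grid a b n j.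
Proof.
move=> ab ij; rewrite /grid ltrD2l ltr_pM2l ?subr_gt0// ltr_pM2r ?invr_gt0//.
by rewrite ltr_nat.
Qed.

Lemma grid_le a b n i j : a < b -> (i <= j)%N -> grid a b n i <= grid a b n j.
Proof.
by move=> ab; rewrite leq_eqVlt => /predU1P[->//|ij]; apply/ltW/grid_lt.
Qed.

Lemma grid_lt_index a b n i j : a < b -> grid a b n i < grid a b n j -> (i < j)%N.
Proof. by move=> ab; apply: contraTltn => ji; rewrite -leNgt grid_le. Qed.

Lemma gridS a b n i : grid a b n i.+1 = grid a b n i + (b - a) / n.+1%:R.
Proof. by rewrite /grid -addrA -[i.+1%:R]natr1 [X in _ * X]mulrDl mulrDr mul1r. Qed.

Lemma grid_index_le a b n t : a < b -> a <= t -> grid a b n (grid_index a b n t) <= t.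
Proof.
move=> ab at_; have ba0 : 0 < b - a by rewrite subr_gt0.
rewrite /grid -lerBrDl -ler_pdivlMl// [X in _ <= X]mulrC ler_pdivrMr//.
by rewrite truncn_le mulr_ge0// divr_ge0 ?subr_ge0// ltW.
Qed.

Lemma lt_grid_index a b n t : a < b -> t < grid a b n (grid_index a b n t).+1.
Proof.
move=> ab; have ba0 : 0 < b - a by rewrite subr_gt0.
rewrite /grid -ltrBlDl -ltr_pdivrMl// [X in X < _]mulrC ltr_pdivlMr//.
exact: truncnS_gt.
Qed.

Lemma grid_index_bound a b n t : a < b -> t <= b -> (grid_index a b n t <= n.+1)%N.
Proof.
move=> ab tb; have ba0 : 0 < b - a by rewrite subr_gt0.
rewrite /grid_index truncn_le_nat; apply: (@le_lt_trans _ _ n.+1%:R); last by rewrite ltr_nat.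
by rewrite -[leRHS]mul1r ler_pM2r// ler_pdivrMr// mul1r lerD2r.
Qed.

Lemma grid_cvg a b t : a < b -> a <= t ->
  grid a b n (grid_index a b n t) @[n --> \oo] --> t.
Proof.
move=> ab at_; apply/cvgrPdist_le => e e0.
have ba0 : 0 < b - a by rewrite subr_gt0.
near=> n.
rewrite ger0_norm ?subr_ge0 ?grid_index_le// lerBlDr.
apply: (le_trans (ltW (lt_grid_index n t ab))); rewrite gridS addrC lerD2r.
rewrite ler_pdivrMr// -ler_pdivrMl//; apply: (@le_trans _ _ n%:R).
  by near: n; exact: nbhs_infty_ger.
by rewrite ler_nat.
Unshelve. all: by end_near. Qed.

Lemma grid_lt_near a b s t : a < b -> a <= s -> s < t -> t <= b ->
  \forall n \near \oo, (grid_index a b n s < grid_index a b n t)%N.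
Proof.
move=> ab as_ st tb.
have at_ : a <= t by exact/ltW/(le_lt_trans as_).
have ba0 : 0 < b - a by rewrite subr_gt0.
near=> n; apply: (@grid_lt_index a b n) => //.
apply: le_lt_trans (grid_index_le n ab as_) _.
by near: n; apply: (cvgr_gt t) => //; exact: grid_cvg.
Unshelve. all: by end_near. Qed.

End grids.

(** * Limits of real powers *)

Section powR_limit.
Context {R : realType} {T : Type} {F : set_system T} {FF : Filter F}.

Lemma cvg_powR (f : T -> R) (c q : R) : 0 < q -> (forall x, 0 <= f x) ->
  f x @[x --> F] --> c -> f x `^ q @[x --> F] --> c `^ q.
Proof.
move=> q0 f0 fc; have [c0|c0|c0] := ltgtP c 0.
- have Fe : \forall x \near F, False.
    near=> x; have := f0 x; rewrite leNgt => /negP; apply.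
    by near: x; exact: (cvgr_lt c fc).
  by apply/cvgrPdist_le => e e0; apply: filterS Fe.
- have : {for c, continuous (@powR R ^~ q)}.
    apply: differentiable_continuous; apply/derivable1_diffP.
    by apply: derivable_powR; rewrite in_itv/= c0.
  by move=> cq; apply: (@cvg_comp _ _ _ f (@powR R ^~ q)) cq.
- rewrite c0 powR0 ?gt_eqF//; apply/cvgrPdist_le => e e0.
  have e'0 : 0 < e `^ q^-1 by exact: powR_gt0.
  near=> x; have fx : f x < e `^ q^-1.
    by near: x; apply: (cvgr_lt c fc); rewrite c0.
  rewrite sub0r normrN ger0_norm ?powR_ge0//.
  rewrite -[leRHS]powRr1 ?(ltW e0)// -(mulVf (lt0r_neq0 q0)) powRrM.
  by apply: ge0_ler_powR; rewrite ?nnegrE ?powR_ge0// ltW.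
Unshelve. all: by end_near. Qed.

End powR_limit.

(** * Measurability of the p-variation distance *)

Section measurability_tools.
Context {disp : measure_display} {T : measurableType disp}.

Lemma measurable_forall (U : countType) (F : U -> set T) :
  (forall u, measurable (F u)) -> measurable [set x | forall u, F u x].
Proof.
move=> mF; rewrite (_ : [set x | _] = ~` \bigcup_u ~` F u); last first.
  apply/seteqP; split => [x Fx [u _]|x nF u]; first exact.
  by apply: contrapT => nFu; apply: nF; exists u.
apply: measurableC; apply: countable_bigcupT_measurable => [|u]; last exact/measurableC.
exact: countableP.
Qed.

Lemma measurable_le_cst {R : realType} (f : T -> R) (c : R) :
  measurable_fun setT f -> measurable [set x | f x <= c].
Proof.
move=> mf; rewrite (_ : [set x | _] = setT `&` f @^-1` `]-oo, c]); last first.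
  by apply/seteqP; split => x /=; rewrite ?in_itv//= => -[].
exact: mf.
Qed.

Lemma measurable_lt_fun {R : realType} (f : T -> R) :
  (forall c, measurable [set x | f x < c]) -> measurable_fun setT f.
Proof.
move=> mf; apply: (measurability _ (RGenInftyO.measurableE R)).
move=> _ [_ [c ->] <-]; rewrite setTI (_ : _ @^-1` _ = [set x | f x < c])//.
Qed.

End measurability_tools.

Section tnorm_limits.
Context {R : realType} {d : nat} (nrm : tensor_norm R d) (k : nat).

Lemma cvg_tnorm {T : Type} {F : set_system T} {FF : Filter F}
    (f : T -> tensor R d k) (v : tensor R d k) :
  (forall u, (f x : {ffun _ -> _}) u @[x --> F] --> (v : {ffun _ -> _}) u) ->
  nrm k (f x) @[x --> F] --> nrm k v.
Proof.
move=> fv; apply/cvgrPdist_le => e e0.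
have c0 : 0 < tensor_basis_norm nrm k + 1.
  by rewrite ltr_wpDl// tensor_basis_norm_ge0.
have : \forall x \near F, forall u,
    `|(v : {ffun _ -> _}) u - (f x : {ffun _ -> _}) u| <= e / (tensor_basis_norm nrm k + 1).
  apply: filter_forall => u; apply: cvgr_dist_le; first exact: fv.
  exact: divr_gt0.
apply: filterS => x fx; apply: le_trans (tnorm_lipschitz _ _ _) _.
apply: (@le_trans _ _ (e / (tensor_basis_norm nrm k + 1) * tensor_basis_norm nrm k)).
  rewrite mulr_sumr; apply: ler_sum => u _; rewrite ler_wpM2r ?tnorm_ge0//.
rewrite mulrAC -mulrA ler_piMr ?(ltW e0)// ler_pdivrMr// mul1r lerDl//.
Qed.

(** A norm is the infimum, over a countable dense set of vectors q, of the
    measurable functions nrm q + sum_u |v_u - q_u| nrm e_u. *)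
Lemma measurable_tnorm {disp} {T : measurableType disp} (f : T -> tensor R d k) :
  (forall u, measurable_fun setT (fun x => (f x : {ffun _ -> _}) u)) ->
  measurable_fun setT (fun x => nrm k (f x)).
Proof.
move=> mf; apply: measurable_lt_fun => c.
pose qt (q : {ffun k.-tuple 'I_d -> rat}) : tensor R d k := [ffun u => ratr (q u)].
pose g q x := nrm k (qt q) +
  \sum_u `|(f x : {ffun _ -> _}) u - ratr (q u)| * nrm k (tensor_basis u).
rewrite (_ : [set x | _] = \bigcup_q [set x | g q x < c]).
  apply: countable_bigcupT_measurable; first exact: countableP.
  move=> q; rewrite -[X in measurable X]setTI.
  have mg : measurable_fun setT (g q).
    apply: measurable_funD; first exact: measurable_cst.
    apply: measurable_sum => u; apply: measurable_funM; last exact: measurable_cst.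
    apply: measurableT_comp; first exact: normr_measurable.
    by apply: measurable_funB; [exact: mf|exact: measurable_cst].
  rewrite (_ : [set x | _] = g q @^-1` `]-oo, c[); first exact: mg.
  by apply/seteqP; split => x /=; rewrite in_itv.
have gE q x : g q x = nrm k (qt q) + \sum_u `|(f x : {ffun _ -> _}) u -
    (qt q : {ffun _ -> _}) u| * nrm k (tensor_basis u).
  by congr (_ + _); apply: eq_bigr => u _; rewrite ffunE.
apply/seteqP; split => [x /= fxc|x [q _] /=]; last first.
  apply: le_lt_trans; rewrite gE addrC -lerBlDr; apply: le_trans (tnorm_lipschitz _ _ _).
  exact: ler_norm.
have c0 : 0 < tensor_basis_norm nrm k + 1.
  by rewrite ltr_wpDl// tensor_basis_norm_ge0.
pose e := (c - nrm k (f x)) / 2 / (tensor_basis_norm nrm k + 1).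
have e0 : 0 < e by rewrite !divr_gt0// subr_gt0.
have /choice[q qP] : forall u, exists q : rat, `|(f x : {ffun _ -> _}) u - ratr q| <= e.
  move=> u; have : (f x : {ffun _ -> _}) u - e < (f x : {ffun _ -> _}) u + e.
    by rewrite ltrBlDr -addrA ltrDl addr_gt0.
  move=> /rat_in_itvoo[q]; rewrite in_itv/= => /andP[h1 h2]; exists q.
  by rewrite ler_norml; apply/andP; split; lra.
exists (finfun q) => //=.
pose S := \sum_u `|(f x : {ffun _ -> _}) u - (qt (finfun q) : {ffun _ -> _}) u| *
   nrm k (tensor_basis u).
have Se : S * 2 < c - nrm k (f x).
  have : S <= e * tensor_basis_norm nrm k.
    rewrite mulr_sumr; apply: ler_sum => u _; rewrite ler_wpM2r ?tnorm_ge0//.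
    by rewrite !ffunE.
  have : e * tensor_basis_norm nrm k < (c - nrm k (f x)) / 2.
    rewrite /e -mulrA gtr_pMr ?divr_gt0 ?subr_gt0// mulrC ltr_pdivrMr// mul1r.
    by rewrite ltrDl.
  by lra.
rewrite gE -/S; have := tnorm_lipschitz nrm (f x) (qt (finfun q)).
by rewrite -/S => /ler_normlP[]; lra.
Qed.

End tnorm_limits.

Section measurable_pvar.
Context {R : realType} {d : nat} (nrm : tensor_norm R d) {N : nat}.
Implicit Types (X Y : R -> T1 R d N) (p a b r s t : R).

Definition cont_on a b X : Prop := forall t, a <= t <= b ->
  forall w : seq 'I_d, (size w <= N)%N ->
  tcoef (val (X u)) w @[u --> within `[a, b] (nbhs t)] --> tcoef (val (X t)) w.

Lemma cont_onT a b X :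
  (forall w, continuous (fun t => tcoef (val (X t)) w)) -> cont_on a b X.
Proof.
by move=> cX t _ w _; apply: cvg_trans (cX w t); apply: cvg_app; exact: cvg_within.
Qed.

Lemma cont_on_grid a b X t (w : seq 'I_d) : a < b -> cont_on a b X -> a <= t <= b ->
  (size w <= N)%N ->
  tcoef (val (X (grid a b n (grid_index a b n t)))) w @[n --> \oo] -->
  tcoef (val (X t)) w.
Proof.
move=> ab cX tab wN.
apply: (cvg_comp (fun n => grid a b n (grid_index a b n t)) _ _ (cX t tab w wN)).
move=> A At; have /andP[at_ tb] := tab.
have H : \forall n \near \oo, `[a, b]%classic (grid a b n (grid_index a b n t)) ->
  A (grid a b n (grid_index a b n t)) := grid_cvg ab at_ At.
change (\forall n \near \oo, A (grid a b n (grid_index a b n t))).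
apply: filterS H => n An; apply: An => /=; rewrite in_itv/=; apply: grid_itv; first exact: ltW.
exact: grid_index_bound.
Qed.

Lemma cvg_incr_dist k X Y (f g : nat -> R) s t : (k <= N)%N ->
  (forall Z, Z = X \/ Z = Y -> forall w : seq 'I_d, (size w <= N)%N ->
    tcoef (val (Z (f n))) w @[n --> \oo] --> tcoef (val (Z s)) w) ->
  (forall Z, Z = X \/ Z = Y -> forall w : seq 'I_d, (size w <= N)%N ->
    tcoef (val (Z (g n))) w @[n --> \oo] --> tcoef (val (Z t)) w) ->
  incr_dist nrm k X Y (f n) (g n) @[n --> \oo] --> incr_dist nrm k X Y s t.
Proof.
move=> kN fs gt; apply: cvg_tnorm => u.
rewrite ffunE tcoefB.
rewrite (_ : (fun _ => _) = fun n => tcoef (val (incr X (f n) (g n))) u -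
   tcoef (val (incr Y (f n) (g n))) u); last first.
  by apply/funext => n; rewrite ffunE tcoefB.
apply: cvgB; apply: incr_coef_cvg; rewrite ?size_tuple//.
- by apply: fs; left.
- by apply: gt; left.
- by apply: fs; right.
- by apply: gt; right.
Qed.

(** By continuity of both paths, grids suffice to test the supremum over all
    finite subsets: for a fine grid, rounding down moves the points of a finite
    subset little and keeps them distinct. *)
Lemma pvar_le_grid p a b X Y r : 1 <= p -> a < b -> cont_on a b X -> cont_on a b Y ->
  (forall k n (l : seq nat), (1 <= k <= N)%N -> sorted ltn l -> all (geq n.+1) l ->
     pvar_sum nrm p k X Y [seq grid a b n i | i <- l] <= r `^ p) ->
  pvar_le nrm p a b X Y r.
Proof.
move=> p1 ab cX cY XY k D kN [Ds Dab].
have p0 : 0 < p by exact: lt_le_trans p1.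
have /andP[k1 kN'] := kN.
pose f n t := grid a b n (grid_index a b n t).
have cZ Z : Z = X \/ Z = Y -> forall t, a <= t <= b -> forall w : seq 'I_d,
    (size w <= N)%N -> tcoef (val (Z (f n t))) w @[n --> \oo] --> tcoef (val (Z t)) w.
  by move=> [->|->] t tab w wN; exact: cont_on_grid.
have sD : \forall n \near \oo, sorted ltn [seq grid_index a b n t | t <- D].
  case: D Ds Dab => [|x D]; first by move=> _ _; near=> n.
  elim: D x => [|y D IH] x; first by move=> _ _; near=> n.
  move=> /= /andP[xy yD] Dab; near=> n; rewrite /=; apply/andP; split.
    near: n; have /andP[ax _] := Dab x (mem_head _ _).
    have /andP[_ yb] : a <= y <= b by apply: Dab; rewrite !inE eqxx orbT.
    exact: grid_lt_near.
  near: n; apply: IH => // z zD; apply: Dab.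
  by rewrite inE zD orbT.
have lim : pvar_sum nrm p k X Y [seq f n t | t <- D] @[n --> \oo] -->
    pvar_sum nrm p k X Y D.
  rewrite /pvar_sum (_ : (fun _ => _) = fun n => \sum_(i < (size D).-1)
      incr_dist nrm k X Y (f n D`_i) (f n D`_i.+1) `^ (p / k%:R)); last first.
    apply/funext => n; rewrite size_map; apply: eq_bigr => i _.
    have iD : (i.+1 < size D)%N by rewrite -ltn_predRL.
    by rewrite !(nth_map 0)// ltnW.
  apply: (@class_sum R nat (fun h l => h n @[n --> \oo] --> l)) => [c|g h u v|i].
  - exact: cvg_cst.
  - exact: cvgD.
  have [aD DD Db] := finite_subset_nth i (conj Ds Dab).
  apply: cvg_powR; first by rewrite divr_gt0// ltr0n.
    by move=> n; exact: incr_dist_ge0.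
  apply: cvg_incr_dist => // Z /cZ; apply.
    by rewrite aD (le_trans DD).
  by rewrite Db (le_trans aD).
apply: (cvgr_to_le lim); near=> n.
have -> : [seq f n t | t <- D] = [seq grid a b n i | i <- [seq grid_index a b n t | t <- D]].
  by rewrite -map_comp.
apply: XY => //; first by near: n.
apply/allP => _ /mapP[t tD ->] /=.
by have /andP[_ tb] := Dab t tD; exact: grid_index_bound.
Unshelve. all: by end_near. Qed.

Lemma measurable_pvar_le {disp} {T : measurableType disp} (X Y : T -> R -> T1 R d N)
    p a b r : 1 <= p -> a < b ->
  (forall x, cont_on a b (X x)) -> (forall x, cont_on a b (Y x)) ->
  (forall s t w, a <= s -> s <= t -> t <= b -> (size w <= N)%N ->
     measurable_fun setT (fun x => tcoef (val (incr (X x) s t)) w)) ->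
  (forall s t w, a <= s -> s <= t -> t <= b -> (size w <= N)%N ->
     measurable_fun setT (fun x => tcoef (val (incr (Y x) s t)) w)) ->
  measurable [set x | pvar_le nrm p a b (X x) (Y x) r].
Proof.
move=> p1 ab cX cY mX mY.
pose good (z : nat * nat * seq nat) :=
  [&& (1 <= z.1.1 <= N)%N, sorted ltn z.2 & all (geq z.1.2.+1) z.2].
pose pts (z : nat * nat * seq nat) := [seq grid a b z.1.2 i | i <- z.2].
pose F z := [set x | good z -> pvar_sum nrm p z.1.1 (X x) (Y x) (pts z) <= r `^ p].
have subset_pts z : good z -> finite_subset a b (pts z).
  move=> /and3P[_ ls lb]; split.
    rewrite sorted_map; apply: sub_sorted ls => i j /=; exact: grid_lt.
  move=> _ /mapP[i il ->]; apply: grid_itv; first exact: ltW.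
  by have /allP/(_ _ il) := lb.
rewrite (_ : [set x | _] = [set x | forall z, F z x]); last first.
  apply/seteqP; split => [x xy z gz|x xF].
    by apply: xy; [case/and3P: gz|exact: subset_pts].
  apply: pvar_le_grid => // k n l kN ls lb; apply: (xF (k, n, l)).
  by rewrite /good kN ls.
apply: (@measurable_forall _ _ (nat * nat * seq nat)%type F) => z; rewrite /F.
have [gz|gz] := boolP (good z); last first.
  by rewrite (_ : [set x | _] = setT)//; apply/seteqP; split.
rewrite (_ : [set x | _] = [set x | pvar_sum nrm p z.1.1 (X x) (Y x) (pts z) <= r `^ p]);
  last by apply/seteqP; split => x /=; [exact|].
apply: measurable_le_cst; apply: measurable_sum => i.
apply: (@measurableT_comp _ _ _ _ _ _ (@powR R ^~ (p / z.1.1%:R)) _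
  (fun x => incr_dist nrm z.1.1 (X x) (Y x) (pts z)`_i (pts z)`_i.+1)).
  exact: measurable_powR.
apply: measurable_tnorm => u.
have [aD DD Db] := finite_subset_nth i (subset_pts z gz).
have /and3P[/andP[_ kN] _ _] := gz.
rewrite (_ : (fun _ => _) = fun x => tcoef (val (incr (X x) (pts z)`_i (pts z)`_i.+1)) u -
   tcoef (val (incr (Y x) (pts z)`_i (pts z)`_i.+1)) u); last first.
  by apply/funext => x; rewrite ffunE tcoefB.
by apply: measurable_funB; [apply: mX|apply: mY]; rewrite ?size_tuple.
Qed.

End measurable_pvar.

(** * Riemann-Stieltjes sums and integrals *)

Section riemann_stieltjes.
Context {R : realType}.
Implicit Types (f g G V : R -> R) (a b c e v tau M : R) (s xi : seq R).

Lemma partition_nth a b s j : itv_partition a b s -> (j < size s)%N ->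
  [/\ a <= (a :: s)`_j, (a :: s)`_j < (a :: s)`_j.+1 & (a :: s)`_j.+1 <= b].
Proof.
move=> ps js; split.
- have := itv_partition_nth_ge (ltnW (js : j.+1 < (size s).+1)%N) ps.
  by rewrite (set_nth_default 0)//= ltnW.
- by have [/(pathP 0)/(_ _ js)] := ps.
- have := itv_partition_nth_le (js : j.+1 < (size s).+1)%N ps.
  by rewrite (set_nth_default 0).
Qed.

Lemma partition_sum G a b s : itv_partition a b s ->
  \sum_(j < size s) (G (a :: s)`_j.+1 - G (a :: s)`_j) = G b - G a.
Proof.
move=> ps; rewrite -(big_mkord xpredT (fun j => G (a :: s)`_j.+1 - G (a :: s)`_j)).
rewrite (telescope_sumr (fun j => G (a :: s)`_j))//.
by rewrite (itv_partition_nth_size 0 ps).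
Qed.

Lemma partition_gap_mesh a s j : (j < size s)%N ->
  (a :: s)`_j.+1 - (a :: s)`_j <= mesh a s.
Proof.
move=> js.
exact: (le_bigmax 0 (fun j : 'I_(size s) => (a :: s)`_j.+1 - (a :: s)`_j) (Ordinal js)).
Qed.

Lemma partition_right_tags a b s : itv_partition a b s ->
  forall j, (j < size s)%N -> (a :: s)`_j <= s`_j <= (a :: s)`_j.+1.
Proof.
by move=> ps j js; have [_ /ltW h _] := partition_nth ps js; rewrite h /=.
Qed.

Lemma RS_integral_unique f g a b v v' : a <= b ->
  is_RS_integral f g a b v -> is_RS_integral f g a b v' -> v = v'.
Proof.
move=> ab iv iv'; apply/eqP; rewrite -subr_eq0 -normr_le0; apply/ler_addgt0Pl => e e0.
rewrite addr0; have e20 : 0 < e / 2 by exact: divr_gt0.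
have [del del0 H] := iv _ e20; have [del' del'0 H'] := iv' _ e20.
have [|s ps ms] := fine_partition ab (e := Num.min del del').
  by rewrite lt_min del0.
move: ms; rewrite lt_min => /andP[ms ms'].
have h := H s s ps ms (partition_right_tags ps).
have h' := H' s s ps ms' (partition_right_tags ps).
rewrite [e]splitr -(subrKA (riemann_stieltjes_sum f g a s s)).
by rewrite (le_trans (ler_normD _ _))// lerD// ltW// distrC.
Qed.

Lemma RS_integralE f g a b v : a <= b -> is_RS_integral f g a b v ->
  RS_integral f g a b = v.
Proof.
by move=> ab iv; apply: xget_unique => // v' /(RS_integral_unique ab iv).
Qed.

(** The bound also covers non-integrable pairs, for which the integral is 0. *)
Lemma RS_integral_bound f g V a b M : a <= b -> 0 <= M ->
  (forall u, a <= u <= b -> `|f u| <= M) ->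
  (forall u u', a <= u -> u <= u' -> u' <= b -> `|g u' - g u| <= V u' - V u) ->
  `|RS_integral f g a b| <= M * (V b - V a).
Proof.
move=> ab M0 fM gV.
have B0 : 0 <= M * (V b - V a) by rewrite mulr_ge0// (le_trans _ (gV a b _ _ _)).
rewrite /RS_integral; case: xgetP => [v _ iv|_]; last by rewrite normr0.
apply/ler_addgt0Pl => e e0; have [del del0 H] := iv _ e0.
have [s ps ms] := fine_partition ab del0.
have /ltW h := H s s ps ms (partition_right_tags ps).
rewrite -[v](subrK (riemann_stieltjes_sum f g a s s)).
apply: le_trans (ler_normD _ _) _; rewrite distrC; apply: lerD => //.
rewrite -(partition_sum V ps) mulr_sumr; apply: le_trans (ler_norm_sum _ _ _) _.
apply: ler_sum => j _; have [aj jj jb] := partition_nth ps (ltn_ord j).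
rewrite normrM ler_pM//; last by apply: gV => //; exact: ltW.
by apply: fM; rewrite jb (le_trans aj (ltW jj)).
Qed.

Lemma is_RS_integral_shift f g f' g' a b tau c v :
  (forall u, a <= u <= b -> f u = f' (u + tau)) ->
  (forall u, a <= u <= b -> g u = g' (u + tau) + c) ->
  is_RS_integral f g a b v -> is_RS_integral f' g' (a + tau) (b + tau) v.
Proof.
move=> ff gg iv e e0; have [del del0 H] := iv e e0; exists del => // s xi ps ms xis.
pose s' := [seq x - tau | x <- s]; pose xi' := mkseq (fun j => xi`_j - tau) (size s).
have ss' : size s' = size s by rewrite size_map.
have s'E j : (j <= size s)%N -> (a :: s')`_j = (a + tau :: s)`_j - tau.
  by case: j => [|j js]; rewrite /= ?addrK// (nth_map 0).
have ps' : itv_partition a b s'.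
  have [ps1 /eqP ps2] := ps; split.
    apply/(pathP 0) => j; rewrite ss' => js; rewrite -[s'`_j]/((a :: s')`_j.+1).
    by rewrite !s'E// ?ltrD2r ?(ltnW js)//; have [] := partition_nth ps js.
  apply/eqP; rewrite (last_nth 0) ss' s'E//.
  by rewrite (itv_partition_nth_size 0 ps) addrK.
have := H s' xi' ps'; rewrite /mesh ss' /riemann_stieltjes_sum ss'.
have -> : \big[Num.max/0]_(j < size s) ((a :: s')`_j.+1 - (a :: s')`_j) = mesh (a + tau) s.
  by apply: eq_bigr => j _; rewrite !s'E// 1?ltnW//; ring.
move=> /(_ ms); have xi'E j : (j < size s)%N -> xi'`_j = xi`_j - tau.
  by move=> js; rewrite nth_mkseq.
have -> : \sum_(j < size s) f xi'`_j * (g (a :: s')`_j.+1 - g (a :: s')`_j) =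
   \sum_(j < size s) f' xi`_j * (g' (a + tau :: s)`_j.+1 - g' (a + tau :: s)`_j).
  apply: eq_bigr => j _; have js := ltn_ord j; have [aj jj jb] := partition_nth ps js.
  have /andP[x1 x2] := xis j js.
  rewrite !s'E// 1?ltnW// xi'E// ff; last first.
    by rewrite lerBrDr lerBlDr (le_trans aj x1) (le_trans x2 jb).
  rewrite !gg ?subrK; last 2 first.
  - by rewrite lerBrDr lerBlDr aj (le_trans (ltW jj)).
  - by rewrite lerBrDr lerBlDr jb (le_trans aj (ltW jj)).
  by congr (_ * _); rewrite opprD addrACA subrr addr0.
apply => j js; rewrite xi'E// !s'E// 1?ltnW// !lerD2r.
exact: xis.
Qed.

Lemma RS_integral_shift f g f' g' a b tau c :
  (forall u, a <= u <= b -> f u = f' (u + tau)) ->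
  (forall u, a <= u <= b -> g u = g' (u + tau) + c) ->
  RS_integral f g a b = RS_integral f' g' (a + tau) (b + tau).
Proof.
move=> ff gg; congr xget; apply/seteqP; split => v /=.
  exact: is_RS_integral_shift ff gg.
have := @is_RS_integral_shift f' g' f g (a + tau) (b + tau) (- tau) (- c) v.
have ab u : a + tau <= u <= b + tau -> a <= u - tau <= b.
  by rewrite lerBrDr lerBlDr.
rewrite !addrK; apply => u /ab uab; first by rewrite ff// subrK.
by rewrite gg// subrK addrK.
Qed.

(** The Riemann sums of f dg differ from the telescoping sum of the increments of
    G by errors that are uniformly o(dt), so their total tends to 0. *)
Lemma is_RS_integral_increments f g G a b : a <= b ->
  (forall e, 0 < e -> exists2 del, 0 < del & forall u x u', a <= u -> u <= x ->
     x <= u' -> u' <= b -> u' - u < del ->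
     `|G u' - G u - f x * (g u' - g u)| <= e * (u' - u)) ->
  is_RS_integral f g a b (G b - G a).
Proof.
move=> ab H e e0; have c0 : 0 < b - a + 1 by rewrite ltr_wpDl// subr_ge0.
have [|del del0 {}H] := H (e / 2 / (b - a + 1)); first by rewrite !divr_gt0.
exists del => // s xi ps ms xis.
rewrite distrC -(partition_sum G ps) -sumrB.
apply: (@le_lt_trans _ _ (\sum_(j < size s) e / 2 / (b - a + 1) *
    ((a :: s)`_j.+1 - (a :: s)`_j))).
  apply: le_trans (ler_norm_sum _ _ _) _; apply: ler_sum => j _.
  have js := ltn_ord j; have [aj jj jb] := partition_nth ps js.
  have /andP[x1 x2] := xis j js; apply: H => //.
  exact: le_lt_trans (partition_gap_mesh _ js) ms.
rewrite -mulr_sumr (partition_sum id ps).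
apply: (@lt_le_trans _ _ (e / 2 / (b - a + 1) * (b - a + 1))).
  by rewrite ltr_pM2l ?divr_gt0// ltrDl.
by rewrite divfK ?gt_eqF// ler_pdivrMr// ler_peMr ?ler1n// ltW.
Qed.

Lemma RS_integral_const1 g a b : a <= b -> RS_integral (fun=> 1) g a b = g b - g a.
Proof.
move=> ab; apply: RS_integralE => //; apply: is_RS_integral_increments => // e e0.
exists 1 => // u x u' _ ux xu' _ _; rewrite mul1r subrr normr0.
by rewrite mulr_ge0 ?(ltW e0)// subr_ge0 (le_trans ux).
Qed.

End riemann_stieltjes.

(** * Iterated integrals *)

Section iterated_integrals.
Context {R : realType} {d : nat}.
Implicit Types (x y : R -> 'rV[R]_d) (a b s t tau : R) (w : seq 'I_d) (V : R -> R).

Lemma iterated_integral_rcons x w i s t : iterated_integral x (rcons w i) s t =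
  RS_integral (iterated_integral x w s) (fun r => x r ord0 i) s t.
Proof. by rewrite /iterated_integral foldl_rcons. Qed.

Lemma iterated_integral1 x i s t : s <= t ->
  iterated_integral x [:: i] s t = x t ord0 i - x s ord0 i.
Proof. by move=> st; exact: (RS_integral_const1 (fun r => x r ord0 i)). Qed.

Lemma iterated_integral_shift x y w s t tau c : s <= t ->
  (forall u, s <= u <= t -> x u = y (u + tau) + c) ->
  iterated_integral x w s t = iterated_integral y w (s + tau) (t + tau).
Proof.
elim/last_ind: w t => // w i IH t st xy.
rewrite !iterated_integral_rcons.
apply: (@RS_integral_shift _ _ _ _ _ _ _ _ (c ord0 i)) => u /andP[su ut].
  apply: IH => // r /andP[sr ru]; apply: xy.
  by rewrite sr (le_trans ru).
by rewrite xy ?su// mxE.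
Qed.

Lemma iterated_integral_bound x V w a b s t :
  (forall u u', a <= u -> u <= u' -> u' <= b -> V u <= V u') ->
  (forall u u' i, a <= u -> u <= u' -> u' <= b ->
     `|x u' ord0 i - x u ord0 i| <= V u' - V u) ->
  a <= s -> s <= t -> t <= b ->
  `|iterated_integral x w s t| <= (V t - V s) ^+ size w.
Proof.
move=> Vm xV as_ st tb; elim/last_ind: w t st tb => [|w i IH] t st tb.
  by rewrite /= normr1.
rewrite iterated_integral_rcons size_rcons exprSr.
have V0 : 0 <= V t - V s by rewrite subr_ge0 Vm.
apply: RS_integral_bound => //; first exact: exprn_ge0.
  move=> u /andP[su ut]; apply: le_trans (IH u su _) _; first exact: le_trans tb.
  by rewrite lerXn2r ?nnegrE ?subr_ge0 ?Vm ?lerD2r ?Vm// (le_trans as_ su, le_trans ut tb).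
move=> u u' su uu ut; apply: xV => //; [exact: le_trans su|exact: le_trans tb].
Qed.

(** Only the innermost integral needs a small oscillation of the path; each
    further integration costs at most a factor of its total variation. *)
Lemma iterated_integral_small x V w a b s t e :
  (forall u u', a <= u -> u <= u' -> u' <= b -> V u <= V u') ->
  (forall u u' i, a <= u -> u <= u' -> u' <= b ->
     `|x u' ord0 i - x u ord0 i| <= V u' - V u) ->
  a <= s -> s <= t -> t <= b -> 0 <= e ->
  (forall u i, s <= u <= t -> `|x u ord0 i - x s ord0 i| <= e) ->
  (0 < size w)%N ->
  `|iterated_integral x w s t| <= e * (V b - V a) ^+ (size w).-1.
Proof.
move=> Vm xV as_ st tb e0; elim/last_ind: w t st tb => [//|w i IH] t st tb xe _.
have W0 : 0 <= V b - V a by rewrite subr_ge0 Vm// (le_trans as_)// (le_trans st).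
rewrite size_rcons /=; case: w IH => [_|j w IH].
  by rewrite mulr1 iterated_integral1// xe// st lexx.
rewrite iterated_integral_rcons /= exprSr mulrA.
apply: le_trans (_ : _ <= e * (V b - V a) ^+ size w * (V t - V s)) _.
  apply: RS_integral_bound => //; first by rewrite mulr_ge0// exprn_ge0.
    move=> u /andP[su ut]; apply: IH => //; first exact: le_trans tb.
    by move=> r i' /andP[sr ru]; apply: xe; rewrite sr (le_trans ru).
  move=> u u' su uu ut; apply: xV => //; [exact: le_trans su|exact: le_trans tb].
rewrite ler_wpM2l ?mulr_ge0 ?exprn_ge0// lerB//; apply: Vm => //.
- exact: le_trans st.
- exact: le_trans tb.
Qed.

End iterated_integrals.

(** * Increments from iterated integrals *)

Section lifts.
Context {R : realType} {d N : nat}.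
Implicit Types (g h : T1 R d N) (S : R -> T1 R d N) (x : R -> 'rV[R]_d)
  (a b s t u K : R) (w : seq 'I_d).

Lemma size_take_leN w i : (size w <= N)%N -> (size (take i w) <= N)%N.
Proof. by apply: leq_trans; rewrite size_take_min geq_minr. Qed.

Lemma size_drop_leN w i : (size w <= N)%N -> (size (drop i w) <= N)%N.
Proof. by apply: leq_trans; rewrite size_drop leq_subr. Qed.

(** In the sum over the splittings of w, every term but one contains a nonempty
    word of h. *)
Lemma tcoef_mulr_near g h w (B e : R) : 0 <= B -> 0 <= e -> (size w <= N)%N ->
  (forall v : seq 'I_d, (size v <= N)%N -> `|tcoef (val g) v| <= B) ->
  (forall v : seq 'I_d, (0 < size v <= N)%N -> `|tcoef (val h) v| <= e) ->
  `|tcoef (val (g * h)%g) w - tcoef (val g) w| <= N%:R * (B * e).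
Proof.
move=> B0 e0 wN gB he; rewrite tcoef_valM// big_ord_recr /= take_size drop_size.
rewrite T1P mulr1 addrK; apply: le_trans (ler_norm_sum _ _ _) _.
apply: (@le_trans _ _ (\sum_(i < size w) B * e)); last first.
  by rewrite sumr_const card_ord -[leLHS]mulr_natl ler_wpM2r ?mulr_ge0// ler_nat.
apply: ler_sum => i _; rewrite normrM ler_pM//; first exact/gB/size_take_leN.
by apply: he; rewrite size_drop_leN// size_drop subn_gt0 ltn_ord.
Qed.

Lemma tcoef_mull_near g h w (B e : R) : 0 <= B -> 0 <= e -> (size w <= N)%N ->
  (forall v : seq 'I_d, (size v <= N)%N -> `|tcoef (val h) v| <= B) ->
  (forall v : seq 'I_d, (0 < size v <= N)%N -> `|tcoef (val g) v| <= e) ->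
  `|tcoef (val (g * h)%g) w - tcoef (val h) w| <= N%:R * (B * e).
Proof.
move=> B0 e0 wN hB ge; rewrite tcoef_valM// big_ord_recl /= take0 drop0.
rewrite T1P mul1r addrC addKr; apply: le_trans (ler_norm_sum _ _ _) _.
apply: (@le_trans _ _ (\sum_(i < size w) B * e)); last first.
  by rewrite sumr_const card_ord -[leLHS]mulr_natl ler_wpM2r ?mulr_ge0// ler_nat.
apply: ler_sum => i _; rewrite normrM [B * e]mulrC ler_pM//; last exact/hB/size_drop_leN.
by apply: ge; rewrite size_take_leN// size_take_min leq_min/= (leq_ltn_trans _ (ltn_ord i)).
Qed.

(** The splittings of w i that leave nothing, or only i, to h are isolated; the
    others contain a word of h of length at least 2. *)
Lemma tcoef_mul_rcons g h w i (B e : R) : 0 <= B -> 0 <= e -> (size w < N)%N ->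
  (forall v : seq 'I_d, (size v <= N)%N -> `|tcoef (val g) v| <= B) ->
  (forall v : seq 'I_d, (1 < size v <= N)%N -> `|tcoef (val h) v| <= e) ->
  `|tcoef (val (g * h)%g) (rcons w i) - tcoef (val g) (rcons w i) -
     tcoef (val g) w * tcoef (val h) [:: i]| <= N%:R * (B * e).
Proof.
move=> B0 e0 wN gB he; have wiN : (size (rcons w i) <= N)%N by rewrite size_rcons.
rewrite tcoef_valM// big_ord_recr /= take_size drop_size T1P mulr1 addrK.
rewrite size_rcons big_ord_recr /= -cats1 take_size_cat// drop_size_cat// addrK.
apply: le_trans (ler_norm_sum _ _ _) _.
apply: (@le_trans _ _ (\sum_(j < size w) B * e)); last first.
  by rewrite sumr_const card_ord -[leLHS]mulr_natl ler_wpM2r ?mulr_ge0// ler_nat ltnW.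
rewrite cats1; apply: ler_sum => j _; rewrite normrM ler_pM//.
  exact/gB/size_take_leN.
apply: he; rewrite size_drop_leN// andbT size_drop size_rcons.
by rewrite subSn ?(ltnW (ltn_ord j))// ltnS subn_gt0.
Qed.

(** By the multiplicativity of the increments (Chen's relation), the coefficient
    of w i grows by the coefficient of w times dx^i up to O(dt^2), the order of
    the levels from 2 on. So it is a Riemann-Stieltjes integral of the coefficient
    of w, and induction on the word identifies the increments with the iterated
    integrals. This gives the existence of the lift and Chen's relation for the
    iterated integrals at once. *)
Lemma incr_iterated_integral S x a b K : 0 <= K ->
  (forall u u' i, (1 <= N)%N -> a <= u -> u <= u' -> u' <= b ->
     tcoef (val (incr S u u')) [:: i] = x u' ord0 i - x u ord0 i) ->
  (forall u u' w, (size w <= N)%N -> a <= u -> u <= u' -> u' <= b ->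
     `|tcoef (val (incr S u u')) w| <= (K * (u' - u)) ^+ size w) ->
  forall s t, a <= s -> s <= t -> t <= b -> forall w, (size w <= N)%N ->
    tcoef (val (incr S s t)) w = iterated_integral x w s t.
Proof.
move=> K0 Sx SK s t as_ st tb w; elim/last_ind: w t st tb => [|w i IH] t st tb wN.
  by rewrite T1P.
rewrite size_rcons in wN; have wN' := ltnW wN.
have N1 : (1 <= N)%N by exact: leq_ltn_trans wN.
have ab : a <= b by rewrite (le_trans as_)// (le_trans st).
pose B := (1 + K * (b - a)) ^+ N.
have B1 : 1 <= 1 + K * (b - a) by rewrite lerDl mulr_ge0// subr_ge0.
have B2 : 0 <= 1 + K * (b - a) by exact: le_trans B1.
have B0 : 0 <= B by exact: exprn_ge0.
have SB u u' v : (size v <= N)%N -> a <= u -> u <= u' -> u' <= b ->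
    `|tcoef (val (incr S u u')) v| <= B.
  move=> vN au uu ub; apply: le_trans (SK u u' v vN au uu ub) _.
  apply: le_trans (_ : _ <= (1 + K * (b - a)) ^+ size v) _.
    rewrite lerXn2r ?nnegrE ?mulr_ge0 ?subr_ge0//.
    apply: (@le_trans _ _ (K * (b - a))); last by rewrite lerDr.
    by rewrite ler_wpM2l// lerB.
  exact: ler_weXn2l.
rewrite iterated_integral_rcons; apply/esym.
have -> : tcoef (val (incr S s t)) (rcons w i) =
    tcoef (val (incr S s t)) (rcons w i) - tcoef (val (incr S s s)) (rcons w i).
  by rewrite incrxx [X in _ - X]tcoef_val1 ?size_rcons// subr0.
apply: RS_integralE => //.
apply: (is_RS_integral_increments (G := fun u => tcoef (val (incr S s u)) (rcons w i))) => //.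
move=> e e0; pose C := N%:R * B * K ^+ 2 *+ 2 + 1.
have NBK0 : 0 <= N%:R * B * K ^+ 2 by rewrite !mulr_ge0// sqr_ge0.
have C0 : 0 < C by rewrite ltr_wpDl// mulrn_wge0.
exists (Num.min (e / C) (K + 1)^-1).
  by rewrite lt_min divr_gt0//= invr_gt0 ltr_wpDl.
move=> u r u' su ur ru' u't; rewrite lt_min => /andP[h1 h2].
set del := u' - u in h1 h2 *.
have del0 : 0 <= del by rewrite subr_ge0 (le_trans ur).
have au : a <= u by exact: le_trans su.
have uu' : u <= u' by exact: le_trans ru'.
have u'b : u' <= b by exact: le_trans tb.
have Kdel : K * del <= 1.
  have : (K + 1) * del <= 1 by rewrite mulrC -ler_pdivlMr ?div1r ?(ltW h2)// ltr_wpDl.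
  by apply: le_trans; rewrite mulrDl mul1r lerDl.
rewrite -(IH r); [|exact: le_trans ur|by rewrite (le_trans ru')|by []].
rewrite -(Sx u u' i)//.
have -> : tcoef (val (incr S s u')) (rcons w i) - tcoef (val (incr S s u)) (rcons w i) -
    tcoef (val (incr S s r)) w * tcoef (val (incr S u u')) [:: i] =
    (tcoef (val (incr S s u')) (rcons w i) - tcoef (val (incr S s u)) (rcons w i) -
      tcoef (val (incr S s u)) w * tcoef (val (incr S u u')) [:: i]) -
    (tcoef (val (incr S s r)) w - tcoef (val (incr S s u)) w) *
      tcoef (val (incr S u u')) [:: i] by ring.
apply: le_trans (_ : _ <= N%:R * B * K ^+ 2 * del ^+ 2 + N%:R * B * K ^+ 2 * del ^+ 2) _.
  apply: le_trans (ler_normB _ _) _; apply: lerD.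
    rewrite -(incrM S s u u') [leRHS](_ : _ = N%:R * (B * (K * del) ^+ 2)); last by ring.
    apply: tcoef_mul_rcons => //; first by rewrite exprn_ge0// mulr_ge0.
      by move=> v vN; apply: SB => //; exact: le_trans u'b.
    move=> v /andP[v2 vN]; apply: le_trans (SK u u' v vN au uu' u'b) _.
    by rewrite -/del; apply: ler_wiXn2l; rewrite ?mulr_ge0.
  rewrite normrM [leRHS](_ : _ = (N%:R * (B * (K * del))) * (K * del)); last by ring.
  rewrite ler_pM//.
    rewrite -(incrM S s u r); apply: tcoef_mulr_near => //; first by rewrite mulr_ge0.
      by move=> v vN; apply: SB => //; rewrite (le_trans ur)// (le_trans ru').
    move=> v /andP[v0 vN]; apply: le_trans (SK u r v vN au ur _) _.
      by rewrite (le_trans ru').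
    have rdel : K * (r - u) <= K * del by rewrite ler_wpM2l// lerD2r.
    apply: le_trans (ler_wiXn2l _ _ v0) _; rewrite ?expr1//.
      by rewrite mulr_ge0// subr_ge0.
    exact: le_trans Kdel.
  by have := SK u u' [:: i] N1 au uu' u'b; rewrite expr1.
rewrite [leLHS](_ : _ = N%:R * B * K ^+ 2 *+ 2 * del * del); last by ring.
rewrite ler_wpM2r//.
apply: (@le_trans _ _ (C * del)); first by rewrite ler_wpM2r// lerDl.
by rewrite mulrC -ler_pdivlMr// ltW.
Qed.

End lifts.

(** * The lift of a piecewise linear path *)

Section exponential.
Context {R : realType} {d N : nat}.
Implicit Types (g h : T1 R d N) (v : 'rV[R]_d) (w : seq 'I_d) (K M : R).

(** The binomial theorem divided by n!; it expresses both the additivity of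
    exponents and the multiplicativity of the bounds K^n / n!. *)
Lemma sum_exp_coef (x y : R) n :
  \sum_(i < n.+1) x ^+ i / i`!%:R * (y ^+ (n - i) / (n - i)`!%:R) =
  (x + y) ^+ n / n`!%:R.
Proof.
rewrite addrC exprDn mulr_suml; apply: eq_bigr => i _.
have fact_neq0 m : m`!%:R != 0 :> R by rewrite pnatr_eq0 -lt0n fact_gt0.
rewrite -(bin_fact (leq_ord i : i <= n)%N) -mulr_natr !natrM.
have C0 : 'C(n, i)%:R != 0 :> R by rewrite pnatr_eq0 -lt0n bin_gt0 leq_ord.
by field; rewrite C0 !fact_neq0.
Qed.

Definition word_prod v w : R := \prod_(i <- w) v ord0 i.

Definition exp_series v : tseries R d N :=
  [ffun w : N.-bseq 'I_d => word_prod v w / (size w)`!%:R].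

Lemma tcoef_exp_series v w : (size w <= N)%N ->
  tcoef (exp_series v) w = word_prod v w / (size w)`!%:R.
Proof. by move=> wN; rewrite /tcoef ffunE insub_bseqK. Qed.

Lemma exp_series_subproof v : tcoef (exp_series v) [::] == 1.
Proof. by rewrite tcoef_exp_series// /word_prod big_nil divr1. Qed.

Definition tensor_exp v : T1 R d N := exist _ (exp_series v) (exp_series_subproof v).

Lemma tcoef_tensor_exp v w : (size w <= N)%N ->
  tcoef (val (tensor_exp v)) w = word_prod v w / (size w)`!%:R.
Proof. exact: tcoef_exp_series. Qed.

Lemma word_prodZ (a : R) v w : word_prod (a *: v) w = a ^+ size w * word_prod v w.
Proof.
rewrite /word_prod; elim: w => [|i w IH]; first by rewrite !big_nil mulr1.
by rewrite !big_cons IH mxE/= exprS; ring.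
Qed.

Lemma word_prod_cat v w1 w2 : word_prod v (w1 ++ w2) = word_prod v w1 * word_prod v w2.
Proof. by rewrite /word_prod big_cat. Qed.

Lemma tensor_exp0 : tensor_exp 0 = 1%g.
Proof.
apply: T1_inj => w wN; rewrite tcoef_tensor_exp// tcoef_val1//.
case: w wN => [|i w] wN; first by rewrite /word_prod big_nil divr1.
by rewrite /word_prod big_cons mxE !mul0r.
Qed.

Lemma tensor_expD (a b : R) v :
  (tensor_exp (a *: v) * tensor_exp (b *: v))%g = tensor_exp ((a + b) *: v).
Proof.
apply: T1_inj => w wN; rewrite tcoef_valM// tcoef_tensor_exp// word_prodZ.
rewrite mulrAC -sum_exp_coef mulr_suml; apply: eq_bigr => i _.
rewrite !tcoef_tensor_exp ?size_take_leN ?size_drop_leN// !word_prodZ.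
rewrite size_takel; last by rewrite -ltnS.
rewrite size_drop.
rewrite (_ : word_prod v w = word_prod v (take i w) * word_prod v (drop i w)).
  by ring.
by rewrite -word_prod_cat cat_take_drop.
Qed.

Lemma incr_tensor_exp (a b : R) v :
  ((tensor_exp (a *: v))^-1 * tensor_exp (b *: v))%g = tensor_exp ((b - a) *: v).
Proof.
by apply: (mulgI (tensor_exp (a *: v))); rewrite mulVKg tensor_expD addrC subrK.
Qed.

Definition exp_bound K g := forall w, (size w <= N)%N ->
  `|tcoef (val g) w| <= K ^+ size w / (size w)`!%:R.

Lemma exp_bound_tensor_exp v M : (forall i, `|v ord0 i| <= M) ->
  exp_bound M (tensor_exp v).
Proof.
move=> vM w wN; rewrite tcoef_tensor_exp// normrM normfV [`|_%:R|]ger0_norm//.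
rewrite ler_wpM2r ?invr_ge0//; elim: w {wN} => [|i w IH].
  by rewrite /word_prod big_nil normr1.
by rewrite /word_prod big_cons normrM exprS ler_pM.
Qed.

Lemma exp_bound1 : exp_bound 0 1%g.
Proof.
move=> w wN; rewrite tcoef_val1// expr0n.
by case: w wN => [|i w] _; rewrite /= ?normr1 ?divr1// normr0 mul0r.
Qed.

Lemma exp_bound_mul K M g h : 0 <= K -> 0 <= M -> exp_bound K g -> exp_bound M h ->
  exp_bound (K + M) (g * h)%g.
Proof.
move=> K0 M0 gK hM w wN; rewrite tcoef_valM//.
apply: le_trans (ler_norm_sum _ _ _) _; rewrite -sum_exp_coef; apply: ler_sum => i _.
rewrite normrM ler_pM//.
  by have := gK (take i w); rewrite size_take_leN// size_takel; [exact|rewrite -ltnS].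
by have := hM (drop i w); rewrite size_drop_leN// size_drop; exact.
Qed.

Lemma exp_bound_le K M g : 0 <= K -> K <= M -> exp_bound K g -> exp_bound M g.
Proof.
move=> K0 KM gK w wN; apply: le_trans (gK w wN) _.
by rewrite ler_wpM2r ?invr_ge0// lerXn2r// nnegrE (le_trans K0).
Qed.

Lemma exp_bound_pow K g w : 0 <= K -> exp_bound K g -> (size w <= N)%N ->
  `|tcoef (val g) w| <= K ^+ size w.
Proof.
move=> K0 gK wN; apply: le_trans (gK w wN) _.
rewrite ler_pdivrMr ?ltr0n ?fact_gt0// ler_peMr ?exprn_ge0//.
by rewrite ler1n fact_gt0.
Qed.

Lemma tcoef_mul_letter g h i : (1 <= N)%N ->
  tcoef (val (g * h)%g) [:: i] = tcoef (val h) [:: i] + tcoef (val g) [:: i].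
Proof.
by move=> N1; rewrite tcoef_valM// !big_ord_recl big_ord0/= !T1P; ring.
Qed.

End exponential.

Section piecewise_linear.
Context {R : realType} {d N : nat}.
Implicit Types (x : R -> 'rV[R]_d) (a b u : R) (s : seq R).

(** On a linear piece the lift is the exponential of the displacement, and the
    lifts of consecutive pieces multiply. *)
Fixpoint pl_lift x a s u : T1 R d N :=
  if s is b :: s' then
    if u <= b then tensor_exp (((u - a) / (b - a)) *: (x b - x a))
    else (tensor_exp (x b - x a) * pl_lift x b s' u)%g
  else 1%g.

Lemma pl_lift_start x a s : path <%R a s -> pl_lift x a s a = 1%g.
Proof.
case: s => //= b s /andP[ab _].
by rewrite (ltW ab) subrr mul0r scale0r tensor_exp0.
Qed.

Lemma pl_interp_start x a s : path <%R a s -> pl_interp x a s a = x a.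
Proof.
by case: s => //= b s /andP[ab _]; rewrite (ltW ab) subrr mul0r scale0r addr0.
Qed.

(** Inside a linear piece the increments are exponentials, and the factorial
    bounds on both sides of a breakpoint add up their exponents. *)
Lemma pl_lift_regular x a s : path <%R a s -> exists2 K, 0 <= K &
  forall u u', a <= u -> u <= u' -> u' <= last a s ->
    (forall i, (1 <= N)%N -> tcoef (val (incr (pl_lift x a s) u u')) [:: i] =
       pl_interp x a s u' ord0 i - pl_interp x a s u ord0 i) /\
    exp_bound (K * (u' - u)) (incr (pl_lift x a s) u u').
Proof.
elim: s a => [|b s IH] a.
  move=> _; exists 0 => // u u' au uu ub.
  have ua : u = a by apply/le_anti; rewrite au andbT (le_trans uu).
  have u'a : u' = a by apply/le_anti; rewrite ub (le_trans au).
  rewrite ua u'a incrxx mul0r; split; last exact: exp_bound1.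
  by move=> i N1; rewrite tcoef_val1// subrr.
case/andP=> ab bs; have [K1 K10 {}IH] := IH b bs.
pose v := x b - x a; pose c := b - a; have c0 : 0 < c by rewrite subr_gt0.
pose M := \sum_i `|v ord0 i|.
have M0 : 0 <= M by exact: sumr_ge0.
have vM i : `|v ord0 i| <= M by rewrite /M (bigD1 i)//= lerDl sumr_ge0.
exists (M / c + K1); first by rewrite addr_ge0// divr_ge0// ltW.
set S := pl_lift x a (b :: s); set p := pl_interp x a (b :: s).
have Sle u : u <= b -> S u = tensor_exp (((u - a) / c) *: v) by move=> ub; rewrite /S/= ub.
have ple u : u <= b -> p u = x a + ((u - a) / c) *: v by move=> ub; rewrite /p/= ub.
have Sb : S b = tensor_exp v by rewrite Sle// divff ?gt_eqF// scale1r.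
have Sgt u : b <= u -> S u = (tensor_exp v * pl_lift x b s u)%g.
  rewrite le_eqVlt => /predU1P[<-|bu]; first by rewrite Sb pl_lift_start// mulg1.
  by rewrite /S/= leNgt bu.
have pgt u : b <= u -> p u = pl_interp x b s u.
  rewrite le_eqVlt => /predU1P[<-|bu]; last by rewrite /p/= leNgt bu.
  by rewrite ple// divff ?gt_eqF// scale1r pl_interp_start// addrC subrK.
have incrgt u u' : b <= u -> b <= u' -> incr S u u' = incr (pl_lift x b s) u u'.
  by move=> bu bu'; rewrite /incr !Sgt// invgM -mulgA mulKg.
have lo u u' : a <= u -> u <= u' -> u' <= b ->
    (forall i, (1 <= N)%N -> tcoef (val (incr S u u')) [:: i] =
       p u' ord0 i - p u ord0 i) /\
    exp_bound ((M / c + K1) * (u' - u)) (incr S u u').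
  move=> au uu ub; have ub' : u <= b by exact: le_trans ub.
  have -> : incr S u u' = tensor_exp (((u' - u) / c) *: v).
    by rewrite /incr !Sle// incr_tensor_exp -mulrBl opprB addrA subrK.
  split=> [i N1|].
    rewrite tcoef_tensor_exp// /word_prod big_seq1 divr1 !ple// !mxE.
    by field; rewrite gt_eqF.
  have uu0 : 0 <= (u' - u) / c by rewrite divr_ge0 ?subr_ge0// ltW.
  apply: (@exp_bound_le _ _ _ ((u' - u) / c * M)); first by rewrite mulr_ge0.
    rewrite [leRHS]mulrDl [leLHS](_ : _ = M / c * (u' - u)); last by ring.
    by rewrite lerDl mulr_ge0// subr_ge0.
  by apply: exp_bound_tensor_exp => i; rewrite mxE normrM ger0_norm// ler_wpM2l.
have hi u u' : b <= u -> u <= u' -> u' <= last b s ->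
    (forall i, (1 <= N)%N -> tcoef (val (incr S u u')) [:: i] =
       p u' ord0 i - p u ord0 i) /\
    exp_bound ((M / c + K1) * (u' - u)) (incr S u u').
  move=> bu uu ul; have bu' := le_trans bu uu; have [l1 l2] := IH u u' bu uu ul.
  rewrite incrgt// !pgt//; split => //; apply: exp_bound_le l2.
    by rewrite mulr_ge0// subr_ge0.
  by rewrite ler_wpM2r ?subr_ge0// lerDr divr_ge0// ltW.
move=> u u' au uu ul.
have [u'b|bu'] := leP u' b; first exact: lo.
have [bu|ub] := leP b u; first exact: hi.
have [l1 b1] := lo u b au (ltW ub) (lexx b).
have [l2 b2] := hi b u' (lexx b) (ltW bu') ul.
rewrite -(incrM S u b u'); split => [i N1|].
  by rewrite tcoef_mul_letter// l1// l2// addrA subrK.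
have K0 : 0 <= M / c + K1 by rewrite addr_ge0// divr_ge0// ltW.
rewrite [_ * (u' - u)](_ : _ = (M / c + K1) * (b - u) + (M / c + K1) * (u' - b)); last by ring.
by apply: exp_bound_mul => //; rewrite mulr_ge0// subr_ge0 ltW.
Qed.

Lemma measurable_pl_lift {disp} {T : measurableType disp} (y : T -> R -> 'rV[R]_d)
    a s u : (forall t i, measurable_fun setT (fun z => y z t ord0 i)) ->
  forall w : seq 'I_d, (size w <= N)%N ->
    measurable_fun setT (fun z => tcoef (val (pl_lift (y z) a s u)) w).
Proof.
move=> my.
have mexp (v : T -> 'rV[R]_d) : (forall i, measurable_fun setT (fun z => v z ord0 i)) ->
    forall w : seq 'I_d, (size w <= N)%N ->
    measurable_fun setT (fun z => tcoef (val (tensor_exp (v z) : T1 R d N)) w).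
  move=> mv w wN; rewrite (_ : (fun _ => _) = fun z => word_prod (v z) w / (size w)`!%:R).
    apply: measurable_funM; last exact: measurable_cst.
    elim: w {wN} => [|i w IH].
      rewrite (_ : (fun _ => _) = fun=> 1)//.
      by apply/funext => z; rewrite /word_prod big_nil.
    rewrite (_ : (fun _ => _) = fun z => v z ord0 i * word_prod (v z) w).
      exact: measurable_funM.
    by apply/funext => z; rewrite /word_prod big_cons.
  by apply/funext => z; rewrite tcoef_tensor_exp.
elim: s a => [|b s IH] a w wN /=; first exact: measurable_cst.
have mv i : measurable_fun setT (fun z => (y z b - y z a) ord0 i).
  rewrite (_ : (fun _ => _) = fun z => y z b ord0 i - y z a ord0 i).
    exact: measurable_funB.
  by apply/funext => z; rewrite !mxE.
have [ub|bu] := leP u b.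
  apply: mexp => // i.
  rewrite (_ : (fun _ => _) = fun z => (u - a) / (b - a) * (y z b - y z a) ord0 i).
    by apply: measurable_funM => //; exact: measurable_cst.
  by apply/funext => z; rewrite !mxE.
apply: (@coef_class_mul R d N T (fun h l => measurable_fun setT h) _ _ _
  (fun z => val (tensor_exp (y z b - y z a) : T1 R d N)) (fun z => val (pl_lift (y z) b s u)) 1 1) => //.
- by move=> h h' _ _; exact: measurable_funD.
- by move=> h h' _ _; exact: measurable_funM.
- exact: mexp.
- exact: IH.
Qed.

End piecewise_linear.

(** * Canonical lifts *)

Section canonical_lifts.
Context {R : realType} {d N : nat}.
Implicit Types (S : R -> T1 R d N) (x y : R -> 'rV[R]_d) (a b s t tau : R).

Lemma canonical_lift_incr a b x S : is_canonical_lift a b x S ->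
  forall s t, a <= s -> s <= t -> t <= b ->
  incr (canonical_lift N a b x) s t = incr S s t.
Proof.
move=> [S0 SS] s t as_ st tb; apply: T1_inj => w wN.
have [_ CC] : is_canonical_lift a b x (canonical_lift N a b x).
  by apply: (@xgetPex _ _ [set S | is_canonical_lift a b x S]); exists S.
by rewrite SS// CC.
Qed.

Lemma canonical_lift_none a b x : (forall S, ~ is_canonical_lift a b x S) ->
  canonical_lift N a b x = fun=> 1%g.
Proof. exact: xgetPN. Qed.

Lemma is_canonical_lift_shift a b a' b' tau c x y S :
  a' <= a + tau -> b + tau <= b' -> is_canonical_lift a' b' x S ->
  (forall u, a <= u <= b -> y u = x (u + tau) + c) ->
  is_canonical_lift a b y (shift_path tau S).
Proof.
move=> aa bb [_ SS] yx; split; first exact: shift_path0.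
move=> s t as_ st tb w wN; rewrite incr_shift_path ![tau + _]addrC SS//.
- apply/esym/(@iterated_integral_shift _ _ _ _ _ _ _ _ c) => // u /andP[su ut].
  by apply: yx; rewrite (le_trans as_ su) (le_trans ut tb).
- by apply: le_trans aa _; rewrite lerD2r.
- by rewrite lerD2r.
- by apply: le_trans bb; rewrite lerD2r.
Qed.

(** pl_lift starts from 1 at time a; shifting it by 0 normalizes it at time 0. *)
Lemma pl_is_canonical_lift a b l x : itv_partition a b l ->
  is_canonical_lift a b (pl_interp x a l)
    (shift_path 0 (pl_lift x a l) : R -> T1 R d N).
Proof.
move=> [al /eqP lb]; have [K K0 Kl] := @pl_lift_regular R d N x a l al.
split; first exact: shift_path0.
move=> s t as_ st tb w wN; rewrite incr_shift_path !add0r.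
apply: (@incr_iterated_integral _ _ _ _ _ a b K) => // [u u' i N1|u u' v vN] au uu ub.
  by have [|-> //] := Kl u u' au uu; first rewrite lb.
have [|_ KB] := Kl u u' au uu; first by rewrite lb.
by apply: exp_bound_pow => //; rewrite mulr_ge0// subr_ge0.
Qed.

Definition incr_modulus a b S : Prop := forall e, 0 < e -> exists2 del, 0 < del &
  forall s t, a <= s -> s <= t -> t <= b -> t - s < del ->
  forall w : seq 'I_d, (0 < size w <= N)%N -> `|tcoef (val (incr S s t)) w| <= e.

Lemma incr_modulus_cont a b S : incr_modulus a b S -> cont_on a b S.
Proof.
move=> Sm t tab.
pose H u := if t <= u then incr S t u else incr S u t.
pose F := within `[a, b] (nbhs t).
(* The modulus only concerns increments forward in time; to the left of t the
   increment from t is the inverse of such an increment. *)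
have H1 (w : seq 'I_d) : (size w <= N)%N ->
    tcoef (val (H u)) w @[u --> F] --> tcoef (val (1%g : T1 R d N)) w.
  move=> wN; apply/cvgrPdist_le => e e0; have [del del0 Hdel] := Sm e e0.
  rewrite /F; near=> u.
  have uab : a <= u <= b.
    have : `[a, b]%classic u by near: u; exact: withinT.
    by rewrite /= in_itv.
  have ut : `|t - u| < del.
    by near: u; apply: cvg_within; exact: (nbhsx_ballx t del del0).
  rewrite distrC tcoef_val1//; have [->|w0] := eqVneq w [::].
    by rewrite T1P subrr normr0 ltW.
  have -> : size w == 0%N = false by case: w w0 {wN}.
  rewrite subr0; have w1 : (0 < size w <= N)%N by rewrite wN andbT; case: w w0 {wN}.
  move: ut uab tab => ut /andP[au ub] /andP[at_ tb].
  rewrite /H; case: (leP t u) => tu; apply: Hdel => //.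
  - by move: ut; rewrite distrC => /(le_lt_trans (ler_norm _)).
  - exact: ltW.
  - by move: ut => /(le_lt_trans (ler_norm _)).
have H2 : coef_class (fun h l => h u @[u --> F] --> l) (fun u => val (H u)^-1%g)
    (val (1^-1%g : T1 R d N)).
  apply: coef_class_inv => //.
  - by move=> c; exact: cvg_cst.
  - by move=> f g k l; exact: cvgD.
  - by move=> f g k l; exact: cvgM.
have H3 (w : seq 'I_d) : (size w <= N)%N ->
    tcoef (val (incr S t u)) w @[u --> F] --> tcoef (val (1%g : T1 R d N)) w.
  move=> wN; apply/cvgrPdist_le => e e0; near=> u.
  have h1 : `|tcoef (val (1%g : T1 R d N)) w - tcoef (val (H u)) w| <= e.
    by near: u; apply: cvgr_dist_le => //; exact: H1.
  have h2 : `|tcoef (val (1%g : T1 R d N)) w - tcoef (val (H u)^-1%g) w| <= e.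
    by near: u; apply: cvgr_dist_le => //; have := H2 w wN; rewrite invg1.
  move: h1 h2; rewrite /H; case: (leP t u) => //.
  by rewrite /incr invgM invgK.
have cS : coef_class (fun h l => h u @[u --> F] --> l)
    (fun u => val (S t * incr S t u)%g) (val (S t * 1)%g).
  apply: (@coef_class_mul _ _ _ _ (fun h l => h u @[u --> F] --> l) _ _ _ (fun=> val (S t))
    (fun u => val (incr S t u)) (val (S t)) (val (1%g : T1 R d N))) => //.
  - by move=> c; exact: cvg_cst.
  - by move=> f g k l; exact: cvgD.
  - by move=> f g k l; exact: cvgM.
  - by move=> w wN; exact: cvg_cst.
move=> w wN; have := cS w wN; rewrite mulg1.
rewrite (_ : (fun _ => _) = fun u => tcoef (val (S u)) w)//.
by apply/funext => u; rewrite /incr mulVKg.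
Unshelve. all: by end_near. Qed.

Lemma pl_lift_cont a b l x : itv_partition a b l -> cont_on a b (pl_lift x a l : R -> T1 R d N).
Proof.
move=> [al /eqP lb]; have [K K0 Kl] := @pl_lift_regular R d N x a l al.
apply: incr_modulus_cont => e e0.
exists (Num.min 1 e / (K + 1)).
  by rewrite divr_gt0 ?lt_min ?ltr01//= ltr_wpDl.
move=> s t as_ st tb; rewrite ltr_pdivlMr ?ltr_wpDl// lt_min => /andP[h1 he].
move=> w /andP[w0 wN]; have [|_ KB] := Kl s t as_ st; first by rewrite lb.
have ts0 : 0 <= t - s by rewrite subr_ge0.
have Kts : K * (t - s) <= (t - s) * (K + 1) by rewrite mulrC mulrDr mulr1 lerDl.
apply: le_trans (exp_bound_pow _ KB wN) _; first by rewrite mulr_ge0.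
apply: le_trans (ler_wiXn2l _ _ w0) _; rewrite ?mulr_ge0//.
  by rewrite (le_trans Kts)// ltW.
by rewrite expr1 (le_trans Kts)// ltW.
Qed.

End canonical_lifts.

(** * Paths in the closure of the smooth paths in 1-variation *)

Section closure_of_smooth_paths.
Context {R : realType} {d : nat} (nrm : tensor_norm R d).
Implicit Types (x y z : R -> 'rV[R]_d) (a b s t tau : R).

Lemma derivable_lipschitz (f : R -> R) a b : a <= b ->
  (forall t, derivable f t 1) -> (forall t, derivable (derive1 f) t 1) ->
  exists2 K, 0 <= K &
    forall u u', a <= u -> u <= u' -> u' <= b -> `|f u' - f u| <= K * (u' - u).
Proof.
move=> ab df ddf.
have cf : continuous f.
  by move=> t; apply/differentiable_continuous/derivable1_diffP.
have cdf : continuous (fun t => `|(derive1 f) t|).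
  move=> t; apply: continuous_comp; last exact: norm_continuous.
  exact/differentiable_continuous/derivable1_diffP.
have [c _ cmax] := EVT_max ab (continuous_subspaceT cdf).
exists `|(derive1 f) c| => // u u' au uu ub.
have [|r rab ->] := @MVT_segment _ f (derive1 f) u u' uu _ (continuous_subspaceT cf).
  by move=> r _; rewrite derive1E; exact: derivableP.
rewrite normrM [X in _ * X]ger0_norm ?subr_ge0// ler_wpM2r ?subr_ge0//.
apply: cmax; move: rab; rewrite !in_itv/= => /andP[ur ru].
by rewrite (le_trans au ur) (le_trans ru ub).
Qed.

Lemma tensor1_coord_le : exists2 C, 0 < C &
  forall (v : 'rV[R]_d) i, `|v ord0 i| <= C * nrm 1%N (tensor1 v).
Proof.
have [C C0 CP] := tnorm_ge_coord nrm 1; exists C => // v i.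
by have := CP (tensor1 v) [tuple i]; rewrite ffunE.
Qed.

(** A path in the closure differs from a Lipschitz one by a path of small
    1-variation, hence is uniformly continuous and of bounded variation. *)
Lemma C0_1var_regular a b x : a <= b -> C0_1var nrm a b x -> exists V : R -> R,
  [/\ forall u u', a <= u -> u <= u' -> u' <= b -> V u <= V u',
      forall u u' i, a <= u -> u <= u' -> u' <= b ->
        `|x u' ord0 i - x u ord0 i| <= V u' - V u &
      forall e, 0 < e -> exists2 del, 0 < del & forall u u' i,
        a <= u -> u <= u' -> u' <= b -> u' - u < del ->
        `|x u' ord0 i - x u ord0 i| <= e].
Proof.
move=> ab [_ xcl]; have [C C0 CP] := tensor1_coord_le.
have dec e : 0 < e -> exists2 K, 0 <= K & exists2 z : R -> 'rV[R]_d,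
    (forall D, finite_subset a b D ->
      \sum_(i < (size D).-1) nrm 1%N (tensor1 (z D`_i.+1 - z D`_i)) <= e) &
    forall u u' i, a <= u -> u <= u' -> u' <= b ->
    `|x u' ord0 i - x u ord0 i| <= C * nrm 1%N (tensor1 (z u' - z u)) + K * (u' - u).
  move=> e0; have [y [ysm _ xy]] := xcl e e0.
  have /choice[K KP] : forall i, exists K, 0 <= K /\ forall u u', a <= u -> u <= u' ->
      u' <= b -> `|y u' ord0 i - y u ord0 i| <= K * (u' - u).
    move=> i; have [||K K0 KP] := @derivable_lipschitz (fun t => y t ord0 i) a b ab.
    - by move=> t; exact: (ysm i 0%N t).
    - by move=> t; exact: (ysm i 1%N t).
    - by exists K.
  exists (\sum_i K i); first by apply: sumr_ge0 => i _; exact: (KP i).1.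
  exists (fun t => x t - y t).
    move=> D Dab; rewrite -lee_fin; apply: le_trans (ltW xy).
    by apply: ereal_sup_ubound; exists D.
  move=> u u' i au uu ub.
  have -> : x u' ord0 i - x u ord0 i = ((x u' - y u') - (x u - y u)) ord0 i +
      (y u' ord0 i - y u ord0 i) by rewrite !mxE; ring.
  apply: le_trans (ler_normD _ _) _; apply: lerD; first exact: CP.
  apply: le_trans ((KP i).2 u u' au uu ub) _; rewrite ler_wpM2r ?subr_ge0//.
  by rewrite (bigD1 i)//= lerDl sumr_ge0// => j _; exact: (KP j).1.
have bv i : bounded_variation a b (fun t => x t ord0 i).
  have [K K0 [z zD xz]] := dec 1 ltr01.
  exists (C * 1 + K * (b - a)) => _ [l pl <-].
  have pD : finite_subset a b (a :: l).
    have [al _] := pl; split => // t /(nthP 0)[j jl <-].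
    rewrite (set_nth_default b)//; apply/andP; split.
      exact: itv_partition_nth_ge.
    exact: itv_partition_nth_le.
  rewrite /variation big_mkord.
  apply: le_trans (_ : _ <= \sum_(j < size l) (C * nrm 1%N (tensor1
      (z (a :: l)`_j.+1 - z (a :: l)`_j)) + K * ((a :: l)`_j.+1 - (a :: l)`_j))) _.
    apply: ler_sum => j _; have [aj jj jb] := partition_nth pl (ltn_ord j).
    rewrite /= -[nth b l j]/(nth b (a :: l) j.+1) !(set_nth_default 0 b) ?ltnS ?(ltnW (ltn_ord j))//.
    by apply: xz => //; exact: ltW.
  rewrite big_split/= -!mulr_sumr (partition_sum id pl) lerD2r.
  by rewrite ler_wpM2l ?(ltW C0)//; exact: zD pD.
exists (fun t => \sum_i fine (total_variation a t (fun t => x t ord0 i))); split.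
- move=> u u' au uu ub; apply: ler_sum => i _; have au' := le_trans au uu.
  have fin t : a <= t -> t <= b -> total_variation a t (fun t => x t ord0 i) \is a fin_num.
    by move=> at_ tb; apply/bounded_variationP => //; exact: bounded_variationl (bv i).
  rewrite fine_le ?fin// ?(le_trans uu)//.
  by rewrite [leRHS](total_variationD _ au uu) leeDl// total_variation_ge0.
- move=> u u' i au uu ub; have au' := le_trans au uu.
  have TVD j : fine (total_variation a u' (fun t => x t ord0 j)) -
      fine (total_variation a u (fun t => x t ord0 j)) =
      fine (total_variation u u' (fun t => x t ord0 j)).
    rewrite (total_variationD _ au uu) fineD ?[_ + _ - _]addrAC ?subrr ?add0r//.
      apply/bounded_variationP => //; apply: bounded_variationl (bv j) => //.
      exact: le_trans ub.
    apply/bounded_variationP => //; apply: (@bounded_variationr _ a) => //.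
    exact: bounded_variationl (bv j).
  rewrite -sumrB (bigD1 i)//= TVD; apply: ler_wpDr.
    apply: sumr_ge0 => j _; rewrite TVD fine_ge0// total_variation_ge0//.
  rewrite -lee_fin fineK; first exact: total_variation_ge.
  apply/bounded_variationP => //; apply: (@bounded_variationr _ a) => //.
  exact: bounded_variationl (bv i).
move=> e e0; have [|K K0 [z zD xz]] := dec (e / 2 / C); first by rewrite !divr_gt0.
exists (e / 2 / (K + 1)); first by rewrite !divr_gt0// ltr_wpDl.
move=> u u' i au uu ub uud; apply: le_trans (xz u u' i au uu ub) _.
rewrite [e]splitr; apply: lerD.
  rewrite mulrC -ler_pdivlMr//; move: uu; rewrite le_eqVlt => /predU1P[<-|uu].
    rewrite subrr (_ : tensor1 0 = 0) ?tnorm0 ?divr_ge0 ?ltW// ?divr_gt0//.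
    by apply/ffunP => v; rewrite !ffunE mxE.
  have := zD [:: u; u']; rewrite big_ord_recl big_ord0 addr0; apply.
  split; rewrite /= ?uu// => t; rewrite !inE => /orP[]/eqP->.
    by rewrite au (le_trans (ltW uu)).
  by rewrite ub (le_trans au)// ltW.
have : (u' - u) * (K + 1) <= e / 2 by rewrite -ler_pdivlMr ?ltW// ltr_wpDl.
by apply: le_trans; rewrite mulrC mulrDr mulr1 lerDl subr_ge0.
Qed.

End closure_of_smooth_paths.

(** * Shifts of rough paths *)

Section shift_closure.
Context {R : realType} {d : nat} (nrm : tensor_norm R d).
Implicit Types (x y : R -> 'rV[R]_d) (a b s t tau p : R).

Lemma derivable_shift (f : R -> R) tau c t : derivable f (t + tau) 1 ->
  derivable (fun u => f (u + tau) + c) t 1.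
Proof.
rewrite /derivable => df; rewrite (_ : (fun h => _) = fun h =>
  h^-1 *: ((f \o shift (t + tau)) (h *: 1) - f (t + tau)))//.
by apply/funext => h /=; congr (_ *: _); rewrite [in RHS]addrA; ring.
Qed.

Lemma derive1_shift (f : R -> R) tau c t :
  derive1 (fun u => f (u + tau) + c) t = derive1 f (t + tau).
Proof.
rewrite /derive1 (_ : (fun h => h^-1 *: (f (h + t + tau) + c - (f (t + tau) + c))) =
  fun h => h^-1 *: (f (h + (t + tau)) - f (t + tau)))//.
by apply/funext => h /=; congr (_ *: _); rewrite [in RHS]addrA; ring.
Qed.

Lemma smooth_path_shift y tau c :
  smooth_path y -> smooth_path (fun t => y (t + tau) + c).
Proof.
move=> ys i n t.
have [cn ->] : exists cn : R, derive1n n (fun u => (y (u + tau) + c) ord0 i) =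
    fun u => derive1n n (fun u => y u ord0 i) (u + tau) + cn.
  elim: n => [|n [cn IH]].
    by exists (c ord0 i); apply/funext => u; rewrite /= mxE.
  by exists 0; rewrite !derive1nS IH; apply/funext => u; rewrite derive1_shift addr0.
exact/derivable_shift/ys.
Qed.

Lemma C0_1var_shift a b a' b' tau x : a' <= a + tau -> b + tau <= b' ->
  C0_1var nrm a' b' x -> C0_1var nrm a b (fun t => x (t + tau) - x tau).
Proof.
move=> aa bb [x0 xcl]; split; first by rewrite add0r subrr.
move=> e e0; have [y [ys y0 xy]] := xcl e e0.
exists (fun t => y (t + tau) - y tau); split.
- exact: smooth_path_shift.
- by rewrite add0r subrr.
apply: le_lt_trans xy; apply: ge_ereal_sup => _ [D [Ds Dab] <-].
apply: ereal_sup_ubound; exists [seq t + tau | t <- D].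
  split.
    by rewrite sorted_map; apply: sub_sorted Ds => u v /=; rewrite ltrD2r.
  move=> _ /mapP[t /Dab /andP[at_ tb] ->].
  by rewrite (le_trans aa) ?lerD2r// (le_trans _ bb)// lerD2r.
rewrite size_map; congr EFin; apply: eq_bigr => i _.
have iD : (i.+1 < size D)%N by rewrite -ltn_predRL.
rewrite !(nth_map 0)// ?(ltnW iD)//; congr (nrm 1%N (tensor1 _)).
by apply/rowP => j; rewrite !mxE; ring.
Qed.

Lemma C0_1var_zero a b : C0_1var nrm a b (fun=> 0).
Proof.
split=> // e e0; exists (fun=> 0); split => //.
  move=> i n t; suff -> : derive1n n (fun u => (0 : 'rV[R]_d) ord0 i) = fun=> 0.
    exact: derivable_cst.
  elim: n => [|n IH]; first by apply/funext => r; rewrite /= mxE.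
  by rewrite derive1nS IH; apply/funext => r; rewrite derive1_cst.
apply: (@le_lt_trans _ _ 0%E); last by rewrite lte_fin.
apply: ge_ereal_sup => _ [D _ <-]; rewrite big1// => i _.
by rewrite !subrr (_ : tensor1 0 = 0) ?tnorm0//; apply/ffunP => u; rewrite !ffunE mxE.
Qed.

Lemma d_pvar_ge0 N p a b (X Y : R -> T1 R d N) : (0 <= d_pvar nrm p a b X Y)%E.
Proof. exact: bigmax_ge_id. Qed.

(** When the iterated integrals of an approximating path do not form a lift,
    its canonical lift is the constant path, which is also the lift of the zero
    path; so the approximating paths can always be assumed to have a lift. *)
Lemma C0_pvar_on_approx p a b X : 1 <= p -> C0_pvar_on nrm p a b X ->
  forall e, 0 < e -> exists x S, [/\ C0_1var nrm a b x,
    is_canonical_lift a b x S & pvar_le nrm p a b X S e].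
Proof.
move=> p1 [_ _ [x xC xX]] e e0; have p0 : 0 < p by exact: lt_le_trans p1.
have [n /= nP] : exists n, (d_pvar nrm p a b X
    (canonical_lift (Num.truncn p) a b (x n)) < e%:E)%E.
  have /xX[n _ nP] : nbhs 0%E [set y : \bar R | (y < e%:E)%E].
    apply: (open_nbhs_nbhs (conj _ _)); first exact: open_ereal_lt_ereal.
    by rewrite /= lte_fin.
  by exists n; exact: nP (leqnn n).
have XS : pvar_le nrm p a b X (canonical_lift (Num.truncn p) a b (x n)) e.
  by apply/d_pvar_leP; rewrite ?(ltW e0) ?(ltW nP).
have [[S SP]|nS] := pselect (exists S : R -> T1 R d (Num.truncn p),
    is_canonical_lift a b (x n) S).
  exists (x n), S; split; [exact: xC|exact: SP|].
  by apply: pvar_le_eqr XS => s t; exact: canonical_lift_incr.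
exists (fun=> 0), (fun=> 1%g); split.
- exact: C0_1var_zero.
- exact: is_canonical_lift0.
- move: XS; rewrite canonical_lift_none// => S SP; apply: nS.
  by exists S.
Qed.

Lemma C0_pvar_on_intro p a b (X : R -> T1 R d (Num.truncn p)) : 1 <= p ->
  (forall w, {within `[a, b], continuous (fun t => tcoef (val (X t)) w)}) ->
  X 0 = 1%g ->
  (forall e, 0 < e -> exists x S, [/\ C0_1var nrm a b x,
     is_canonical_lift a b x S & pvar_le nrm p a b X S e]) ->
  C0_pvar_on nrm p a b X.
Proof.
move=> p1 cX X0 H; have p0 : 0 < p by exact: lt_le_trans p1.
split => //.
have /choice[x xP] : forall n, exists x, C0_1var nrm a b x /\
    (d_pvar nrm p a b X (canonical_lift (Num.truncn p) a b x) <= (harmonic n)%:E)%E.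
  move=> n; have [|x [S [xC xS XS]]] := H (harmonic n); first exact: harmonic_gt0.
  exists x; split; first exact: xC.
  apply/d_pvar_leP; [exact: p0|exact: harmonic_ge0|].
  by apply: pvar_le_eqr XS => s t as_ st tb; rewrite (canonical_lift_incr xS).
exists x => [n|]; first by case: (xP n).
rewrite (_ : (fun _ => _) = fun n => (fine (d_pvar nrm p a b X
    (canonical_lift (Num.truncn p) a b (x n))))%:E).
  apply: cvg_EFin; first by near=> n.
  apply: (@squeeze_cvgr _ _ _ _ (fun=> 0) harmonic); last 2 first.
  - exact: cvg_cst.
  - exact: cvg_harmonic.
  near=> n; have [_ nP] := xP n; rewrite /= fine_ge0 ?d_pvar_ge0//=.
  by rewrite -lee_fin fineK// ge0_fin_numE ?d_pvar_ge0// (le_lt_trans nP)// ltry.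
apply/funext => n; have [_ nP] := xP n.
by rewrite fineK// ge0_fin_numE ?d_pvar_ge0// (le_lt_trans nP)// ltry.
Unshelve. all: by end_near. Qed.

Lemma cont_shift_path N tau (X : R -> T1 R d N) :
  (forall w, continuous (fun t => tcoef (val (X t)) w)) ->
  forall w, continuous (fun t => tcoef (val (shift_path tau X t)) w).
Proof.
move=> cX w t; rewrite (_ : (fun t => tcoef (val (shift_path tau X t)) w) =
    fun t => tcoef (val (shift_path tau X t)) (insub_bseq N w)); last first.
  by apply/funext => u; rewrite tcoefE.
have H := @incr_coef_cvg R d N R (nbhs t) (nbhs_filter t) X (fun=> tau)
  (fun u => tau + u) tau (tau + t).
apply: H; last exact: size_bseq.
- by move=> v _; exact: cvg_cst.
- move=> v _; apply: (@cvg_comp _ _ _ (fun u => tau + u) (fun u => tcoef (val (X u)) v)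
    (nbhs t) (nbhs (tau + t))); last exact: cX.
  by apply: cvgD; [exact: cvg_cst|exact: cvg_id].
Qed.

Lemma C0_pvar_shift p tau (X : R -> T1 R d (Num.truncn p)) : 1 <= p ->
  C0_pvar nrm p X -> C0_pvar nrm p (shift_path tau X).
Proof.
move=> p1 [cX HX]; have cS := @cont_shift_path _ tau X cX; split; first exact: cS.
move=> a b /andP[a0 b0]; apply: (C0_pvar_on_intro p1).
- by move=> w; apply: continuous_subspaceT; exact: cS.
- exact: shift_path0.
(* The path is approximated on an interval that contains both [a, b] + tau and
   the time 0 at which lifts are normalized. *)
move=> e e0; pose a' := Num.min (a + tau) 0; pose b' := Num.max (b + tau) 0.
have aa : a' <= a + tau by rewrite ge_min lexx.
have bb : b + tau <= b' by rewrite le_max lexx.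
have [|x [S [xC xS XS]]] := C0_pvar_on_approx p1 (HX a' b' _) e0.
  by rewrite ge_min le_max !lexx !orbT.
exists (fun t => x (t + tau) - x tau), (shift_path tau S); split.
- exact: C0_1var_shift aa bb xC.
- exact: (is_canonical_lift_shift (c := - x tau) aa bb xS).
- by apply: pvar_le_shift; apply: pvar_le_sub XS.
Qed.

End shift_closure.

(** * Separability in p-variation *)

Section separability.
Context {R : realType} {d : nat} (nrm : tensor_norm R d) {N : nat}.
Implicit Types (S X Y : R -> T1 R d N) (x : R -> 'rV[R]_d) (a b s t e eta p M : R).

(** The increments of V serve as a control: they are additive, so that their sums
    over subdivisions telescope. *)
Definition variation_bound a b M S : Prop := exists V : R -> R,
  [/\ forall u u', a <= u -> u <= u' -> u' <= b -> V u <= V u',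
      V b - V a <= M &
      forall s t, a <= s -> s <= t -> t <= b ->
        forall w : seq 'I_d, (size w <= N)%N ->
        `|tcoef (val (incr S s t)) w| <= (V t - V s) ^+ size w].

Definition incr_close a b e S X : Prop := forall s t, a <= s -> s <= t -> t <= b ->
  forall w : seq 'I_d, (size w <= N)%N ->
  `|tcoef (val (incr S s t)) w - tcoef (val (incr X s t)) w| <= e.

Lemma finite_subset_sum a b (V : R -> R) (D : seq R) : a <= b ->
  (forall u u', a <= u -> u <= u' -> u' <= b -> V u <= V u') ->
  finite_subset a b D -> \sum_(i < (size D).-1) (V D`_i.+1 - V D`_i) <= V b - V a.
Proof.
move=> ab Vm Dab; have [Ds Din] := Dab.
rewrite -(big_mkord xpredT (fun i => V D`_i.+1 - V D`_i)).
rewrite (telescope_sumr (fun i => V D`_i))//.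
case: D Dab Ds Din => [|u D] Dab Ds Din; first by rewrite subrr subr_ge0 Vm.
have inD i : (i <= size D)%N -> a <= (u :: D)`_i <= b.
  by move=> iD; apply: Din; rewrite mem_nth.
have /andP[a1 b1] := inD 0%N isT; have /andP[a2 b2] := inD (size D) (leqnn _).
by apply: lerB; apply: Vm.
Qed.

(** Interpolation: on paths of bounded 1/k-variation at each level k, uniform
    closeness implies closeness in p-variation, because
    |D|^(p/k) = |D|^((p-1)/k) |D|^(1/k). *)
Lemma pvar_interpolation p a b M e : 1 < p -> a <= b -> 0 <= M -> 0 < e ->
  exists2 eta, 0 < eta & forall S X, variation_bound a b M S ->
    variation_bound a b M X -> incr_close a b eta S X -> pvar_le nrm p a b S X e.
Proof.
move=> p1 ab M0 e0; have p0 : 0 < p by exact: lt_trans p1.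
have q0 : 0 < p - 1 by rewrite subr_gt0.
pose C := 1 + \sum_(k < N.+1) tensor_basis_norm nrm k.
have C1 : 1 <= C by rewrite lerDl sumr_ge0// => k _; exact: tensor_basis_norm_ge0.
have C0 : 0 < C by exact: lt_le_trans C1.
have Ck k : (k <= N)%N -> tensor_basis_norm nrm k <= C.
  move=> kN; rewrite /C (bigD1 (Ordinal (kN : (k < N.+1)%N)))//= addrCA.
  rewrite lerDl addr_ge0// sumr_ge0// => j _; exact: tensor_basis_norm_ge0.
pose G := e `^ p / (4 * C * M + 1).
have D0 : 0 < 4 * C * M + 1 by rewrite ltr_wpDl// !mulr_ge0// ltW.
have G0 : 0 < G by rewrite divr_gt0// powR_gt0.
pose rho := Num.min 1 (G `^ (N%:R / (p - 1))).
have rho0 : 0 < rho by rewrite lt_min ltr01 powR_gt0.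
have rho1 : rho <= 1 by rewrite ge_min lexx.
exists (rho / C); first exact: divr_gt0.
move=> S X [V [Vm VM SV]] [V' [Vm' VM' XV]] SX k D /andP[k1 kN] Dab.
have k0 : 0 < k%:R :> R by rewrite ltr0n.
have N0 : 0 < N%:R :> R by rewrite ltr0n (leq_trans k1).
have kge1 : 1 <= k%:R :> R by rewrite ler1n.
have rhoG : rho `^ ((p - 1) / k%:R) <= G.
  apply: (@le_trans _ _ (rho `^ ((p - 1) / N%:R))).
    apply: ger_powR; first by rewrite rho0.
    by rewrite ler_pM2l// lef_pV2 ?posrE// ler_nat.
  apply: (@le_trans _ _ ((G `^ (N%:R / (p - 1))) `^ ((p - 1) / N%:R))).
    apply: ge0_ler_powR; rewrite ?nnegrE ?powR_ge0 ?(ltW rho0) ?divr_ge0 ?(ltW q0)//.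
    by rewrite ge_min lexx orbT.
  by rewrite -powRrM mulrA divfK ?gt_eqF// mulfV ?gt_eqF// powRr1// ltW.
have termP (i : 'I_(size D).-1) : incr_dist nrm k S X D`_i D`_i.+1 `^ (p / k%:R) <=
    G * (2 * C) * ((V D`_i.+1 - V D`_i) + (V' D`_i.+1 - V' D`_i)).
  have [aD DD Db] := finite_subset_nth i Dab.
  set xi := incr_dist _ _ _ _ _ _; have xi0 : 0 <= xi by exact: incr_dist_ge0.
  set v := V D`_i.+1 - V D`_i; set v' := V' D`_i.+1 - V' D`_i.
  have v0 : 0 <= v by rewrite subr_ge0 Vm.
  have v'0 : 0 <= v' by rewrite subr_ge0 Vm'.
  have vv0 : 0 <= v + v' by exact: addr_ge0.
  have xi_rho : xi <= rho.
    apply: le_trans (_ : _ <= rho / C * tensor_basis_norm nrm k) _.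
      apply: tnorm_le_sup => u; rewrite ffunE tcoefB.
      by apply: SX => //; rewrite size_tuple.
    by rewrite mulrAC ler_pdivrMr// ler_wpM2l ?Ck// ltW.
  have xi_v : xi <= 2 * C * (v + v') ^+ k.
    apply: le_trans (_ : _ <= (2 * (v + v') ^+ k) * tensor_basis_norm nrm k) _.
      apply: tnorm_le_sup => u; rewrite ffunE tcoefB.
      have uN : (size u <= N)%N by rewrite size_tuple.
      have h1 := SV _ _ aD DD Db u uN; have h2 := XV _ _ aD DD Db u uN.
      apply: le_trans (ler_normB _ _) _; rewrite mulr_natl mulr2n.
      rewrite size_tuple -/v in h1; rewrite size_tuple -/v' in h2; apply: lerD.
        by apply: le_trans h1 _; rewrite lerXn2r ?nnegrE// lerDl.
      by apply: le_trans h2 _; rewrite lerXn2r ?nnegrE// lerDr.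
    by rewrite mulrAC ler_wpM2r ?exprn_ge0// ler_wpM2l// Ck.
  rewrite (_ : p / k%:R = (p - 1) / k%:R + 1 / k%:R); last by rewrite -mulrDl subrK.
  rewrite powRD; last first.
    by rewrite -mulrDl subrK gt_eqF ?divr_gt0.
  rewrite -mulrA; apply: ler_pM; rewrite ?powR_ge0//.
    apply: le_trans rhoG; apply: ge0_ler_powR; rewrite ?nnegrE ?(ltW rho0)//.
    by rewrite divr_ge0 ?(ltW q0) ?(ltW k0).
  apply: le_trans (_ : _ <= (2 * C * (v + v') ^+ k) `^ (1 / k%:R)) _.
    apply: ge0_ler_powR; rewrite ?nnegrE// ?divr_ge0//.
    by rewrite !mulr_ge0 ?exprn_ge0// ltW.
  have C2 : 1 <= 2 * C by rewrite -[leLHS]mulr1 ler_pM// ler1n.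
  have C20 : 0 <= 2 * C by exact: le_trans C2.
  rewrite powRM ?exprn_ge0//; apply: ler_pM; rewrite ?powR_ge0//.
    by apply: ler1_powR => //; rewrite ler_pdivrMr// mul1r.
  by rewrite -powR_mulrn// -powRrM mul1r mulfV ?gt_eqF// powRr1.
apply: (@le_trans _ _ (G * (2 * C) * (M + M))).
  apply: le_trans (ler_sum _ (fun i _ => termP i)) _.
  rewrite -mulr_sumr; apply: ler_wpM2l.
    by apply: mulr_ge0; [exact: ltW|apply: mulr_ge0 => //; exact: ltW].
  rewrite big_split/=; apply: lerD.
    exact: le_trans (finite_subset_sum ab Vm Dab) VM.
  exact: le_trans (finite_subset_sum ab Vm' Dab) VM'.
rewrite /G [leLHS](_ : _ = e `^ p * (2 * C * (M + M) / (4 * C * M + 1))); last by ring.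
by rewrite ler_piMr ?powR_ge0// ler_pdivrMr// mul1r; lra.
Qed.

Definition small_increments a b m eta S : Prop := forall s t,
  a <= s -> s <= t -> t <= b -> t - s <= (b - a) / m.+1%:R ->
  forall w : seq 'I_d, (0 < size w <= N)%N -> `|tcoef (val (incr S s t)) w| <= eta.

(** Increments between arbitrary times are compared through the grid points that
    they enclose, by Chen's relation. *)
Lemma incr_close_grid a b m B eta S X : a < b -> 1 <= B -> 0 <= eta ->
  (forall Z, Z = S \/ Z = X -> small_increments a b m eta Z) ->
  (forall Z, Z = S \/ Z = X -> forall s t, a <= s -> s <= t -> t <= b ->
     forall w : seq 'I_d, (size w <= N)%N -> `|tcoef (val (incr Z s t)) w| <= B) ->
  (forall i j (w : seq 'I_d), (i <= m.+1)%N -> (j <= m.+1)%N -> (size w <= N)%N ->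
    `|tcoef (val (incr S (grid a b m i) (grid a b m j))) w -
      tcoef (val (incr X (grid a b m i) (grid a b m j))) w| <= eta) ->
  incr_close a b ((4 * N%:R * B + 2) * eta) S X.
Proof.
move=> ab B1 eta0 small bounded near s t as_ st tb w wN.
have B0 : 0 <= B by exact: le_trans B1.
have sb := le_trans st tb; have at_ := le_trans as_ st.
have [->|w0] := eqVneq w [::].
  by rewrite !T1P subrr normr0 mulr_ge0// addr_ge0// !mulr_ge0.
have w1 : (0 < size w <= N)%N by rewrite wN andbT; case: w w0 {wN}.
set i := (grid_index a b m s).+1; set j := grid_index a b m t.
have jm : (j <= m.+1)%N by exact: grid_index_bound.
have si := lt_grid_index m s ab; rewrite -/i in si.
have gis : grid a b m i - s <= (b - a) / m.+1%:R.
  by rewrite gridS lerBlDl lerD2r grid_index_le.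
have gjt := grid_index_le m ab at_; rewrite -/j in gjt.
have tgj : t - grid a b m j <= (b - a) / m.+1%:R.
  by rewrite lerBlDl -gridS ltW// lt_grid_index.
(* The time s is rounded up and t down; when the roundings cross, s and t are
   within one mesh of each other. *)
have [ij|ji] := leqP i j; last first.
  have ts : t - s <= (b - a) / m.+1%:R.
    apply: le_trans gis; rewrite lerD2r; apply: (le_trans (ltW (lt_grid_index m t ab))).
    exact: grid_le.
  apply: le_trans (ler_normB _ _) _.
  apply: (@le_trans _ _ (eta + eta)).
    by apply: lerD; apply: (small _ _ s t) => //; [left|right].
  by rewrite mulrDl [2 * eta]mulr_natl mulr2n lerDr !mulr_ge0.
have gij : grid a b m i <= grid a b m j by exact: grid_le.
have agi : a <= grid a b m i by exact/(le_trans as_)/ltW.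
have gjb := le_trans gjt tb; have agj := le_trans agi gij; have gib := le_trans gij gjb.
have git := le_trans gij gjt.
have near_grid Z : Z = S \/ Z = X -> `|tcoef (val (incr Z s t)) w -
    tcoef (val (incr Z (grid a b m i) (grid a b m j))) w| <= 2 * (N%:R * (B * eta)).
  move=> ZSX; rewrite -(subrKA (tcoef (val (incr Z (grid a b m i) t)) w)).
  apply: le_trans (ler_normD _ _) _; rewrite mulr_natl mulr2n; apply: lerD.
    rewrite -(incrM Z s (grid a b m i) t); apply: tcoef_mull_near => //.
      by move=> v vN; apply: bounded.
    by move=> v vN; apply: (small _ ZSX) => //; exact: ltW.
  rewrite -(incrM Z (grid a b m i) (grid a b m j) t); apply: tcoef_mulr_near => //.
    by move=> v vN; apply: bounded.
  by move=> v vN; apply: (small _ ZSX).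
have h1 := near_grid S (or_introl erefl); have h2 := near_grid X (or_intror erefl).
have h3 := near i j w (leq_trans ij jm) jm wN.
set xS := tcoef (val (incr S s t)) w in h1 *; set xX := tcoef (val (incr X s t)) w in h2 *.
set yS := tcoef _ w in h1 h3; set yX := tcoef _ w in h2 h3.
have -> : xS - xX = (xS - yS) + (yS - yX) - (xX - yX) by ring.
apply: le_trans (ler_normB _ _) _.
apply: le_trans (lerD (le_trans (ler_normD _ _) (lerD h1 h3)) h2) _.
have -> : (4 * N%:R * B + 2) * eta = 2 * (N%:R * (B * eta)) + eta +
  2 * (N%:R * (B * eta)) + eta by ring.
by rewrite lerDl.
Qed.

Lemma canonical_lift_regular a b x S : a <= b -> C0_1var nrm a b x ->
  is_canonical_lift a b x S ->
  (exists M : nat, variation_bound a b M%:R S) /\ incr_modulus a b S.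
Proof.
move=> ab xC [_ SS]; have [V [Vm xV xm]] := C0_1var_regular ab xC; split.
  exists (Num.truncn (V b - V a)).+1; exists V; split => //.
    exact/ltW/truncnS_gt.
  by move=> s t as_ st tb w wN; rewrite SS//; exact: (iterated_integral_bound w Vm xV).
have W0 : 0 <= V b - V a by rewrite subr_ge0 Vm.
move=> e e0; pose W := (1 + (V b - V a)) ^+ N.
have W1 : 1 <= W by rewrite exprn_ege1// lerDl.
have Wp : 0 < W by exact: lt_le_trans W1.
have [|del del0 xdel] := xm (e / W); first exact: divr_gt0.
exists del => // s t as_ st tb std w /andP[w0 wN]; rewrite SS//.
apply: le_trans (iterated_integral_small (w := w) (e := e / W) Vm xV as_ st tb _ _ w0) _.
- by rewrite divr_ge0 ?ltW.
- move=> u i /andP[su ut]; apply: xdel => //; first exact: le_trans tb.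
  by apply: le_lt_trans std; rewrite lerD2r.
rewrite mulrAC ler_pdivrMr// ler_wpM2l ?(ltW e0)//.
apply: le_trans (_ : _ <= (1 + (V b - V a)) ^+ (size w).-1) _.
  by rewrite lerXn2r ?nnegrE ?(addr_ge0 ler01 W0)// lerDr.
by apply: ler_weXn2l; [rewrite lerDl|rewrite (leq_trans (leq_pred _))].
Qed.

End separability.


Section countable_code.
Context {R : realType} {d : nat} (nrm : tensor_norm R d).
Implicit Types (a b e p : R).

Lemma floor_eq_close (x y : R) : Num.floor x = Num.floor y -> `|x - y| <= 1.
Proof.
move=> xy; have /andP[x1 x2] := floor_itv x; have /andP[y1 y2] := floor_itv y.
by rewrite xy in x1 x2; rewrite ler_norml; apply/andP; split; move: x1 x2 y1 y2; rewrite intrD; lra.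
Qed.

(** Each rough path is given a code in a countable set: a bound on the variation
    of some close approximating lift, a grid on which that lift has small
    increments, and the rounded coefficients of its increments on this grid. *)
Lemma countable_code p a b e : 1 < p -> a < b -> 0 < e ->
  exists Q : (R -> T1 R d (Num.truncn p)) -> nat * nat * seq int -> Prop,
    (forall X, C0_pvar_on nrm p a b X -> exists c, Q X c) /\
    (forall X Y c, Q X c -> Q Y c -> pvar_le nrm p a b X Y e).
Proof.
move=> p1 ab e0; set N := Num.truncn p; have ab' := ltW ab.
(* Two uses of the inequality with constant 4 lead from e' to e. *)
pose e' := e / 16; have e'0 : 0 < e' by exact: divr_gt0.
have /choice[eta etaP] : forall M : nat, exists eta : R, 0 < eta /\
    forall S X : R -> T1 R d N, variation_bound a b M%:R S ->
    variation_bound a b M%:R X -> incr_close a b eta S X -> pvar_le nrm p a b S X e'.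
  move=> M; have [eta eta0 H] := pvar_interpolation nrm (N := N) p1 ab' (ler0n R M) e'0.
  by exists eta.
pose B (M : nat) : R := (1 + M%:R) ^+ N.
have B1 M : 1 <= B M by rewrite exprn_ege1// lerDl.
have D0 M : 0 < 4 * N%:R * B M + 2.
  by rewrite ltr_wpDl// !mulr_ge0// (le_trans _ (B1 M)).
pose theta M := eta M / (4 * N%:R * B M + 2).
have theta0 M : 0 < theta M by rewrite divr_gt0// (etaP M).1.
pose code (M m : nat) (S : R -> T1 R d N) : seq int :=
  map (fun z : ('I_m.+2 * 'I_m.+2 * N.-bseq 'I_d)%type => Num.floor
    (tcoef (val (incr S (grid a b m z.1.1) (grid a b m z.1.2))) z.2 / theta M)) (enum predT).
exists (fun X c => exists S, [/\ pvar_le nrm p a b X S e',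
  variation_bound a b c.1.1%:R S, small_increments a b c.1.2 (theta c.1.1) S &
  c.2 = code c.1.1 c.1.2 S]); split.
  move=> X XC; have [x [S [xC xS XS]]] := C0_pvar_on_approx (ltW p1) XC e'0.
  have [[M SM] Sm] := canonical_lift_regular ab' xC xS.
  have [del del0 Sdel] := Sm _ (theta0 M).
  pose m := Num.truncn ((b - a) / del).
  exists (M, m, code M m S), S; split; [exact: XS|exact: SM| |reflexivity].
  move=> s t as_ st tb std w wN; apply: Sdel; [by []..| |exact: wN].
  apply: le_lt_trans std _; rewrite ltr_pdivrMr// -ltr_pdivrMl// mulrC.
  exact: truncnS_gt.
move=> X Y [[M m] l] [S [XS SM Ssm /= ->]] [S' [YS' S'M S'sm /= ll]].
have bound Z : Z = S \/ Z = S' -> forall s t, a <= s -> s <= t -> t <= b ->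
    forall w : seq 'I_d, (size w <= N)%N -> `|tcoef (val (incr Z s t)) w| <= B M.
  move=> ZS s t as_ st tb w wN.
  have [V [Vm VM ZV]] : variation_bound a b M%:R Z by case: ZS => ->.
  have V0 : 0 <= V t - V s by rewrite subr_ge0 Vm.
  have VM' : V t - V s <= M%:R.
    apply: le_trans VM; apply: lerB; apply: Vm => //; [exact: le_trans st|exact: le_trans tb].
  apply: le_trans (ZV s t as_ st tb w wN) _.
  apply: le_trans (_ : _ <= (1 + M%:R) ^+ size w) _.
    by rewrite lerXn2r// ?nnegrE ?addr_ge0// (le_trans VM')// lerDr.
  by apply: ler_weXn2l => //; rewrite lerDl.
have SS' : incr_close a b (eta M) S S'.
  rewrite -[eta M](divfK (lt0r_neq0 (D0 M))) -/(theta M) mulrC.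
  apply: (@incr_close_grid _ _ _ a b m (B M)) => //; first exact: ltW.
    by move=> Z [->|->].
  move=> i j w im jm wN.
  have /eq_in_map/(_ (inord i, inord j, insub_bseq N w)) := ll.
  rewrite mem_enum => /(_ isT) /=; rewrite !inordK// insub_bseqK//.
  move=> /floor_eq_close; rewrite -mulrBl normrM normfV [`|theta M|]gtr0_norm//.
  by rewrite ler_pdivrMr// mul1r.
have pSS' := (etaP M).2 S S' SM S'M SS'.
have p1' := ltW p1; have p0 : 0 <= p by exact: le_trans p1'.
have XS' := pvar_le_trans p1' (ltW e'0) XS pSS'.
have -> : e = 4 * (4 * e') by rewrite /e'; lra.
have e40 : 0 <= 4 * e' by rewrite mulr_ge0// ltW.
apply: (pvar_le_trans p1' e40 XS'); apply: pvar_le_sym.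
by apply: (pvar_le_mono p0 (ltW e'0) _ YS'); rewrite ler_peMl ?ler1n// ltW.
Qed.

End countable_code.

(** * The Borel sigma-algebra of the space of rough paths *)

Section borel.
Context {R : realType} {d : nat} (nrm : tensor_norm R d) (p : R) (p1 : 1 < p).
Local Notation N := (Num.truncn p).
Local Notation RP := (rough_path nrm p).
Implicit Types (X Y : RP) (s t c r : R) (w : N.-bseq 'I_d).

Let p1' : 1 <= p. Proof. exact: ltW. Qed.
Let p0 : 0 < p. Proof. exact: lt_trans p1. Qed.

Lemma rough_pathP X : C0_pvar nrm p (rough_path_fun X).
Proof. exact: set_mem (valP X). Qed.

Lemma rough_path_cont a b X : cont_on a b (rough_path_fun X).
Proof. by apply: cont_onT; case: (rough_pathP X). Qed.

Lemma rough_path0 X : rough_path_fun X 0 = 1%g.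
Proof.
have [_ H] := rough_pathP X; have [|_ -> //] := H 0 0.
by rewrite lexx.
Qed.

Definition incr_coef (q : R * R * N.-bseq 'I_d) (X : RP) : R :=
  tcoef (val (incr (rough_path_fun X) q.1.1 q.1.2)) q.2.

Definition incr_box (l : seq (R * R * N.-bseq 'I_d * R)) : set RP :=
  [set X | all (fun q => incr_coef q.1 X <= q.2) l].

(** Only pairs s <= t of times occur, because the p-variation distance compares
    increments forward in time. *)
Definition incr_boxes : set (set RP) :=
  [set incr_box l | l in [set l | all (fun q => q.1.1.1 <= q.1.1.2) l]].

Lemma incr_boxesI : setI_closed incr_boxes.
Proof.
move=> _ _ [l ll <-] [m mm <-]; exists (l ++ m); first by rewrite /= all_cat ll.
apply/seteqP; split => X; rewrite /incr_box/= all_cat; first by move/andP.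
by move=> [-> ->].
Qed.

Lemma nbhs_rough_path_initial (I : @itv0 R) X (A : set RP) :
  nbhs (X : initial_topology (@restrict_path R d nrm p I)) A -> nbhs X A.
Proof.
have := (@cvg_sup _ _ (fun I : itv0 =>
    Topological.class (initial_topology (@restrict_path R d nrm p I)))
    (nbhs X) X (nbhs_filter X)).1 (fun B H => H) I.
exact.
Qed.

(** Convergence in the coarsest topology is convergence on each interval, so the
    sets that contain a p-variation ball on some [-L, L] around X form a filter
    finer than the neighborhood filter of X. *)
Lemma nbhs_rough_path_ball X (A : set RP) : nbhs X A -> exists L : nat,
  exists2 r, 0 < r & forall Y, pvar_le nrm p (- L%:R) L%:R
    (rough_path_fun X) (rough_path_fun Y) r -> A Y.
Proof.
pose F : set_system RP := [set A | exists L : nat, exists2 r, 0 < r & forall Y,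
  pvar_le nrm p (- L%:R) L%:R (rough_path_fun X) (rough_path_fun Y) r -> A Y].
have FF : Filter F.
  split.
  - by exists 0%N; exists 1.
  - move=> P Q [L [r r0 HP]] [L' [r' r'0 HQ]]; exists (maxn L L').
    have rr0 : 0 < Num.min r r' by rewrite lt_min r0.
    exists (Num.min r r') => // Y XY; split.
      apply: HP; apply: (@pvar_le_mono _ _ _ _ _ _ _ _ _ (Num.min r r')); rewrite ?(ltW p0) ?(ltW rr0)//.
        by rewrite ge_min lexx.
      by apply: pvar_le_sub XY; rewrite ?lerN2 ler_nat leq_maxl.
    apply: HQ; apply: (@pvar_le_mono _ _ _ _ _ _ _ _ _ (Num.min r r')); rewrite ?(ltW p0) ?(ltW rr0)//.
      by rewrite ge_min lexx orbT.
    by apply: pvar_le_sub XY; rewrite ?lerN2 ler_nat leq_maxr.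
  - by move=> P Q PQ [L [r r0 HP]]; exists L; exists r => // Y /HP/PQ.
have FX : F --> (X : RP).
  apply/(@cvg_sup _ _ (fun I : itv0 =>
    Topological.class (initial_topology (@restrict_path R d nrm p I))) F X FF) => I B.
  rewrite (@nbhsE (initial_topology (@restrict_path R d nrm p I))) => -[U [[V oV <-] VX] UB].
  have [r r0 rV] : exists2 r : R, 0 < r & forall Y : rough_path_on nrm p (val I),
      (d_pvar nrm p (val I).1 (val I).2 (val (restrict_path I X)) (val Y) < r%:E)%E -> V Y.
    exact: oV VX.
  exists (Num.truncn (Num.max `|(val I).1| `|(val I).2|)).+1.
  exists (r / 2); first exact: divr_gt0.
  move=> Y XY; apply: UB; apply: rV.
  apply: (@le_lt_trans _ _ (r / 2)%:E); last first.
    by rewrite lte_fin ltr_pdivrMr// ltr_pMr// ltr1n.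
  apply/d_pvar_leP; [exact: p0|by rewrite divr_ge0// ltW|].
  have := truncnS_gt (Num.max `|(val I).1| `|(val I).2|).
  rewrite gt_max => /andP[/ltr_normlP[h1 _] /ltr_normlP[_ h2]].
  apply: pvar_le_sub XY; last exact: ltW.
  by rewrite lerNl ltW.
exact: FX.
Qed.

Lemma open_incr_coef_gt s t w c : s <= t ->
  open [set X : RP | c < incr_coef (s, t, w) X].
Proof.
move=> st; rewrite openE => X /= cX.
have I0 : (Num.min s 0, Num.max t 0).1 <= 0 <= (Num.min s 0, Num.max t 0).2.
  by rewrite /= ge_min le_max !lexx !orbT.
pose I : @itv0 R := exist _ (Num.min s 0, Num.max t 0) I0.
rewrite /interior; apply: (@nbhs_rough_path_initial I).
apply: (@open_nbhs_nbhs (initial_topology (@restrict_path R d nrm p I))).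
split; last exact: cX.
pose V : set (rough_path_on nrm p (val I)) :=
  [set Z | c < tcoef (val (incr (val Z) s t)) w].
exists V; last by apply/seteqP; split.
have [C C0 CP] := @pvar_le_coef R d nrm N.
move=> Z /= cZ; pose g := tcoef (val (incr (val Z) s t)) w - c.
have g0 : 0 < g by rewrite subr_gt0.
pose r := Num.min 1 (g / (C * 2)).
have r0 : 0 < r by rewrite lt_min ltr01 divr_gt0// mulr_gt0.
exists r => // Y ZY; rewrite /V/=.
have r01 : 0 <= r <= 1 by rewrite ltW//= ge_min lexx.
have ZY' : pvar_le nrm p (Num.min s 0) (Num.max t 0) (val Z) (val Y) r.
  by apply/d_pvar_leP; [exact: p0|exact: ltW|exact: ltW].
have sI : Num.min s 0 <= s by rewrite ge_min lexx.
have tI : t <= Num.max t 0 by rewrite le_max lexx.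
have := CP p _ _ _ _ _ p1' r01 ZY' s t sI st tI w (size_bseq w).
have : C * r <= g / 2.
  apply: (@le_trans _ _ (C * (g / (C * 2)))).
    by rewrite ler_wpM2l ?(ltW C0)// ge_min lexx orbT.
  by rewrite le_eqVlt; apply/orP; left; apply/eqP; field; rewrite gt_eqF.
move=> h1 h2; have := le_trans (ler_norm _) (le_trans h2 h1).
rewrite lerBlDr -lerBlDl; apply: lt_le_trans; rewrite ltrBrDr -ltrBrDl.
by rewrite -/g ltr_pdivrMr// ltr_pMr// ltr1n.
Qed.

Lemma measurable_incr_coef_le s t w c : s <= t ->
  measurable [set X : RP | incr_coef (s, t, w) X <= c].
Proof.
move=> st; rewrite (_ : [set X | _] = ~` [set X | c < incr_coef (s, t, w) X]).
  apply: measurableC; apply: sub_sigma_algebra; exact: open_incr_coef_gt.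
by apply/seteqP; split => X /=; rewrite leNgt => /negP.
Qed.

Lemma measurable_incr_box : incr_boxes `<=` @measurable _ RP.
Proof.
move=> _ [l + <-]; elim: l => [|[[[s t] w] c] l IH] /=.
  by move=> _; rewrite (_ : incr_box _ = setT)//; apply/seteqP; split.
move=> /andP[st /IH ml].
rewrite (_ : incr_box _ = [set X | incr_coef (s, t, w) X <= c] `&` incr_box l).
  by apply: measurableI => //; exact: measurable_incr_coef_le.
by apply/seteqP; split => X /andP.
Qed.

Lemma measurable_le_fun {disp} {T : measurableType disp} (f : T -> R) :
  (forall c, measurable [set x | f x <= c]) -> measurable_fun setT f.
Proof.
move=> mf; apply: (measurability _ (RGenOInfty.measurableE R)).
move=> _ [_ [c ->] <-]; rewrite setTI (_ : _ @^-1` _ = ~` [set x | f x <= c]).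
  exact/measurableC.
by apply/seteqP; split => x /=; rewrite in_itv/= andbT ltNge => /negP.
Qed.

(** Balls are measurable for the increments, and by separability countably many
    of them exhaust an open set: if U contains the ball of radius 1/j around X
    then the chosen path with the same code of precision 1/j as X has a ball of
    this radius in U that contains X. *)
Lemma open_incr_sigma (U : set RP) : open U -> <<s incr_boxes >> U.
Proof.
move=> oU; pose T := g_sigma_algebraType incr_boxes.
have mcoef s t (w : seq 'I_d) : s <= t -> (size w <= N)%N ->
    measurable_fun setT (fun X : T => tcoef (val (incr (rough_path_fun X) s t)) w).
  move=> st wN; apply: measurable_le_fun => c; apply: sub_sigma_algebra.
  exists [:: (s, t, insub_bseq N w, c)]; first by rewrite /= st.
  apply/seteqP; split => X; rewrite /incr_box/= /incr_coef/= insub_bseqK//; last by move=> ->.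
  by case/andP.
pose L1 (L : nat) : R := L.+1%:R.
have LL L : - L1 L < L1 L by rewrite /L1 gtrN// ltr0n.
pose ball (L j : nat) (X : RP) : set RP := [set Y : RP | pvar_le nrm p (- L1 L) (L1 L)
  (rough_path_fun X) (rough_path_fun Y) (harmonic j)].
have mball L j X : @measurable _ T (ball L j X).
  apply: (@measurable_pvar_le _ _ _ _ _ T (fun=> rough_path_fun X) (fun Y => rough_path_fun Y)).
  - exact: p1'.
  - exact: LL.
  - by move=> _; exact: rough_path_cont.
  - by move=> Y; exact: rough_path_cont.
  - by move=> s t w _ _ _ _; exact: measurable_cst.
  - by move=> s t w _ st _ wN; exact: mcoef.
have /choice[Q QP] : forall z : nat * nat,
    exists Q : (R -> T1 R d N) -> nat * nat * seq int -> Prop,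
    (forall Z, C0_pvar_on nrm p (- L1 z.1) (L1 z.1) Z -> exists k, Q Z k) /\
    (forall Z W k, Q Z k -> Q W k ->
      pvar_le nrm p (- L1 z.1) (L1 z.1) Z W (harmonic z.2)).
  by move=> z; apply: countable_code; [exact: p1|exact: LL|exact: harmonic_gt0].
pose good (z : nat * nat * (nat * nat * seq int)) X :=
  Q z.1 (rough_path_fun X) z.2 /\ ball z.1.1 z.1.2 X `<=` U.
pose F z := if pselect (exists X, good z X) is left e
  then ball z.1.1 z.1.2 (projT1 (cid e)) else set0.
have -> : U = \bigcup_z F z.
  apply/seteqP; split => [X UX|X [z _]]; last first.
    rewrite /F; case: pselect => // e; case: cid => Y [_ YU] /=; exact: YU.
  have [L [r r0 rU]] := nbhs_rough_path_ball (open_nbhs_nbhs (conj oU UX)).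
  pose j := Num.truncn r^-1.
  have jr : harmonic j <= r.
    by rewrite -[leRHS]invrK lef_pV2 ?posrE ?invr_gt0// ltW// truncnS_gt.
  have bU : ball L j X `<=` U.
    move=> Y XY; apply: rU; apply: (pvar_le_mono (ltW p0) (harmonic_ge0 _) jr).
    by apply: pvar_le_sub XY; rewrite /L1 ?lerN2 ler_nat.
  have [c Qc] : exists k, Q (L, j) (rough_path_fun X) k.
    apply: (QP (L, j)).1; have [_] := rough_pathP X; apply.
    by rewrite oppr_le0 ler0n.
  exists (L, j, c) => //; rewrite /F; case: pselect => [e|]; last first.
    by case; exists X; split.
  case: cid => Y [QY YU] /=; exact: (QP (L, j)).2 QY Qc.
apply: (@countable_bigcupT_measurable _ T); first exact: countableP.
move=> z; rewrite /F; case: pselect => // e.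
Qed.

Lemma measurable_rough_pathE : @measurable _ RP = <<s incr_boxes >>.
Proof.
apply/seteqP; split; last first.
  apply: smallest_sub; last exact: measurable_incr_box.
  exact: sigma_algebra_measurable.
apply: smallest_sub; last by move=> U; exact: open_incr_sigma.
exact: smallest_sigma_algebra.
Qed.

Lemma measurable_fun_incr_coef s t (w : seq 'I_d) : s <= t -> (size w <= N)%N ->
  measurable_fun setT (fun X : RP => tcoef (val (incr (rough_path_fun X) s t)) w).
Proof.
move=> st wN; apply: measurable_le_fun => c.
have := measurable_incr_coef_le (insub_bseq N w) c st.
by rewrite /incr_coef/= insub_bseqK.
Qed.

(** The criterion through which measurability of maps into the path space is
    reduced to real functions. *)
Lemma measurable_fun_rough_path {disp} {T : measurableType disp} (f : T -> RP) :
  (forall s t (w : seq 'I_d), s <= t -> (size w <= N)%N ->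
    measurable_fun setT (fun x => tcoef (val (incr (rough_path_fun (f x)) s t)) w)) ->
  measurable_fun setT f.
Proof.
move=> mf; apply: (measurability _ measurable_rough_pathE).
move=> _ [_ [l + <-] <-]; rewrite setTI; elim: l => [|[[[s t] w] c] l IH] /=.
  by move=> _; rewrite (_ : _ @^-1` _ = setT)//; apply/seteqP; split.
move=> /andP[st /IH ml].
rewrite (_ : _ @^-1` _ = [set x | incr_coef (s, t, w) (f x) <= c] `&` (f @^-1` incr_box l)).
  apply: measurableI => //; apply: measurable_le_cst.
  by apply: mf => //; exact: size_bseq.
by apply/seteqP; split => x /andP.
Qed.

End borel.

(** * Piecewise linear interpolation and time shifts *)

Section interpolation_shift.
Context {R : realType} {d : nat}.
Implicit Types (x : R -> 'rV[R]_d) (a b e t u : R) (s : seq R).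

Lemma mesh_lt a s e : 0 < e -> path (fun u v => v - u < e) a s -> mesh a s < e.
Proof.
move=> e0 /(pathP 0) H; apply: bigmax_lt => // j _.
exact: H.
Qed.

Lemma mesh_ltP a s e : mesh a s < e -> path (fun u v => v - u < e) a s.
Proof.
move=> H; apply/(pathP 0) => j js; apply: le_lt_trans H.
exact: partition_gap_mesh js.
Qed.

Lemma pl_interp_catr x a b s s2 u : itv_partition a b s -> path <%R b s2 -> b <= u ->
  pl_interp x a (s ++ s2) u = pl_interp x b s2 u.
Proof.
move=> ps bs2 bu; elim: s a ps => [|c s IH] a ps; first by rewrite (itv_partition_nil ps).
have pc := itv_partition_cons ps; have cb := itv_partition_le pc.
rewrite /=; case: ifP => uc; last exact: IH.
have uE : u = c by apply/le_anti; rewrite uc (le_trans cb).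
have cE : c = b by apply/le_anti; rewrite cb -uE.
have ac : a < c by case: ps => /= /andP[].
rewrite uE divff ?subr_eq0 ?gt_eqF// scale1r addrC subrK.
by rewrite cE pl_interp_start.
Qed.

Lemma pl_interp_catl x a b s s2 u : itv_partition a b s -> path <%R b s2 ->
  a <= u -> u <= b -> pl_interp x a (s ++ s2) u = pl_interp x a s u.
Proof.
move=> ps bs2; elim: s a ps => [|c s IH] a ps au ub.
  have ab := itv_partition_nil ps; have -> : u = a by apply/le_anti; rewrite au ab ub.
  by rewrite pl_interp_start// ab.
rewrite /=; case: ifP => // /negbT; rewrite -ltNge => /ltW cu.
exact: IH (itv_partition_cons ps) cu ub.
Qed.

Lemma pl_interp_shift x a s u t c :
  pl_interp (fun h => x (h + t) + c) a s u = pl_interp x (a + t) [seq h + t | h <- s] (u + t) + c.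
Proof.
elim: s a => [//|b s IH] a /=; rewrite lerD2r; case: ifP => // _.
have kill (V : zmodType) (y z c' : V) : y + c' - (z + c') = y - z.
  by rewrite opprD addrACA subrr addr0.
by rewrite !kill [RHS]addrAC.
Qed.

Lemma itv_partition_shift a b s t : itv_partition a b s ->
  itv_partition (a + t) (b + t) [seq h + t | h <- s].
Proof.
move=> [ps /eqP ls]; split; last by rewrite (@last_map _ _ (fun h => h + t)) ls.
by rewrite (@path_map _ _ (fun h => h + t)); apply: sub_path ps => u v /=; rewrite ltrD2r.
Qed.

(** Fine partitions of the two remaining intervals are put before and after the
    translate of s; they do not affect the interpolation in between. *)
Lemma extend_partition a b a' b' t e s : 0 < e -> itv_partition a b s -> mesh a s < e ->
  a' <= a + t -> b + t <= b' -> exists2 s', itv_partition a' b' s' & mesh a' s' < e /\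
  forall x u, a <= u -> u <= b ->
    pl_interp x a' s' (u + t) = pl_interp x (a + t) [seq h + t | h <- s] (u + t).
Proof.
move=> e0 ps ms aa bb; have pt := itv_partition_shift t ps.
have [s1 p1 m1] := fine_partition aa e0; have [s2 p2 m2] := fine_partition bb e0.
exists (s1 ++ [seq h + t | h <- s] ++ s2).
  exact: itv_partition_cat p1 (itv_partition_cat pt p2).
have [_ /eqP l1] := p1; have [_ /eqP lt] := pt; split.
  apply: mesh_lt => //; rewrite !cat_path l1 lt (mesh_ltP m1) (mesh_ltP m2) andbT /=.
  rewrite (@path_map _ _ (fun h => h + t)); apply: sub_path (mesh_ltP ms) => u v /=.
  by rewrite opprD addrACA subrr addr0.
move=> x u au ub; have [pt' _] := pt; have [p2' _] := p2.
rewrite (pl_interp_catr _ p1) ?lerD2r//; last by rewrite cat_path lt pt'.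
by rewrite (pl_interp_catl _ pt p2')// lerD2r.
Qed.

End interpolation_shift.

(** * Stationarity of the law of the increments *)

Section stationarity.
Context {R : realType} {d : nat} (nrm : tensor_norm R d) (p : R) (p1 : 1 < p).
Local Notation N := (Num.truncn p).
Local Notation RP := (rough_path nrm p).
Local Notation constraint := (R * R * N.-bseq 'I_d * R)%type.
Implicit Types (l : seq constraint) (Z S : R -> T1 R d N) (r t L : R).

Definition path_box l Z : bool :=
  all (fun q : constraint => tcoef (val (incr Z q.1.1.1 q.1.1.2)) q.1.2 <= q.2) l.

Definition constraints_in L l : bool :=
  all (fun q : constraint => [&& - L <= q.1.1.1, q.1.1.1 <= q.1.1.2 & q.1.1.2 <= L]) l.

Definition slack r l : seq constraint := [seq (q.1, q.2 + r) | q <- l].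

Definition shift_constraints t l : seq constraint :=
  [seq (t + q.1.1.1, t + q.1.1.2, q.1.2, q.2) | q <- l].

Lemma path_box_shift t l Z : path_box l (shift_path t Z) = path_box (shift_constraints t l) Z.
Proof.
by rewrite /path_box /shift_constraints all_map; apply: eq_all => q;
  rewrite -[LHS]/(tcoef (val (incr (shift_path t Z) q.1.1.1 q.1.1.2)) q.1.2 <= q.2) incr_shift_path.
Qed.

Lemma path_box_eq L l Z S : constraints_in L l ->
  (forall s t, - L <= s -> s <= t -> t <= L -> incr Z s t = incr S s t) ->
  path_box l Z = path_box l S.
Proof.
move=> /allP Ll ZS; apply: eq_in_all => q ql.
by have /and3P[q1 q2 q3] := Ll q ql; rewrite ZS.
Qed.

Lemma path_box_close L l Z S r : constraints_in L l ->
  (forall s t, - L <= s -> s <= t -> t <= L -> forall w : seq 'I_d, (size w <= N)%N ->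
    `|tcoef (val (incr Z s t)) w - tcoef (val (incr S s t)) w| <= r) ->
  path_box l Z -> path_box (slack r l) S.
Proof.
move=> /allP Ll ZS /allP lZ; rewrite /path_box /slack all_map; apply/allP => q ql /=.
have /and3P[q1 q2 q3] := Ll q ql.
have := ZS _ _ q1 q2 q3 q.1.2 (size_bseq _); rewrite distrC => /(le_trans (ler_norm _)).
by have /= := lZ q ql; lra.
Qed.

Lemma measurable_path_box {disp} {T : measurableType disp} (Y : T -> R -> T1 R d N) l :
  (forall q, q \in l -> forall w : seq 'I_d, (size w <= N)%N ->
    measurable_fun setT (fun x => tcoef (val (incr (Y x) q.1.1.1 q.1.1.2)) w)) ->
  measurable [set x | path_box l (Y x)].
Proof.
elim: l => [|q l IH] mY.
  by rewrite (_ : [set x | _] = setT)//; apply/seteqP; split.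
rewrite (_ : [set x | _] = [set x | tcoef (val (incr (Y x) q.1.1.1 q.1.1.2)) q.1.2 <= q.2]
   `&` [set x | path_box l (Y x)]).
  apply: measurableI; last by apply: IH => q' q'l; apply: mY; rewrite inE q'l orbT.
  by apply: measurable_le_cst; apply: mY; [exact: mem_head|exact: size_bseq].
by apply/seteqP; split => x /andP.
Qed.

Context {disp : measure_display} {Omega : measurableType disp} (P : probability Omega R)
  (X : 'I_d -> R -> {RV P >-> R}) (Xbar : {RV P >-> RP}).

Lemma measurable_lift_path L (s : seq R) a b :
  forall w : seq 'I_d, (size w <= N)%N -> measurable_fun setT
    (fun omega => tcoef (val (incr (pl_lift (path_of X omega) L s : R -> T1 R d N) a b)) w).
Proof.
apply: measurable_incr_coef; apply: measurable_pl_lift => t i;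
  rewrite (_ : (fun _ => _) = fun omega => X i t omega - X i 0 omega);
  by [apply: measurable_funB|apply/funext => omega; rewrite mxE].
Qed.

Lemma measurable_rv_incr a b (w : seq 'I_d) : a <= b -> (size w <= N)%N ->
  measurable_fun setT (fun omega => tcoef (val (incr (rough_path_fun (Xbar omega)) a b)) w).
Proof.
move=> ab wN.
apply: (@measurableT_comp _ _ _ _ _ _ (fun Y : RP => tcoef (val (incr (rough_path_fun Y) a b)) w)) => //.
exact: measurable_fun_incr_coef.
Qed.

(** Written with the explicit lift of the interpolation, the exceptional event in
    the definition of the natural lift is seen to be measurable; only then is the
    value of P on it meaningful. *)
Lemma lift_error_eventE (L eps : R) (s : seq R) : 0 <= eps ->
  itv_partition (- L) L s ->
  [set omega | (eps%:E < d_pvar nrm p (- L) L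
     (canonical_lift N (- L) L (pl_interp (path_of X omega) (- L) s))
     (rough_path_fun (Xbar omega)))%E] =
  ~` [set omega | pvar_le nrm p (- L) L (pl_lift (path_of X omega) (- L) s)
     (rough_path_fun (Xbar omega)) eps].
Proof.
move=> eps0 ps; have p0 : 0 < p by exact: lt_trans p1.
have cl omega u v : - L <= u -> u <= v -> v <= L ->
    incr (canonical_lift N (- L) L (pl_interp (path_of X omega) (- L) s)) u v =
    incr (pl_lift (path_of X omega) (- L) s) u v.
  move=> Lu uv vL.
  rewrite (canonical_lift_incr (pl_is_canonical_lift (path_of X omega) ps))//.
  by rewrite incr_shift_path !add0r.
apply/seteqP; split => omega /=; rewrite ltNge.
  move=> /negP h le; apply: h; apply/(d_pvar_leP _ _ _ _ _ p0 eps0).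
  apply: pvar_le_sym; apply: pvar_le_eqr (pvar_le_sym le) => u v Lu uv vL.
  by rewrite cl.
move=> h; apply/negP => /(d_pvar_leP _ _ _ _ _ p0 eps0) le; apply: h.
by apply: pvar_le_sym; apply: pvar_le_eqr (pvar_le_sym le) => u v; exact: cl.
Qed.

Lemma measurable_lift_error (L eps : R) (s : seq R) : 0 < L -> itv_partition (- L) L s ->
  measurable [set omega | pvar_le nrm p (- L) L (pl_lift (path_of X omega) (- L) s)
     (rough_path_fun (Xbar omega)) eps].
Proof.
move=> L0 ps; apply: measurable_pvar_le.
- exact: ltW.
- by rewrite gtrN.
- by move=> omega; exact: pl_lift_cont.
- by move=> omega; exact: rough_path_cont.
- by move=> u v w _ _ _ wN; exact: measurable_lift_path.
- by move=> u v w _ uv _ wN; exact: measurable_rv_incr.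
Qed.

Hypothesis (Xstat : stationary_increments X) (Xlift : natural_lift X Xbar).

(** Constraints on the lifts of the interpolations of X - X_0 and of
    X_(t + .) - X_t are the same cylinder event for two processes with the same
    law. *)
Lemma approximation_stationary (L L' t : R) l (s s' : seq R) :
  constraints_in L l -> - L' <= - L + t -> L + t <= L' ->
  itv_partition (- L) L s -> itv_partition (- L') L' s' ->
  (forall x u, - L <= u -> u <= L -> pl_interp (d := d) x (- L') s' (u + t) =
     pl_interp x (- L + t) [seq h + t | h <- s] (u + t)) ->
  P [set omega | path_box l (pl_lift (path_of X omega) (- L) s)] =
  P [set omega | path_box (shift_constraints t l) (pl_lift (path_of X omega) (- L') s')].
Proof.
move=> Ll LL' L'L ps ps' ss'.
have lift_shift omega : path_box l (pl_lift (fun h => path_of X omega (h + t) -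
    path_of X omega t) (- L) s) =
    path_box (shift_constraints t l) (pl_lift (path_of X omega) (- L') s').
  set x := path_of X omega; rewrite -path_box_shift.
  have H := @pl_is_canonical_lift R d N _ _ _ (fun h => x (h + t) - x t) ps.
  have H' : is_canonical_lift (- L) L (pl_interp (fun h => x (h + t) - x t) (- L) s)
      (shift_path t (shift_path 0 (pl_lift x (- L') s')) : R -> T1 R d N).
    apply: (is_canonical_lift_shift (c := - x t) LL' L'L (pl_is_canonical_lift x ps')).
    by move=> u /andP[u1 u2]; rewrite pl_interp_shift ss'.
  apply: (path_box_eq Ll) => u v Lu uv vL.
  have := canonical_lift_incr H' Lu uv vL.
  by rewrite (canonical_lift_incr H Lu uv vL) !incr_shift_path !add0r.
pose row (x : R -> 'I_d -> R) (h : R) : 'rV[R]_d := \row_i x h i.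
pose A : set (R -> 'I_d -> R) := [set x | path_box l (pl_lift (row x) (- L) s)].
have cA : cylinder_sigma_algebra A.
  apply: (@measurable_path_box _ (g_sigma_algebraType [set A | exists t i,
    exists2 B : set R, measurable B & A = [set x : R -> 'I_d -> R | B (x t i)]])).
  move=> q ql; apply: measurable_incr_coef; apply: measurable_pl_lift => h i;
    (rewrite (_ : (fun _ => _) = fun x : R -> 'I_d -> R => x h i);
      last by apply/funext => x; rewrite mxE);
    by move=> _ B mB; rewrite setTI; apply: sub_sigma_algebra; exists h, i, B.
have Xs := Xstat 0 t cA.
rewrite (_ : [set omega | path_box l _] =
    (fun omega h i => X i (0 + h) omega - X i 0 omega) @^-1` A); last first.
  apply/seteqP; split => omega; rewrite /A/= (_ : row _ = path_of X omega)//;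
    by apply/funext => h; apply/rowP => i; rewrite !mxE add0r.
have rowE omega : row (fun h i => X i (t + h) omega - X i t omega) =
    fun h => path_of X omega (h + t) - path_of X omega t.
  by apply/funext => h; apply/rowP => i; rewrite !mxE [t + h]addrC; ring.
rewrite Xs; congr (P _); apply/seteqP; split => omega; rewrite /A/= rowE;
  by rewrite lift_shift.
Qed.

(** Outside of the exceptional events on [-L, L] and [-L', L'], the constraints on
    Xbar, and on Xbar shifted by t, are those on the approximating lifts up to r;
    the two approximations have the same law. *)
Lemma box_le_slack_shift (n n' : nat) (t r delta : R) l (L := n.+1%:R) (L' := n'.+1%:R) :
  constraints_in L l -> - L' <= - L + t -> L + t <= L' -> 0 < r -> 0 < delta ->
  (P [set omega | path_box l (rough_path_fun (Xbar omega))] <=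
   P [set omega | path_box (shift_constraints t (slack (r + r) l))
       (rough_path_fun (Xbar omega))] + (delta + delta)%:E)%E.
Proof.
move=> Ll LL' L'L r0 delta0.
have L0 : 0 < L by rewrite /L ltr0n.
have L'0 : 0 < L' by rewrite /L' ltr0n.
have [C C0 CP] := @pvar_le_coef R d nrm N; have p1' := ltW p1.
pose eps := Num.min 1 (r / C).
have eps0 : 0 < eps by rewrite lt_min ltr01 divr_gt0.
have eps01 : 0 <= eps <= 1 by rewrite ltW//= ge_min lexx.
have Ceps : C * eps <= r by rewrite mulrC -ler_pdivlMr// ge_min lexx orbT.
have [eta eta0 H] := Xlift (ltn0Sn n) eps0 delta0.
have [eta' eta'0 H'] := Xlift (ltn0Sn n') eps0 delta0.
have ee0 : 0 < Num.min eta eta' by rewrite lt_min eta0.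
have LL : - L <= L by rewrite (@le_trans _ _ 0) ?oppr_le0 ?ltW.
have [s ps ms] := fine_partition LL ee0.
have [s' ps' [ms' ss']] := @extend_partition R d _ _ _ _ t _ s ee0 ps ms LL' L'L.
have close (K : R) u (K0 : 0 < K) (pu : itv_partition (- K) K u) omega :
    pvar_le nrm p (- K) K (pl_lift (path_of X omega) (- K) u)
      (rough_path_fun (Xbar omega)) eps ->
    forall a b, - K <= a -> a <= b -> b <= K -> forall w : seq 'I_d, (size w <= N)%N ->
    `|tcoef (val (incr (pl_lift (path_of X omega) (- K) u : R -> T1 R d N) a b)) w -
      tcoef (val (incr (rough_path_fun (Xbar omega)) a b)) w| <= r.
  move=> le a b Ka ab bK w wN; apply: le_trans Ceps.
  exact: (CP p _ _ _ _ _ p1' eps01 le).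
pose E K u := [set omega | pvar_le nrm p (- K) K (pl_lift (path_of X omega) (- K) u)
  (rough_path_fun (Xbar omega)) eps].
have mE K u : 0 < K -> itv_partition (- K) K u -> measurable (E K u).
  exact: measurable_lift_error.
have PE : (P (~` E L s) <= delta%:E)%E.
  rewrite -(lift_error_eventE (ltW eps0) ps); apply: H => //.
  by apply: lt_le_trans ms _; rewrite ge_min lexx.
have PE' : (P (~` E L' s') <= delta%:E)%E.
  rewrite -(lift_error_eventE (ltW eps0) ps'); apply: H' => //.
  by apply: lt_le_trans ms' _; rewrite ge_min lexx orbT.
pose A := [set omega | path_box (slack r l) (pl_lift (path_of X omega) (- L) s)].
pose A' := [set omega | path_box (shift_constraints t (slack r l))
  (pl_lift (path_of X omega) (- L') s')].
pose B := [set omega | path_box l (rough_path_fun (Xbar omega))].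
pose B' := [set omega | path_box (shift_constraints t (slack (r + r) l))
  (rough_path_fun (Xbar omega))].
have Ls : constraints_in L (slack r l) by rewrite /constraints_in /slack all_map.
have Lt : constraints_in L' (shift_constraints t (slack r l)).
  rewrite /constraints_in /shift_constraints all_map; apply/allP => q ql /=.
  have /allP/(_ q ql)/and3P[q1 q2 q3] := Ls; rewrite lerD2l q2/=.
  apply/andP; split; first by rewrite (le_trans LL')// addrC lerD2l.
  by rewrite (le_trans _ L'L)// addrC lerD2r.
have slackD : shift_constraints t (slack (r + r) l) = slack r (shift_constraints t (slack r l)).
  rewrite /slack /shift_constraints -!map_comp; apply: eq_map => q /=.
  by rewrite addrA.
have mB l' : constraints_in L' l' -> measurable [set omega | path_box l' (rough_path_fun (Xbar omega))].
  move=> /allP Ll'; apply: measurable_path_box => q /Ll'/and3P[_ q2 _] w wN.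
  exact: measurable_rv_incr.
have mA K u l' : measurable [set omega | path_box l' (pl_lift (path_of X omega) K u)].
  by apply: measurable_path_box => q _ w wN; exact: measurable_lift_path.
have LL'' : L <= L'.
  have [t0|t0] := leP 0 t; first by rewrite (le_trans _ L'L)// lerDl.
  by rewrite -lerN2 (le_trans LL')// gerDl ltW.
have Ll' : constraints_in L' l.
  apply/allP => q /(allP Ll)/and3P[q1 q2 q3]; rewrite q2 (le_trans q3)//.
  by rewrite (le_trans _ q1)// lerN2.
have BA : (P B <= P A + delta%:E)%E.
  apply: (@le_trans _ _ (P (A `|` ~` E L s))).
    apply: le_measure; rewrite ?inE; [exact: mB|apply: measurableU|].
    - exact: mA.
    - exact/measurableC/mE.
    move=> omega Bo; have [Eo|] := pselect (E L s omega); last by right.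
    left; apply: (path_box_close Ll _ Bo) => a b La ab bL w wN.
    by rewrite distrC; apply: close.
  apply: le_trans (measureU2 _ _ _) _; [exact: mA|exact/measurableC/mE|].
  exact: leeD2l.
have A'B' : (P A' <= P B' + delta%:E)%E.
  have mB' : measurable B'.
    by rewrite /B' slackD; apply: mB; rewrite /constraints_in /slack all_map.
  apply: (@le_trans _ _ (P (B' `|` ~` E L' s'))).
    apply: le_measure; rewrite ?inE; [exact: mA|apply: measurableU|].
    - exact: mB'.
    - exact/measurableC/mE.
    move=> omega Ao; have [Eo|] := pselect (E L' s' omega); last by right.
    left; rewrite /B'/= slackD; apply: (path_box_close Lt _ Ao) => a b La ab bL w wN.
    exact: close.
  apply: le_trans (measureU2 _ _ _) _; [exact: mB'|exact/measurableC/mE|].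
  exact: leeD2l.
have AA' : P A = P A' by exact: approximation_stationary ss'.
rewrite EFinD addeA; apply: le_trans BA _; rewrite leeD2r// AA'.
exact: A'B'.
Qed.

(** Letting the probability bounds of the exceptional events and then the slack tend to
    0 yields one inequality between the laws of the increments of Xbar at times
    translated by t; the converse one is its instance at - t. *)
Lemma box_le_shift (t : R) l : all (fun q : constraint => q.1.1.1 <= q.1.1.2) l ->
  (P [set omega | path_box l (rough_path_fun (Xbar omega))] <=
   P [set omega | path_box (shift_constraints t l) (rough_path_fun (Xbar omega))])%E.
Proof.
move=> ll.
have mB l' : all (fun q : constraint => q.1.1.1 <= q.1.1.2) l' ->
    measurable [set omega | path_box l' (rough_path_fun (Xbar omega))].
  move=> /allP ll'; apply: measurable_path_box => q /ll' q2 w wN.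
  exact: measurable_rv_incr.
have [n Ln] : exists n : nat, constraints_in n.+1%:R l.
  elim: l ll => [|q l IH] /=; first by exists 0%N.
  move=> /andP[q12 /IH[n nl]]; pose m := Num.truncn (Num.max `|q.1.1.1| `|q.1.1.2|).
  exists (maxn m n); have := truncnS_gt (Num.max `|q.1.1.1| `|q.1.1.2|).
  rewrite -/m gt_max => /andP[/ltr_normlP[h1 _] /ltr_normlP[_ h2]].
  have mm : m.+1%:R <= (maxn m n).+1%:R :> R by rewrite ler_nat ltnS leq_maxl.
  have nm : n.+1%:R <= (maxn m n).+1%:R :> R by rewrite ler_nat ltnS leq_maxr.
  rewrite /constraints_in/= q12 (le_trans (ltW h2) mm) lerNl (le_trans (ltW h1) mm)/=.
  apply/allP => q' /(allP nl)/and3P[a1 a2 a3]; rewrite a2 (le_trans a3)//.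
  by rewrite (le_trans _ a1)// lerN2.
pose n' := (n + Num.truncn `|t|).+1.
have tn' := truncnS_gt `|t|; have := tn'; move=> /ltr_normlP[t1 t2].
have nn' : n'.+1%:R = n.+1%:R + (Num.truncn `|t|).+1%:R :> R.
  by rewrite -natrD /n' addSn addnS.
have slack_le r : 0 < r -> (P [set omega | path_box l (rough_path_fun (Xbar omega))] <=
    P [set omega | path_box (shift_constraints t (slack (r + r) l))
       (rough_path_fun (Xbar omega))])%E.
  move=> r0; apply/lee_addgt0Pr => e e0; rewrite [e]splitr.
  apply: (@box_le_slack_shift n n') => //.
  - by rewrite nn'; lra.
  - by rewrite nn'; lra.
  - by rewrite divr_gt0.
pose F k := [set omega | path_box (shift_constraints t (slack (harmonic k + harmonic k) l))
  (rough_path_fun (Xbar omega))].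
have mF k : measurable (F k).
  apply: mB; rewrite /shift_constraints /slack !all_map; apply/allP => q ql /=.
  by rewrite lerD2l; exact: (allP ll).
have -> : [set omega | path_box (shift_constraints t l) (rough_path_fun (Xbar omega))] =
    \bigcap_k F k.
  rewrite /F /path_box /shift_constraints /slack; apply/seteqP; split => omega /=.
    move=> /allP h k _ /=; rewrite !all_map in h *; apply/allP => q ql /=.
    have := h _ (map_f _ ql); move=> /le_trans; apply.
    by rewrite lerDl addr_ge0 ?harmonic_ge0.
  move=> h; rewrite all_map; apply/allP => q ql /=.
  have hk k : tcoef (val (incr (rough_path_fun (Xbar omega)) (t + q.1.1.1) (t + q.1.1.2))) q.1.2
      <= q.2 + (harmonic k + harmonic k).
    by have := h k I; rewrite /= !all_map => /allP/(_ q ql).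
  have lim : q.2 + (harmonic k + harmonic k) @[k --> \oo] --> q.2.
    rewrite -[X in _ --> X]addr0 -[X in _ --> _ + X]addr0.
    by apply: cvgD; [exact: cvg_cst|apply: cvgD; exact: cvg_harmonic].
  by apply: (cvgr_to_ge lim); exact: nearW.
have cvF : P \o F @ \oo --> P (\bigcap_k F k).
  apply: nonincreasing_cvg_mu => //.
  - by rewrite (le_lt_trans (probability_le1 P (mF 0%N)))// ltry.
  - exact: bigcapT_measurable.
  - move=> k k' kk'; apply/subsetPset => omega; rewrite /F /path_box /shift_constraints /slack /=.
    rewrite !all_map => /allP h; apply/allP => q ql; apply: le_trans (h q ql) _ => /=.
    by rewrite lerD2l lerD// lef_pV2 ?posrE// ler_nat ltnS.
apply: cvge_ge cvF; apply: nearW => k /=; apply: slack_le.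
exact: harmonic_gt0.
Qed.

End stationarity.

(** * The shift on the space of rough paths *)

(** A function that is measurable in the first variable and continuous in the
    second one is the limit of its discretizations in the second variable, which
    are jointly measurable. *)
Lemma measurable_fun_caratheodory {R : realType} {disp} {T : measurableType disp}
    (g : T -> R -> R) :
  (forall t, measurable_fun setT (g ^~ t)) -> (forall x, continuous (g x)) ->
  measurable_fun [set: T * R] (fun z => g z.1 z.2).
Proof.
move=> mg cg.
pose step (n : nat) (t : R) : R := (Num.floor (t * n.+1%:R))%:~R / n.+1%:R.
have step_cvg t : step n t @[n --> \oo] --> t.
  apply/cvgrPdist_le => e e0; near=> n.
  have n0 : 0 < n.+1%:R :> R by rewrite ltr0n.
  have /andP[h1 h2] := floor_itv (t * n.+1%:R).
  have -> : t - step n t = (t * n.+1%:R - (Num.floor (t * n.+1%:R))%:~R) / n.+1%:R.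
    by rewrite mulrBl mulfK ?gt_eqF.
  rewrite normrM [`|_^-1|]ger0_norm ?invr_ge0// ler_pdivrMr//.
  apply: (@le_trans _ _ 1).
    by move: h2; rewrite ger0_norm ?subr_ge0// intrD; lra.
  rewrite mulrC -ler_pdivrMr// div1r; apply: (@le_trans _ _ n%:R); last by rewrite ler_nat.
  by near: n; exact: nbhs_infty_ger.
apply: (@measurable_fun_cvg _ _ _ _ (fun n z => g z.1 (step n z.2))); last first.
  by move=> [x t] _ /=; apply: (cvg_comp (fun n => step n t) (g x) (step_cvg t)); exact: cg.
move=> n _ B mB; rewrite setTI.
have n0 : 0 < n.+1%:R :> R by rewrite ltr0n.
rewrite (_ : _ @^-1` _ = \bigcup_(k : int) (((g ^~ (k%:~R / n.+1%:R)) @^-1` B) `*`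
    [set t | Num.floor (t * n.+1%:R) = k])).
  apply: countable_bigcupT_measurable => [|k]; first exact: countableP.
  apply: measurableX; first by rewrite -[X in measurable X]setTI; exact: mg.
  rewrite (_ : [set t | _] = `[k%:~R / n.+1%:R, (k + 1)%:~R / n.+1%:R[%classic)//.
  apply/seteqP; split => t /=; rewrite in_itv/= ler_pdivrMr// ltr_pdivlMr//.
    by move=> fk; have := floor_itv (t * n.+1%:R); rewrite fk.
  by move=> tk; exact: floor_def.
apply/seteqP; split => [[x t] /= Bg|[x t] [k _ [/= Bg fk]]].
  by exists (Num.floor (t * n.+1%:R)).
by rewrite /step fk.
Unshelve. all: by end_near. Qed.

Section shift_system.
Context {R : realType} {d : nat} (nrm : tensor_norm R d) (p : R) (p1 : 1 < p).
Local Notation N := (Num.truncn p).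
Local Notation RP := (rough_path nrm p).

Definition shift_rough_path (tau : R) (Y : RP) : RP :=
  exist _ (shift_path tau (rough_path_fun Y))
    (mem_set (C0_pvar_shift tau (ltW p1) (rough_pathP Y))).

Lemma rough_path_fun_inj (Y Z : RP) : rough_path_fun Y = rough_path_fun Z -> Y = Z.
Proof. exact: val_inj. Qed.

Lemma shift_rough_path_0 : shift_rough_path 0 = id.
Proof.
apply/funext => Y; apply: rough_path_fun_inj; apply/funext => t.
rewrite /rough_path_fun /= /shift_path add0r /incr.
by rewrite -[val Y]/(rough_path_fun Y) rough_path0 invg1 mul1g.
Qed.

Lemma shift_rough_pathD s t :
  shift_rough_path (s + t) = shift_rough_path s \o shift_rough_path t.
Proof.
apply/funext => Y; apply: rough_path_fun_inj; apply/funext => u.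
rewrite /rough_path_fun /= -[RHS]/(incr (shift_path t (rough_path_fun Y)) s (s + u)).
by rewrite incr_shift_path /shift_path [s + t]addrC addrA.
Qed.

(** By continuity of the increments in time and the separability of the path
    space, measurability in the path for each fixed time suffices. *)
Lemma measurable_shift_rough_path :
  measurable_fun [set: RP * R] (fun z => shift_rough_path z.2 z.1).
Proof.
apply: (measurable_fun_rough_path p1) => s t w st wN.
rewrite (_ : (fun _ => _) = fun z : RP * R =>
  tcoef (val (incr (rough_path_fun z.1) (z.2 + s) (z.2 + t))) w); last first.
  apply/funext => z; rewrite -[rough_path_fun _]/(shift_path z.2 (rough_path_fun z.1)).
  by rewrite incr_shift_path.
apply: (@measurable_fun_caratheodory _ _ _ (fun (Y : RP) tau =>
  tcoef (val (incr (rough_path_fun Y) (tau + s) (tau + t))) w)).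
  by move=> tau; apply: measurable_fun_incr_coef => //; rewrite lerD2l.
move=> Y tau; have [cY _] := rough_pathP Y.
have H := @incr_coef_cvg R d N R (nbhs tau) (nbhs_filter tau) (rough_path_fun Y)
  (fun u => u + s) (fun u => u + t) (tau + s) (tau + t).
have cD r : r + u @[u --> tau] --> tau + r.
  by rewrite [tau + r]addrC; apply: cvgD; [exact: cvg_cst|exact: cvg_id].
apply: H => // v _.
- apply: (@cvg_comp _ _ _ (fun u => u + s) (fun u => tcoef (val (rough_path_fun Y u)) v)
    (nbhs tau) (nbhs (tau + s))); last exact: cY.
  by apply: cvgD; [exact: cvg_id|exact: cvg_cst].
- apply: (@cvg_comp _ _ _ (fun u => u + t) (fun u => tcoef (val (rough_path_fun Y u)) v)
    (nbhs tau) (nbhs (tau + t))); last exact: cY.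
  by apply: cvgD; [exact: cvg_id|exact: cvg_cst].
Qed.

Lemma measurable_shift_rough_path_at tau : measurable_fun setT (shift_rough_path tau).
Proof.
apply: (@measurableT_comp _ _ _ _ _ _ (fun z : RP * R => shift_rough_path z.2 z.1) _
  (fun Y => (Y, tau))); first exact: measurable_shift_rough_path.
exact: measurable_pair2.
Qed.

HB.instance Definition _ tau := isMeasurableFun.Build _ _ _ _ (shift_rough_path tau)
  (measurable_shift_rough_path_at tau).

Context {disp : measure_display} {Omega : measurableType disp} (P : probability Omega R)
  (X : 'I_d -> R -> {RV P >-> R}) (Xbar : {RV P >-> RP}).
Hypothesis (Xstat : stationary_increments X) (Xlift : natural_lift X Xbar).

Lemma shift_incr_box tau l :
  shift_rough_path tau @^-1` (incr_box l) = incr_box (shift_constraints tau l).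
Proof.
by apply/seteqP; split => Y; rewrite /preimage/= /incr_box/=
  -/(path_box l (shift_path tau (rough_path_fun Y))) path_box_shift.
Qed.

Lemma law_incr_box tau l : all (fun q : R * R * N.-bseq 'I_d * R => q.1.1.1 <= q.1.1.2) l ->
  P (Xbar @^-1` incr_box l) = P (Xbar @^-1` incr_box (shift_constraints tau l)).
Proof.
move=> ll; apply/eqP; rewrite eq_le; apply/andP; split.
  exact: (box_le_shift p1 Xstat Xlift tau ll).
have ll' : all (fun q : R * R * N.-bseq 'I_d * R => q.1.1.1 <= q.1.1.2) (shift_constraints tau l).
  by rewrite all_map; apply: sub_all ll => q /=; rewrite lerD2l.
have := box_le_shift p1 Xstat Xlift (- tau) ll'.
rewrite (_ : shift_constraints (- tau) (shift_constraints tau l) = l)//.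
rewrite /shift_constraints -map_comp -[RHS]map_id; apply: eq_map => -[[[s t] w] c] /=.
by rewrite !addKr.
Qed.

(** The boxes form a pi-system that generates the Borel sigma-algebra. *)
Lemma law_shift_rough_path tau (A : set RP) : measurable A ->
  distribution P Xbar (shift_rough_path tau @^-1` A) = distribution P Xbar A.
Proof.
move=> mA; pose m1 : probability RP R := distribution P Xbar.
pose m2 : probability RP R := distribution m1 (shift_rough_path tau).
suff : m2 A = m1 A by [].
apply: (@measure_unique _ R _ (@incr_boxes R d nrm p) (fun=> setT)) => //.
- exact: measurable_rough_pathE.
- exact: incr_boxesI.
- move=> _; exists [::] => //.
  by apply/seteqP; split.
- by apply/seteqP; split => // Y _; exists 0%N.
- move=> _ [l ll <-].
  rewrite [LHS](_ : _ = P (Xbar @^-1` (shift_rough_path tau @^-1` incr_box l)))//.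
  by rewrite shift_incr_box; exact/esym/law_incr_box.
- by move=> _; rewrite (le_lt_trans (probability_le1 _ _))// ltry.
Qed.

Definition rough_path_id (Y : RP) : RP := Y.

Lemma measurable_rough_path_id : measurable_fun setT rough_path_id.
Proof. exact: measurable_id. Qed.

HB.instance Definition _ := isMeasurableFun.Build _ _ _ _ rough_path_id
  measurable_rough_path_id.

End shift_system.

(** * The cocycle *)

Theorem corollary9 (R : realType) (d : nat) (nrm : tensor_norm R d)
    (disp0 : measure_display) (Omega0 : measurableType disp0)
    (P0 : probability Omega0 R) (X : 'I_d -> R -> {RV P0 >-> R}) (rho : R)
    (Xcont : continuous_paths X) (Xgauss : gaussian_process X)
    (Xcent : centered X) (Xstat : stationary_increments X)
    (Xindep : independent_components X) (hrho : 1 <= rho < 2)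
    (hcov : forall (s t : R) (i : 'I_d), s <= t ->
       finite_2d_variation rho s t (cov X i))
    (p : R) (hp : 2 * rho < p)
    (Xbar : {RV P0 >-> rough_path nrm p}) (hXbar : natural_lift X Xbar) :
  exists (disp : measure_display) (Omega : measurableType disp)
      (P : probability Omega R) (theta : R -> Omega -> Omega)
      (bX : {RV P >-> rough_path nrm p}),
    [/\ metric_dynamical_system P theta,
        (forall A : set (rough_path nrm p), measurable A ->
           distribution P bX A = distribution P0 Xbar A) &
        forall (omega : Omega) (s t : R),
          incr (rough_path_fun (bX omega)) s (s + t) =
          rough_path_fun (bX (theta s omega)) t].
Proof.
have p1 : 1 < p by lra.
exists _, (rough_path nrm p), (distribution P0 Xbar), (shift_rough_path p1),
  (@rough_path_id R d nrm p); split.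
- split.
  + exact: measurable_shift_rough_path.
  + exact: shift_rough_path_0.
  + exact: shift_rough_pathD.
  + by move=> t A mA; exact: (law_shift_rough_path p1 Xstat hXbar).
- by [].
- by [].
Qed.
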